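(* Let $(u_m,w_m)$ be a minimizing sequence for $I$ with $u_m,w_m\ge0$, i.e. $(u_m,w_m)\in\mathcal{N}$, $N(u_m,w_m)=1$ for all $m$, and $K(u_m,w_m)\to I$. Then there exist a subsequence $(u_{m_j},w_{m_j})$ and sequences $(R_j)\subset(0,\infty)$, $(y_j)\subset\mathbb{R}^4$ such that \[ v_j(x):=R_j^{-1}u_{m_j}(R_j^{-1}(x-y_j)),\qquad z_j(x):=R_j^{-1}w_{m_j}(R_j^{-1}(x-y_j)) \] converge strongly in $\dot H^1(\mathbb{R}^4)\times\dot H^1(\mathbb{R}^4)$ to some $(v,z)\in\mathcal{N}$ which is a minimizer for $I$, i.e. $N(v,z)=1$ and $K(v,z)=I$.
   Context: Real-valued functions. $K(u,w)=\int(|\nabla u|^2+|\nabla w|^2)$, $N(u,w)=\int(\frac1{36}u^4+\frac94w^4+u^2w^2+\frac19u^3w)$, $\mathcal{N}=\{(u,w)\in\dot H^1(\mathbb{R}^4)^2:N(u,w)>0\}$, $I=\inf\{K(u,w):(u,w)\in\mathcal{N},N(u,w)=1\}$. *)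

(* Defs.v *)
From HB Require Import structures.
From mathcomp Require Import all_boot all_order all_algebra.
From mathcomp Require Import all_classical all_reals all_analysis.
Set Implicit Arguments. Unset Strict Implicit. Unset Printing Implicit Defensive.
Import Order.TTheory GRing.Theory Num.Theory.
Import numFieldNormedType.Exports.
Local Open Scope classical_set_scope.
Local Open Scope ring_scope.

(* R^4, realised as ((R * R) * R) * R: it carries the product normed-module
   structure (used for derivatives) and, convertibly, the product of the
   Borel/Lebesgue measurable structures. *)
Definition R4 (R : realType) := (((R * R) * R) * R)%type.

Section Defs.
Variable R : realType.
Local Notation E := (R4 R).

Definition leb4 := ((((@lebesgue_measure R) \x (@lebesgue_measure R))
                      \x (@lebesgue_measure R)) \x (@lebesgue_measure R))%E.

Definition e4 (i : 'I_4) : E :=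
  match val i with
  | 0 => (1, 0, 0, 0)
  | 1 => (0, 1, 0, 0)
  | 2 => (0, 0, 1, 0)
  | _ => (0, 0, 0, 1)
  end.

Fixpoint Ck (k : nat) (f : E -> R) : Prop :=
  match k with
  | 0 => continuous f
  | k.+1 => (forall x, differentiable f x) /\ (forall v : E, Ck k ('D_v f))
  end.

Definition smooth (f : E -> R) : Prop := forall k, Ck k f.

Definition test_fun (phi : E -> R) : Prop :=
  smooth phi /\ compact (closure [set x | phi x != 0]).

Definition Lp4 (p : nat) (f : E -> R) : Prop :=
  measurable_fun setT f /\ (\int[leb4]_x (`|f x| ^+ p)%:E < +oo)%E.

Definition weak_grad (u : E -> R) (g : 'I_4 -> E -> R) : Prop :=
  forall (i : 'I_4) (phi : E -> R), test_fun phi ->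
    leb4.-integrable setT (fun x => (u x * 'D_(e4 i) phi x)%:E) /\
    leb4.-integrable setT (fun x => (g i x * phi x)%:E) /\
    (\int[leb4]_x (u x * 'D_(e4 i) phi x)%:E
       = - \int[leb4]_x (g i x * phi x)%:E)%E.

Definition L2_weak_grad (u : E -> R) (g : 'I_4 -> E -> R) : Prop :=
  (forall i, Lp4 2 (g i)) /\ weak_grad u g.

Definition Hdot1 (u : E -> R) : Prop :=
  Lp4 4 u /\ exists g, L2_weak_grad u g.

(* the (a.e. unique) weak gradient of u, chosen when it exists *)
Definition grad (u : E -> R) : 'I_4 -> E -> R :=
  xget (fun _ _ => 0) [set g | L2_weak_grad u g].

Definition Kfun (u w : E -> R) : R :=
  Rintegral leb4 setT
    (fun x => \sum_(i < 4) (grad u i x ^+ 2 + grad w i x ^+ 2)).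

Definition Nfun (u w : E -> R) : R :=
  Rintegral leb4 setT
    (fun x => 36^-1 * u x ^+ 4 + 9 / 4 * w x ^+ 4 + u x ^+ 2 * w x ^+ 2
              + 9^-1 * (u x ^+ 3 * w x)).

Definition inNN (u w : E -> R) : Prop :=
  Hdot1 u /\ Hdot1 w /\ 0 < Nfun u w.

Definition Ival : R :=
  inf [set k | exists u w, inNN u w /\ Nfun u w = 1 /\ k = Kfun u w].

Definition rescale (r : R) (y : E) (u : E -> R) : E -> R :=
  fun x => r^-1 * u (r^-1 *: (x - y)).

End Defs.

(* Main.v *)
Require Import Defs.
From HB Require Import structures.
From mathcomp Require Import all_boot all_order all_algebra.
From mathcomp Require Import all_classical all_reals all_analysis.
From mathcomp Require Import measurable_realfun ring lra.
Set Implicit Arguments. Unset Strict Implicit. Unset Printing Implicit Defensive.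
Import Order.TTheory GRing.Theory Num.Theory.
Import numFieldNormedType.Exports.
Local Open Scope classical_set_scope.
Local Open Scope ring_scope.

(** Concentration-compactness without rearrangements.  If the averages of |u|
over cubes of side r are at most M / r, then the L^4 norm satisfies
|u|_4^4 <= C M^2 |grad u|_2^2 ([refined_sobolev]).  Hence a bounded sequence
with N = 1 has, after rescaling and translating, averages over the unit cube
that stay away from 0.  Along an ultrafilter U on the indices the rescaled
sequence has a weak limit (v, z), the remainder (d, e) tends to 0 in L^2 on
bounded sets, and so K and N split asymptotically:
K(d, e) -> I - K(v, z) and N(d, e) -> 1 - N(v, z).
By homogeneity I^2 N <= K^2 for every pair, so a = K(v, z) / I satisfies
1 <= a^2 + (1 - a)^2, i.e. a = 0 or a = 1; a = 0 is excluded by the averages.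
Thus K(d, e) -> 0 along U, and a subsequence is extracted from U. *)

(** * L^2 spaces and weak limits *)

(** K and N do not change under translations and under u -> r u(r x), so a minimizing sequence can
    converge weakly to 0; a lower bound on the unit cube averages fixes both parameters at once. It
    comes from N = 1: since N <= 3 (|u|_4^4 + |w|_4^4), one component keeps a fixed amount of L^4
    norm, which the refined inequality turns into a large average. The same inequality contains the
    usual Sobolev inequality (take M of the order of |u|_4), hence I > 0 and all L^4 bounds. An
    ultrafilter makes every bounded real sequence converge, so weak limits exist against all test
    functions simultaneously, with neither separability nor diagonal extraction. The price is that
    convergence theorems for sequences of integrals do not apply along it: the remainder is
    controlled by estimates uniform in the index. The remainder satisfies the same inequality I^2 N
    <= K^2 as the limit. Hence it needs no further decomposition, and strict convexity of the square
    takes the place of a strict subadditivity condition. *)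

Section L2.
Context d (T : measurableType d) (R : realType) (mu : {measure set T -> \bar R}).
Implicit Types f g h : T -> R.

Definition intg f := mu.-integrable setT (EFin \o f).

Lemma intg_meas f : intg f -> measurable_fun setT f.
Proof. by move=> /integrableP[/measurable_EFinP]. Qed.

Lemma intg_ext f g : f =1 g -> intg f -> intg g.
Proof. by move=> /funext ->. Qed.

Lemma intgD f g : intg f -> intg g -> intg (fun x => f x + g x).
Proof. by move=> If Ig; apply: (integrableD _ If Ig). Qed.

Lemma intgZ k f : intg f -> intg (fun x => k * f x).
Proof. by move=> If; apply: (integrableZl _ k If). Qed.

Lemma intgN f : intg f -> intg (fun x => - f x).
Proof. by move=> If; apply: (integrableN If). Qed.

Lemma intgB f g : intg f -> intg g -> intg (fun x => f x - g x).
Proof. by move=> If Ig; apply: intgD => //; exact: intgN. Qed.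

Lemma intg_le f g : measurable_fun setT f -> (forall x, `|f x| <= g x) ->
  intg g -> intg f.
Proof.
move=> mf fg; apply: le_integrable => //; first exact/measurable_EFinP.
by move=> x _ /=; rewrite lee_fin (le_trans (fg x))// ler_norm.
Qed.

Lemma intg_ge0P f : measurable_fun setT f -> (forall x, 0 <= f x) ->
  (\int[mu]_x (f x)%:E < +oo)%E -> intg f.
Proof.
move=> mf f0 fi; apply/integrableP; split; first exact/measurable_EFinP.
by under eq_integral do rewrite /= ger0_norm//.
Qed.

Lemma intgK f : intg f -> ((\int[mu]_x f x)%:E = \int[mu]_x (f x)%:E)%E.
Proof. by move=> If; rewrite fineK//; exact: integrable_fin_num. Qed.

Lemma intD f g : intg f -> intg g ->
  \int[mu]_x (f x + g x) = \int[mu]_x f x + \int[mu]_x g x.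
Proof. by move=> If Ig; rewrite RintegralD. Qed.

Lemma intB f g : intg f -> intg g ->
  \int[mu]_x (f x - g x) = \int[mu]_x f x - \int[mu]_x g x.
Proof. by move=> If Ig; rewrite RintegralB. Qed.

Lemma intZ k f : intg f -> \int[mu]_x (k * f x) = k * \int[mu]_x f x.
Proof. by move=> If; rewrite RintegralZl. Qed.

Lemma int_le f g : intg f -> intg g -> (forall x, f x <= g x) ->
  \int[mu]_x f x <= \int[mu]_x g x.
Proof. by move=> If Ig fg; apply: le_Rintegral. Qed.

Lemma int_ge0 f : (forall x, 0 <= f x) -> 0 <= \int[mu]_x f x.
Proof. by move=> f0; apply: Rintegral_ge0. Qed.

Lemma int_ae f g : measurable_fun setT f -> measurable_fun setT g ->
  {ae mu, forall x, f x = g x} -> \int[mu]_x f x = \int[mu]_x g x.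
Proof.
move=> mf mg fg; rewrite /Rintegral; congr fine.
apply: ae_eq_integral => //; try exact/measurable_EFinP.
by apply: filterS fg => x + _; move=> ->.
Qed.

Lemma intg_indic (A : set T) : measurable A -> (mu A < +oo)%E -> intg (\1_A).
Proof.
by move=> mA Ao; apply: intg_ge0P => //; rewrite integral_indic// setIT.
Qed.

Lemma ae_imp (P Q : T -> Prop) : (forall x, P x -> Q x) ->
  {ae mu, forall x, P x} -> {ae mu, forall x, Q x}.
Proof. by move=> PQ; apply: filterS => x; exact: PQ. Qed.

Definition L2 f := measurable_fun setT f /\ intg (fun x => f x ^+ 2).

Lemma L2_meas f : L2 f -> measurable_fun setT f. Proof. by case. Qed.
Lemma L2_intg f : L2 f -> intg (fun x => f x ^+ 2). Proof. by case. Qed.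

Lemma L2_mul f g : L2 f -> L2 g -> intg (fun x => f x * g x).
Proof.
move=> [mf If] [mg Ig].
apply: (@intg_le _ (fun x => f x ^+ 2 + g x ^+ 2)).
- exact: measurable_funM.
- move=> x; rewrite ler_norml; nra.
- exact: intgD.
Qed.

Lemma L2D f g : L2 f -> L2 g -> L2 (fun x => f x + g x).
Proof.
move=> Lf Lg; split; first by apply: measurable_funD; [case: Lf|case: Lg].
apply: (@intg_ext (fun x => f x ^+ 2 + 2 * (f x * g x) + g x ^+ 2)).
  by move=> x; ring.
apply: intgD; last by case: Lg.
by apply: intgD; [case: Lf|apply: intgZ; exact: L2_mul].
Qed.

Lemma L2Z k f : L2 f -> L2 (fun x => k * f x).
Proof.
move=> [mf If]; split; first exact: measurable_funM.
by apply: (@intg_ext (fun x => k ^+ 2 * f x ^+ 2)) => [x|]; [ring|exact: intgZ].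
Qed.

Lemma L2B f g : L2 f -> L2 g -> L2 (fun x => f x - g x).
Proof.
move=> Lf /(L2Z (-1)) Lg; have := L2D Lf Lg.
by rewrite (_ : (fun x => _) = (fun x => f x - g x))//; apply/funext => x; ring.
Qed.

Lemma int_sqrD f g : L2 f -> L2 g ->
  \int[mu]_x (f x + g x) ^+ 2 =
  \int[mu]_x f x ^+ 2 + 2 * \int[mu]_x (f x * g x) + \int[mu]_x g x ^+ 2.
Proof.
move=> Lf Lg; rewrite -intZ ?intD//; try by [case: Lf|case: Lg|exact: L2_mul].
rewrite -!intD; first by apply: eq_Rintegral => x _; ring.
- by apply: intgD; [case: Lf|apply: intgZ; exact: L2_mul].
- by case: Lg.
- by case: Lf.
- by apply: intgZ; exact: L2_mul.
Qed.

Lemma int_sqrDZ f g t : L2 f -> L2 g ->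
  \int[mu]_x (f x + t * g x) ^+ 2 =
  \int[mu]_x f x ^+ 2 + 2 * t * \int[mu]_x (f x * g x) +
  t ^+ 2 * \int[mu]_x g x ^+ 2.
Proof.
move=> Lf Lg; rewrite int_sqrD//; last exact: L2Z.
have -> : \int[mu]_x (f x * (t * g x)) = t * \int[mu]_x (f x * g x).
  by rewrite -intZ; [apply: eq_Rintegral => x _; ring|exact: L2_mul].
have -> : \int[mu]_x (t * g x) ^+ 2 = t ^+ 2 * \int[mu]_x g x ^+ 2.
  by rewrite -intZ; [apply: eq_Rintegral => x _; ring|case: Lg].
by rewrite mulrA.
Qed.

Lemma cauchy_schwarz f g : L2 f -> L2 g ->
  (\int[mu]_x (f x * g x)) ^+ 2 <= \int[mu]_x f x ^+ 2 * \int[mu]_x g x ^+ 2.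
Proof.
move=> Lf Lg.
set A := \int[mu]_x f x ^+ 2; set B := \int[mu]_x g x ^+ 2.
set c := \int[mu]_x (f x * g x).
have H t : 0 <= A + 2 * t * c + t ^+ 2 * B.
  by rewrite -int_sqrDZ//; apply: int_ge0 => x; exact: sqr_ge0.
have A0 : 0 <= A by apply: int_ge0 => x; exact: sqr_ge0.
have B0 : 0 <= B by apply: int_ge0 => x; exact: sqr_ge0.
have [B0'|Bn] := eqVneq B 0.
  have [->|cn] := eqVneq c 0; first by rewrite expr0n mulr_ge0.
  (* With B = 0 the quadratic is affine in t, and this t gives it the value -1. *)
  have := H (- (A + 1) / (2 * c)); rewrite B0' !mulr0 addr0.
  have -> : 2 * (- (A + 1) / (2 * c)) * c = - (A + 1) by field.
  lra.
have Bp : 0 < B by rewrite lt_def Bn.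
have := H (- c / B).
have -> : A + 2 * (- c / B) * c + (- c / B) ^+ 2 * B = (A * B - c ^+ 2) / B.
  by field.
by rewrite pmulr_lge0 ?invr_gt0// subr_ge0.
Qed.

End L2.

(** * Completeness of L^2 along rapidly converging sequences *)

Section complete.
Context d (T : measurableType d) (R : realType) (mu : {measure set T -> \bar R}).
Implicit Types f g h : T -> R.

(** Weighted Cauchy-Schwarz for a telescoping sum: the weights 2^-(n + k) add up to at most 2 *
    2^-n. *)
Lemma telescope_sqr_le (a : nat -> R) n m :
  (a (n + m)%N - a n) ^+ 2 <=
  2 * 2 ^- n * \sum_(k < m) 2 ^+ (n + k) * (a (n + k).+1 - a (n + k)%N) ^+ 2.
Proof.
elim: m n => [|m IH] n; first by rewrite addn0 subrr expr0n big_ord0 mulr0.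
rewrite big_ord_recl /= addn0 mulrDr.
have := IH n.+1.
set S1 := \sum_(i < m) _; set S2 := \sum_(i < m) _.
have -> : S1 = S2.
  by apply: eq_bigr => i _; rewrite /bump /= !addSn !addnS.
rewrite addSnnS => H.
have -> : 2 * 2 ^- n * (2 ^+ n * (a n.+1 - a n) ^+ 2) = 2 * (a n.+1 - a n) ^+ 2.
  by rewrite mulrA -(mulrA 2) mulVf ?mulr1// expf_neq0.
have E : 2 * 2 ^- n.+1 = 2 ^- n :> R.
  by rewrite exprS invfM mulrA divff ?mul1r.
rewrite E in H.
have -> : 2 * 2 ^- n * S2 = 2 * (2 ^- n * S2) by rewrite mulrA.
have := sqr_ge0 ((a (n + m.+1)%N - a n.+1) - (a n.+1 - a n)); nra.
Qed.

Lemma geometric_half_le n : \sum_(k < n) 2 ^- k <= 2 :> R.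
Proof.
suff -> : \sum_(k < n) 2 ^- k = 2 - 2 * 2 ^- n :> R.
  by rewrite lerBlDr lerDl mulr_ge0// invr_ge0 exprn_ge0.
elim: n => [|n IH]; first by rewrite big_ord0 expr0 invr1 mulr1 subrr.
by rewrite big_ord_recr /= IH exprS invfM; field; rewrite expf_neq0.
Qed.

Lemma L2_of_int_lt f : measurable_fun setT f ->
  (\int[mu]_x (f x ^+ 2)%:E < +oo)%E -> L2 mu f.
Proof.
move=> mf fi; split=> //; apply: intg_ge0P => //; first exact: measurable_funX.
by move=> x; exact: sqr_ge0.
Qed.

(** The weighted series S of squared increments has integral at most the sum of 2^k 4^-k, that is 2,
    and (f n - g)^2 <= 2 * 2^-n S holds at every point, trivially where S is infinite. Integrating
    this gives the factor 4. *)
Lemma L2_complete (f : nat -> T -> R) : (forall n, L2 mu (f n)) ->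
  (forall n, \int[mu]_x (f n.+1 x - f n x) ^+ 2 <= 4 ^- n) ->
  exists g, L2 mu g /\
    forall n, \int[mu]_x (f n x - g x) ^+ 2 <= 4 * 2 ^- n.
Proof.
move=> Lf fn.
pose a k x : R := 2 ^+ k * (f k.+1 x - f k x) ^+ 2.
have a0 k x : 0 <= a k x by rewrite /a mulr_ge0 ?sqr_ge0 ?exprn_ge0.
have ma k : measurable_fun setT (a k).
  apply: measurable_funM => //; apply: measurable_funX; apply: measurable_funB.
    exact: L2_meas (Lf _).
  exact: L2_meas (Lf _).
pose S x := (\sum_(k <oo) (a k x)%:E)%E.
have S0 x : (0 <= S x)%E by apply: nneseries_ge0 => k _ _; rewrite lee_fin.
have IS : (\int[mu]_x S x <= 2%:E)%E.
  rewrite integral_nneseries//; last 2 first.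
  - by move=> n; exact/measurable_EFinP.
  - by move=> n x _; rewrite lee_fin.
  apply: lime_le.
    apply: is_cvg_nneseries => n _ _; apply: integral_ge0 => x _.
    by rewrite lee_fin.
  apply: nearW => n; rewrite big_mkord.
  apply: (@le_trans _ _ (\sum_(k < n) (2 ^- k)%:E)%E).
    apply: lee_sum => k _.
    have Ia : intg mu (fun x => (f k.+1 x - f k x) ^+ 2).
      by have [] := L2B (Lf k.+1) (Lf k).
    rewrite -intgK; last exact: intgZ.
    rewrite lee_fin intZ//.
    apply: (le_trans (ler_wpM2l (exprn_ge0 _ _) (fn k))) => //.
    have -> : 4 = 2 * 2 :> R by ring.
    by rewrite exprMn_comm ?invfM ?mulrA ?divff ?mul1r ?expf_neq0//; exact: mulrC.
  by rewrite sumEFin lee_fin geometric_half_le.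
have mS : measurable_fun setT S.
  apply: (@emeasurable_fun_cvg _ _ _ _ (fun n x => (\sum_(k < n) (a k x)%:E)%E)).
    by move=> n; apply: emeasurable_sum => k; exact/measurable_EFinP.
  move=> x _; rewrite /S.
  have := @is_cvg_nneseries R (fun k => (a k x)%:E) xpredT 0%N.
  by under eq_fun do rewrite big_mkord; apply=> n _ _; rewrite lee_fin.
pose D := [set x | (S x < +oo)%E].
have mD : measurable D.
  by rewrite -[D]setTI; apply: emeasurable_fun_infty_o.
have Sle n x : ((\sum_(k < n) a k x)%:E <= S x)%E.
  rewrite -sumEFin -(big_mkord xpredT (fun k => (a k x)%:E)).
  by apply: nneseries_lim_ge => k _ _; rewrite lee_fin.
have key n m x : (((f (n + m)%N x - f n x) ^+ 2)%:E <= (2 * 2 ^- n)%:E * S x)%E.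
  have /(_ (f ^~ x)) := telescope_sqr_le _ n m.
  rewrite -lee_fin => /le_trans; apply; rewrite EFinM lee_pmul2l//.
  apply: (le_trans _ (Sle (n + m)%N x)); rewrite lee_fin big_split_ord /=.
  by rewrite lerDr sumr_ge0.
(* Cutting to the set where S is finite makes the sequence converge at every point, so its limit is
   measurable. *)
pose g_ n x := f n x * \1_D x.
have cvg_g x : cvg (g_ ^~ x @ \oo).
  have [xD|xD] := boolP (x \in D); last first.
    rewrite (_ : g_ ^~ x = cst 0); first exact: is_cvg_cst.
    by apply/funext => n; rewrite /g_ indicE (negbTE xD) mulr0.
  have := xD; rewrite inE /D /= => Sx.
  pose s := fine (S x).
  have sE : S x = s%:E by rewrite fineK// ge0_fin_numE.
  have s0 : 0 <= s by rewrite -lee_fin -sE.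
  rewrite (_ : g_ ^~ x = f ^~ x); last first.
    by apply/funext => n; rewrite /g_ indicE xD mulr1.
  apply/cauchy_cvgP/cauchy_exP => e e0.
  have [n Hn] : exists n, 2 * 2 ^- n * s < e ^+ 2.
    have := @cvg_geometric R (2 * s) 2^-1.
    rewrite ger0_norm ?invr_ge0// invf_lt1 ?ltr1n// => /(_ isT).
    move/cvgrPdist_lt => /(_ (e ^+ 2)); rewrite exprn_gt0// => /(_ isT)[n _ Hn].
    exists n; have := Hn n (leqnn n); rewrite /= sub0r normrN.
    by move/(le_lt_trans (ler_norm _)); rewrite mulrAC exprVn.
  exists (f n x); exists n => // k /= nk; rewrite -(subnKC nk).
  rewrite /ball /= distrC -(@ltr_pXn2r _ 2)// ?nnegrE//; last exact: ltW.
  rewrite real_normK ?num_real//; apply: le_lt_trans Hn.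
  by rewrite -lee_fin [X in (_ <= X)%E]EFinM -sE; exact: key.
pose g x := lim (g_ ^~ x @ \oo).
have mg : measurable_fun setT g.
  apply: (@measurable_fun_cvg _ _ _ _ g_) => [n|x _]; last exact: cvg_g.
  by apply: measurable_funM; [exact: L2_meas (Lf n)|exact: measurable_indic].
have key2 n x : (((f n x - g x) ^+ 2)%:E <= (2 * 2 ^- n)%:E * S x)%E.
  have [Sx|] := boolP (S x < +oo)%E; last first.
    by rewrite -leNgt leye_eq => /eqP ->; rewrite gt0_muley ?leey.
  have xD : x \in D by rewrite inE.
  have sE : S x = (fine (S x))%:E by rewrite fineK// ge0_fin_numE.
  rewrite sE -EFinM lee_fin.
  have cg : f ^~ x @ \oo --> g x.
    suff -> : f ^~ x = g_ ^~ x by exact: cvg_g.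
    by apply/funext => k; rewrite /g_ indicE xD mulr1.
  have : (f n x - f m x) ^+ 2 @[m --> \oo] --> (f n x - g x) ^+ 2.
    rewrite expr2; under eq_fun do rewrite expr2.
    by apply: cvgM; (apply: cvgB; [exact: cvg_cst|exact: cg]).
  move/cvgr_to_le; apply; exists n => // m /= nm.
  rewrite -sqrrN opprB -(subnKC nm) -lee_fin [X in (_ <= X)%E]EFinM -sE; exact: key.
have Lgn n : L2 mu (fun x => f n x - g x).
  apply: L2_of_int_lt; first by apply: measurable_funB => //; exact: L2_meas.
  apply: (@le_lt_trans _ _ (\int[mu]_x ((2 * 2 ^- n)%:E * S x))%E).
    apply: ge0_le_integral => //.
    - by move=> x _; rewrite lee_fin sqr_ge0.
    - apply/measurable_EFinP/measurable_funX/measurable_funB => //.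
      exact: L2_meas.
    - exact: measurable_funeM.
  rewrite ge0_integralZl//.
  by rewrite lte_mul_pinfty// (le_lt_trans IS)// ltry.
exists g; split.
  have := L2B (Lf 0%N) (Lgn 0%N).
  by rewrite (_ : (fun x => _) = g)//; apply/funext => x; ring.
move=> n; rewrite -lee_fin intgK; last by case: (Lgn n).
apply: (@le_trans _ _ (\int[mu]_x ((2 * 2 ^- n)%:E * S x))%E).
  apply: ge0_le_integral => //.
  - by move=> x _; rewrite lee_fin sqr_ge0.
  - apply/measurable_EFinP/measurable_funX/measurable_funB => //.
    exact: L2_meas.
  - exact: measurable_funeM.
rewrite ge0_integralZl//.
have -> : 4 * 2 ^- n = 2 * 2 ^- n * 2 :> R by ring.
rewrite [X in (_ <= X)%E]EFinM; apply: lee_pmul => //.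
by apply: integral_ge0.
Qed.
End complete.

(** * Riesz representation and weak limits along an ultrafilter *)

Section weak_limit.
Context d (T : measurableType d) (R : realType) (mu : {measure set T -> \bar R}).
Implicit Types f g h : T -> R.

(** By compactness the image filter has a cluster point, and a cluster point of an ultrafilter is a
    limit. *)
Lemma ultra_bounded_cvg (U : set_system nat) (a : nat -> R) (C : R) :
  UltraFilter U -> (forall n, `|a n| <= C) -> exists l : R, a @ U --> l.
Proof.
move=> UU aC.
have := @segment_compact R (- C) C => /(_ (a @ U) _).
case.
  suff : U (a @^-1` `[- C, C]) by [].
  by apply: (filterS _ (@filterT _ U _)) => n _ /=; rewrite in_itv /=; move: (aC n); rewrite ler_norml.
move=> p [_ clp]; exists p => B Bp.
have [//|nB] := in_ultra_setVsetC (a @^-1` B) UU.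
have [y []] := clp (~` B) B nB Bp.
by [].
Qed.

Lemma int_mul_cvg0 (I : Type) (F : set_system I) (f : I -> T -> R) h : Filter F ->
  (forall i, L2 mu (f i)) -> L2 mu h ->
  (fun i => \int[mu]_x (f i x) ^+ 2) @ F --> (0 : R) ->
  (fun i => \int[mu]_x (f i x * h x)) @ F --> (0 : R).
Proof.
move=> FF Lf Lh /cvgr0Pnorm_lt f0; apply/cvgr0Pnorm_lt => e e0.
set H := \int[mu]_x h x ^+ 2.
have H0 : 0 <= H by apply: int_ge0 => x; exact: sqr_ge0.
have : 0 < e ^+ 2 / (H + 1) by rewrite divr_gt0 ?exprn_gt0// ltr_wpDl.
move=> /f0; apply: filterS => i fi.
rewrite -(@ltr_pXn2r _ 2) ?nnegrE//; last exact: ltW.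
rewrite real_normK ?num_real//; apply: (le_lt_trans (cauchy_schwarz (Lf i) Lh)).
set A := \int[mu]_x f i x ^+ 2 in fi *.
have A0 : 0 <= A by apply: int_ge0 => x; exact: sqr_ge0.
rewrite ger0_norm// ltr_pdivlMr ?ltr_wpDl// in fi.
by apply: le_lt_trans fi; rewrite -/H ler_wpM2l// lerDl.
Qed.

(** The first-order condition at a minimum; the denominator H + 1 keeps the test value of t
    meaningful when H = 0. *)
Lemma quadratic_ge0_eq0 (H b : R) : 0 <= H ->
  (forall t, 0 <= t ^+ 2 * H + 2 * t * b) -> b = 0.
Proof.
move=> H0 /(_ (- b / (H + 1))) h.
have e : (- b / (H + 1)) ^+ 2 * H + 2 * (- b / (H + 1)) * b
  = - (b ^+ 2 * (H + 2)) / (H + 1) ^+ 2 by field; lra.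
move: h; rewrite e pmulr_lge0 ?invr_gt0 ?exprn_gt0 ?ltr_wpDl// oppr_ge0 => h.
apply/eqP; rewrite -sqrf_eq0 eq_le sqr_ge0 andbT.
by move: h; rewrite pmulr_lle0//; lra.
Qed.

(** The second hypothesis says that J h = |h|^2 - 2 L h is bounded below, which is what minimizing J
    requires; the minimizer represents L. In this form h = q also yields |q|^2 <= C at once. *)
Lemma riesz (L : (T -> R) -> R) (C : R) :
  (forall g h t, L2 mu g -> L2 mu h ->
    L (fun x => g x + t * h x) = L g + t * L h) ->
  (forall h, L2 mu h -> 2 * L h <= C + \int[mu]_x h x ^+ 2) ->
  exists2 q, L2 mu q & forall h, L2 mu h -> \int[mu]_x (q x * h x) = L h.
Proof.
move=> LD LC.
have sq0 h : 0 <= \int[mu]_x (h x) ^+ 2 by apply: int_ge0 => x; exact: sqr_ge0.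
have L0 : L2 mu (cst 0).
  split=> //; apply: (@intg_ext _ _ _ _ (cst 0)) => [x|]; last exact: integrable0.
  by rewrite /= expr0n.
have L00 : L (cst 0) = 0.
  have := LD _ _ 1 L0 L0; rewrite (_ : (fun x => _) = cst 0); first by lra.
  by apply/funext => x /=; ring.
have LZ h t : L2 mu h -> L (fun x => t * h x) = t * L h.
  move=> Lh; rewrite -[RHS]add0r -L00 -LD//; congr L.
  by apply/funext => x /=; rewrite add0r.
pose J h := \int[mu]_x h x ^+ 2 - 2 * L h.
have Jge h : L2 mu h -> - C <= J h.
  by move=> /LC; rewrite /J; lra.
pose A := [set J h | h in [set h | L2 mu h]].
have infA : has_inf A.
  split; first by exists (J (cst 0)); exists (cst 0).
  by exists (- C) => _ [h Lh <-]; exact: Jge.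
set i0 := inf A.
have iJ h : L2 mu h -> i0 <= J h.
  by move=> Lh; apply: ge_inf; [case: infA|exists h].
(* By the parallelogram identity |a - b|^2 = 2 J a + 2 J b - 4 J ((a + b) / 2), gaps of this size
   make the increments satisfy the bound 4^-n of [L2_complete]. *)
have : forall n, exists h, L2 mu h /\ J h < i0 + 4 ^- n / 4.
  move=> n; have [|_ [h Lh <-] Jh] := @inf_adherent R A (4 ^- n / 4) _ infA.
    by rewrite divr_gt0// invr_gt0 exprn_gt0.
  by exists h.
move=> /choice[g Pg].
have Lg n : L2 mu (g n) by case: (Pg n).
have [n|q [Lq gq]] := @L2_complete _ _ _ mu g Lg.
  have E1 := int_sqrDZ (-1) (Lg n.+1) (Lg n).
  have E2 := int_sqrDZ 1 (Lg n.+1) (Lg n).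
  have Ls := L2D (Lg n.+1) (L2Z 1 (Lg n)).
  have E3 : \int[mu]_x (2^-1 * (g n.+1 x + 1 * g n x)) ^+ 2 =
      4^-1 * \int[mu]_x (g n.+1 x + 1 * g n x) ^+ 2.
    rewrite -intZ; last by case: Ls.
    by apply: eq_Rintegral => x _; rewrite exprMn; congr (_ * _); field.
  have E4 := iJ _ (L2Z 2^-1 Ls).
  rewrite /J LZ// LD// E3 in E4.
  have [_ J1] := Pg n.+1; have [_ J2] := Pg n.
  have -> : \int[mu]_x (g n.+1 x - g n x) ^+ 2 =
            \int[mu]_x (g n.+1 x + -1 * g n x) ^+ 2.
    by apply: eq_Rintegral => x _; ring.
  have : 4 ^- n.+1 = 4^-1 * 4 ^- n :> R by rewrite exprS invfM.
  have : 0 < 4 ^- n :> R by rewrite invr_gt0 exprn_gt0.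
  rewrite /J in J1 J2; lra.
exists q => // h Lh.
suff : \int[mu]_x (q x * h x) - L h = 0 by move/eqP; rewrite subr_eq0 => /eqP.
apply: (@quadratic_ge0_eq0 (\int[mu]_x h x ^+ 2)) => // t.
have cgq : (fun n => \int[mu]_x ((g n x - q x) * h x)) @ \oo --> (0 : R).
  apply: int_mul_cvg0 => //; first by move=> n; exact: L2B.
  have c0 : (fun n => 4 * 2 ^- n : R) @ \oo --> (0 : R).
    have := @cvg_geometric R 4 2^-1.
    rewrite ger0_norm ?invr_ge0// invf_lt1 ?ltr1n// => /(_ isT).
    suff -> : geometric (4 : R) 2^-1 = (fun n => 4 * 2 ^- n) by [].
    by apply/funext => k; rewrite /geometric /= exprVn.
  apply: (squeeze_cvgr _ (cvg_cst 0) c0).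
  by apply: nearW => n; rewrite sq0 gq.
have c1 : (fun n => t ^+ 2 * \int[mu]_x h x ^+ 2 +
   2 * t * (\int[mu]_x ((g n x - q x) * h x) + \int[mu]_x (q x * h x) - L h)
   + 4^-1 * 4 ^- n) @ \oo --> t ^+ 2 * \int[mu]_x h x ^+ 2 +
   2 * t * (0 + \int[mu]_x (q x * h x) - L h) + 0.
  have c4 : (fun n => 4^-1 * 4 ^- n : R) @ \oo --> (0 : R).
    have := @cvg_geometric R 4^-1 4^-1.
    rewrite ger0_norm ?invr_ge0// invf_lt1 ?ltr1n// => /(_ isT).
    suff -> : geometric (4^-1 : R) 4^-1 = (fun n => 4^-1 * 4 ^- n) by [].
    by apply/funext => k; rewrite /geometric /= exprVn.
  apply: cvgD => //; apply: cvgD; first exact: cvg_cst.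
  apply: cvgM; first exact: cvg_cst.
  apply: cvgD; last exact: cvg_cst.
  by apply: cvgD => //; exact: cvg_cst.
rewrite add0r addr0 in c1.
apply: (cvgr_to_ge c1); apply: nearW => n.
have Lt := L2D (Lg n) (L2Z t Lh).
have := iJ _ Lt; rewrite /J LD// int_sqrDZ//.
have [_] := Pg n; rewrite /J.
have -> : \int[mu]_x ((g n x - q x) * h x) =
    \int[mu]_x (g n x * h x) - \int[mu]_x (q x * h x).
  rewrite -intB; [|exact: L2_mul..].
  by apply: eq_Rintegral => x _; ring.
lra.
Qed.

(** All pairings converge along U, and their limit is a linear functional; expanding 0 <= |f n -
    h|^2 gives it the bound that [riesz] asks for. *)
Lemma weak_limit (U : set_system nat) (f : nat -> T -> R) C : UltraFilter U ->
  (forall n, L2 mu (f n)) -> (forall n, \int[mu]_x (f n x) ^+ 2 <= C) ->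
  exists g, L2 mu g /\ forall h, L2 mu h ->
    (fun n => \int[mu]_x (f n x * h x)) @ U --> \int[mu]_x (g x * h x).
Proof.
move=> UU Lf fC.
pose L h := lim ((fun n => \int[mu]_x (f n x * h x)) @ U).
have sq0 h : 0 <= \int[mu]_x (h x) ^+ 2 by apply: int_ge0 => x; exact: sqr_ge0.
have cL h : L2 mu h -> (fun n => \int[mu]_x (f n x * h x)) @ U --> L h.
  move=> Lh.
  have [n|l cl] := @ultra_bounded_cvg U (fun n => \int[mu]_x (f n x * h x))
      (1 + C * \int[mu]_x h x ^+ 2) UU.
    have := cauchy_schwarz (Lf n) Lh.
    set c := (X in X ^+ 2 <= _) => cs.
    have {}cs : c ^+ 2 <= C * \int[mu]_x h x ^+ 2.
      by apply: (le_trans cs); apply: ler_wpM2r.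
    have : `|c| ^+ 2 <= C * \int[mu]_x h x ^+ 2 by rewrite real_normK ?num_real.
    have := sqr_ge0 (`|c| - 1).
    by have := normr_ge0 c; nra.
  by rewrite /L (cvg_lim _ cl).
have LD g h t : L2 mu g -> L2 mu h -> L (fun x => g x + t * h x) = L g + t * L h.
  move=> Lg Lh; apply/cvg_lim => //.
  rewrite (_ : (fun n => _) = (fun n => \int[mu]_x (f n x * g x) +
      t * \int[mu]_x (f n x * h x))); last first.
    apply/funext => n; rewrite -intZ; last exact: L2_mul.
    rewrite -intD; first by apply: eq_Rintegral => x _; ring.
    - exact: L2_mul.
    - by apply: intgZ; exact: L2_mul.
  by apply: cvgD; [exact: cL|apply: cvgM; [exact: cvg_cst|exact: cL]].
have LC h : L2 mu h -> 2 * L h <= C + \int[mu]_x h x ^+ 2.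
  move=> Lh; suff : L h <= (C + \int[mu]_x h x ^+ 2) / 2 by lra.
  apply: (cvgr_to_le (cL h Lh)); apply: nearW => n.
  have := int_sqrDZ (-1) (Lf n) Lh; have := fC n.
  have := sq0 (fun x => f n x + -1 * h x); lra.
have [q Lq qL] := riesz LD LC.
by exists q; split=> // h Lh; rewrite qL//; exact: cL.
Qed.

End weak_limit.

(** * Lebesgue measure on R^4 *)

Section product.
Context d1 d2 (T1 : measurableType d1) (T2 : measurableType d2) (R : realType).
Variable m1 : {sigma_finite_measure set T1 -> \bar R}.
Variable m2 : {sigma_finite_measure set T2 -> \bar R}.

Lemma product_sigma_finite : sigma_finite setT (m1 \x m2)%E.
Proof.
have /sigma_finiteP[F [TF ndF Foo]] := sigma_finiteT m1.
have /sigma_finiteP[G [TG ndG Goo]] := sigma_finiteT m2.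
exists (fun n => F n `*` G n); last first.
  move=> k; have [mF Fk] := Foo k; have [mG Gk] := Goo k.
  split; first exact: measurableX.
  by rewrite product_measure1E// lte_mul_pinfty// ge0_fin_numE.
apply/esym; rewrite -subTset => -[x y] _.
have [n _ Fx] : (\bigcup_n F n) x by rewrite -TF.
have [k _ Gy] : (\bigcup_n G n) y by rewrite -TG.
exists (n + k)%N => //; split.
- by have /subsetPset := ndF _ _ (leq_addr k n); apply.
- by have /subsetPset := ndG _ _ (leq_addl n k); apply.
Qed.

(* The instance of [m1 \x m2] as a sigma-finite measure is not found by
   canonical structure inference when products are iterated. *)
Definition prod_sfm : {sigma_finite_measure set (T1 * T2)%type -> \bar R} :=
  HB.pack (m1 \x m2)%E
    (@Measure_isSigmaFinite.Build _ _ _ (m1 \x m2)%E product_sigma_finite).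

Lemma tonelli1 (f : T1 * T2 -> \bar R) : measurable_fun setT f ->
  (forall x, 0 <= f x)%E ->
  (\int[prod_sfm]_z f z = \int[m1]_x \int[m2]_y f (x, y))%E.
Proof. by move=> mf f0; exact: fubini_tonelli1. Qed.

Lemma tonelli2 (f : T1 * T2 -> \bar R) : measurable_fun setT f ->
  (forall x, 0 <= f x)%E ->
  (\int[prod_sfm]_z f z = \int[m2]_y \int[m1]_x f (x, y))%E.
Proof. by move=> mf f0; exact: fubini_tonelli2. Qed.

End product.

(** * Affine changes of variables *)

Section scaling_map.
Context (R : realType).

(** Stated for nonnegative extended-valued functions, the form that passes to products by Tonelli;
    [integral_scaling] then recovers integrable functions from their positive and negative parts. *)
Definition scaling_map d (T : measurableType d)
    (m : {sigma_finite_measure set T -> \bar R}) (S : T -> T) (c : R) :=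
  [/\ measurable_fun setT S, 0 < c &
  forall f : T -> \bar R, measurable_fun setT f -> (forall x, 0 <= f x)%E ->
  (\int[m]_x f x = c%:E * \int[m]_x f (S x))%E].

Lemma scaling_map_prod d1 d2 (T1 : measurableType d1) (T2 : measurableType d2)
    (m1 : {sigma_finite_measure set T1 -> \bar R})
    (m2 : {sigma_finite_measure set T2 -> \bar R}) S1 S2 c1 c2 :
  scaling_map m1 S1 c1 -> scaling_map m2 S2 c2 ->
  scaling_map (prod_sfm m1 m2) (fun z => (S1 z.1, S2 z.2)) (c1 * c2).
Proof.
move=> [mS1 c10 H1] [mS2 c20 H2].
have mS : measurable_fun setT (fun z : T1 * T2 => (S1 z.1, S2 z.2)).
  by apply: measurable_fun_pair; apply: measurableT_comp.
split=> //; first exact: mulr_gt0.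
move=> f mf f0; rewrite tonelli1// tonelli1//; last exact: measurableT_comp mS.
have mF := @measurable_fun_fubini_tonelli_F _ _ _ _ _ m2 f mf f0.
have F0 x : (0 <= fubini_F m2 f x)%E by apply: integral_ge0.
rewrite (H1 _ mF F0).
have -> : (\int[m1]_x fubini_F m2 f (S1 x) =
    \int[m1]_x (c2%:E * \int[m2]_y f (S1 x, S2 y)))%E.
  apply: eq_integral => x _; rewrite /fubini_F (H2 (fun y => f (S1 x, y)))//.
  exact: measurable_fun_pair2 mf.
rewrite ge0_integralZl//; last 3 first.
- apply: (@measurable_fun_fubini_tonelli_F _ _ _ _ _ m2
    (fun z => f (S1 z.1, S2 z.2))) => //.
  exact: measurableT_comp mS.
- by move=> x _; apply: integral_ge0.
- by rewrite lee_fin ltW.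
by rewrite muleA EFinM.
Qed.

Lemma integral_scaling d (T : measurableType d)
    (m : {sigma_finite_measure set T -> \bar R}) (S : T -> T) c (f : T -> R) :
  scaling_map m S c ->
  intg m f -> intg m (fun x => f (S x)) /\
   \int[m]_x f x = c * \int[m]_x f (S x).
Proof.
move=> [mS c0 HS] If.
have mf := intg_meas If.
have mfS : measurable_fun setT (fun x => f (S x)) by exact: measurableT_comp mS.
have IfS : intg m (fun x => f (S x)).
  move/integrableP : (If) => [_ Ifo]; apply/integrableP; split.
    exact/measurable_EFinP.
  have : (c%:E * (\int[m]_x `|((EFin \o (fun x => f (S x))) x)|) < +oo)%E.
    rewrite -(HS (fun x => `|(f x)%:E|%E))//.
    by apply: measurableT_comp => //; exact/measurable_EFinP.
  rewrite lt_neqAle leey andbT => /eqP H; rewrite ltNge leye_eq; apply/negP => /eqP H'.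
  by apply: H; rewrite H' gt0_muley ?lte_fin.
split=> //; apply: EFin_inj; rewrite intgK// EFinM intgK//.
rewrite integralE [in RHS]integralE.
have mfe : measurable_fun setT (EFin \o f) by exact/measurable_EFinP.
rewrite (HS (EFin \o f)^\+%E)//; last exact: measurable_funepos.
rewrite (HS (EFin \o f)^\-%E)//; last exact: measurable_funeneg.
have F1 : (\int[m]_x ((EFin \o (fun x => f (S x)))^\+)%E x)%E \is a fin_num.
  exact: integrable_pos_fin_num.
rewrite [RHS]muleBr; [|by []|exact: (fin_num_adde_defr _ F1)].
by congr (_ * _ - _ * _)%E; apply: eq_integral => x _; rewrite !(funeposE, funenegE).
Qed.

Definition lam1 : {sigma_finite_measure set (measurableTypeR R) -> \bar R} :=
  @lebesgue_measure R.

(** Uniqueness of Lebesgue measure: r times its image under the affine map has the right value on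
    half-open intervals. *)
Lemma scaling_map_lam1 (r a : R) : 0 < r ->
  scaling_map lam1 (fun x => r * x + a : R) r.
Proof.
move=> r0; set S : measurableTypeR R -> measurableTypeR R := (fun x : R => r * x + a).
have mS : measurable_fun setT (S : measurableTypeR R -> measurableTypeR R).
  apply: (@continuous_measurable_fun R) => x.
  by apply: cvgD; [apply: cvgM; [exact: cvg_cst|exact: cvg_id]|exact: cvg_cst].
split=> // f mf f0.
pose P' : {measure set (measurableTypeR R) -> \bar R} := pushforward lam1 S.
pose P := P' mS.
pose k := NngNum (ltW r0).
transitivity (\int[mscale k P]_x f x)%E.
  apply: (eq_measure_integral (mscale k P)) => A mA _.
  apply: (@lebesgue_measure_unique R (mscale k P)) => // _ [[u v] /= uv <-].
  rewrite /mscale /P /P' /= /pushforward.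
  have -> : S @^-1` `]u, v]%classic = `](u - a) / r, (v - a) / r]%classic :> set R.
    apply/seteqP; split => x /=; rewrite !in_itv /= /S.
      by rewrite ltr_pdivrMr// ler_pdivlMr// mulrC ltrBlDr lerBrDr.
    by rewrite ltr_pdivrMr// ler_pdivlMr// mulrC ltrBlDr lerBrDr.
  rewrite /lam1 /= !lebesgue_measure_itv /= !lte_fin.
  rewrite ltr_pM2r ?invr_gt0// ltrD2r.
  case: ifPn => _; last by rewrite mule0.
  by rewrite -!EFinD -EFinM; congr EFin; field; rewrite gt_eqF.
rewrite ge0_integral_mscale//; congr (_ * _)%E.
by rewrite (ge0_integral_pushforward mS)//; rewrite preimage_setT.
Qed.

End scaling_map.

Section R4.
Variable R : realType.
Local Notation E := (R4 R).
Local Notation mR := (measurableTypeR R).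

(** [E4] carries the measurable structure and [R4] the normed one on convertible products. Likewise
    [lam4] is convertible to [leb4], with the sigma-finite structure supplied factor by factor. *)
Definition E4 : measurableType _ := (mR * mR * mR * mR)%type.

Definition lam4 : {sigma_finite_measure set E4 -> \bar R} :=
  prod_sfm (prod_sfm (prod_sfm (lam1 R) (lam1 R)) (lam1 R)) (lam1 R).

Lemma scaling_map_lam4 (r : R) (a : E) : 0 < r ->
  @scaling_map R _ E4 lam4 (fun x => r *: (x : E) + a : E) (r ^+ 4).
Proof.
move=> r0.
have := scaling_map_prod (scaling_map_prod (scaling_map_prod
  (scaling_map_lam1 a.1.1.1 r0) (scaling_map_lam1 a.1.1.2 r0))
  (scaling_map_lam1 a.1.2 r0)) (scaling_map_lam1 a.2 r0).
have -> : r * r * r * r = r ^+ 4 by ring.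
suff -> : (fun x : E4 => r *: (x : E) + a : E) = (fun z : E4 =>
  ((r * z.1.1.1 + a.1.1.1, r * z.1.1.2 + a.1.1.2, r * z.1.2 + a.1.2,
    r * z.2 + a.2) : E)) by [].
apply/funext => -[[[x1 x2] x3] x4].
by case: a => [[[a1 a2] a3] a4].
Qed.

End R4.

Notation meas4 f := (@measurable_fun _ _ (E4 _) _ setT f) (only parsing).

(** * Borel sets and boxes of R^4 *)

Section R4meas.
Variable R : realType.
Local Notation E := (R4 R).
Local Notation mR := (measurableTypeR R).
Local Notation E4 := (E4 R).
Local Notation mu := (lam4 R).

Lemma meas_fun4 d (T : measurableType d) (f1 f2 f3 f4 : T -> R) :
  measurable_fun setT f1 -> measurable_fun setT f2 ->
  measurable_fun setT f3 -> measurable_fun setT f4 ->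
  measurable_fun setT ((fun t => (f1 t, f2 t, f3 t, f4 t)) : T -> E4).
Proof.
by move=> m1 m2 m3 m4; do !apply: measurable_fun_pair.
Qed.

Lemma meas_co1 : measurable_fun setT ((fun x : E => x.1.1.1) : E4 -> R).
Proof. by do 2 apply: measurableT_comp => //. Qed.
Lemma meas_co2 : measurable_fun setT ((fun x : E => x.1.1.2) : E4 -> R).
Proof. by do 2 apply: measurableT_comp => //. Qed.
Lemma meas_co3 : measurable_fun setT ((fun x : E => x.1.2) : E4 -> R).
Proof. by apply: measurableT_comp => //. Qed.
Lemma meas_co4 : measurable_fun setT ((fun x : E => x.2) : E4 -> R).
Proof. exact: measurable_snd. Qed.

Lemma meas_affine d (T : measurableType d) (S : T -> E4) (r : T -> R) (V : T -> E4) :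
  measurable_fun setT S -> measurable_fun setT r -> measurable_fun setT V ->
  measurable_fun setT ((fun t => (S t : E) + r t *: (V t : E)) : T -> E4).
Proof.
move=> mS mr mV.
have -> : ((fun t => (S t : E) + r t *: (V t : E)) : T -> E4) =
   (fun t => ((S t : E).1.1.1 + r t * (V t : E).1.1.1,
     (S t : E).1.1.2 + r t * (V t : E).1.1.2,
     (S t : E).1.2 + r t * (V t : E).1.2, (S t : E).2 + r t * (V t : E).2)).
  apply/funext => t; case: (S t) => [[[? ?] ?] ?]; by case: (V t) => [[[? ?] ?] ?].
have c1 := meas_co1; have c2 := meas_co2; have c3 := meas_co3; have c4 := meas_co4.
apply: meas_fun4; apply: measurable_funD; try apply: measurable_funM => //.
- exact: (measurableT_comp c1 mS).
- exact: (measurableT_comp c1 mV).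
- exact: (measurableT_comp c2 mS).
- exact: (measurableT_comp c2 mV).
- exact: (measurableT_comp c3 mS).
- exact: (measurableT_comp c3 mV).
- exact: (measurableT_comp c4 mS).
- exact: (measurableT_comp c4 mV).
Qed.

Lemma measurable_ball4 (c : E) (r : R) : measurable (ball c r : set E4).
Proof.
have -> : (ball c r : set E4) =
  ((ball c.1.1.1 r `*` ball c.1.1.2 r) `*` ball c.1.2 r) `*` ball c.2 r.
  apply/seteqP; split => -[[[x1 x2] x3] x4].
    by case: c => [[[c1 c2] c3] c4] [[[? ?] ?] ?].
  by case: c => [[[c1 c2] c3] c4] [[[? ?] ?] ?].
by do !apply: measurableX; exact: measurable_ball.
Qed.

Definition ratpt (q : rat * rat * rat * rat) : E :=
  (ratr q.1.1.1, ratr q.1.1.2, ratr q.1.2, ratr q.2).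

(** Links the norm topology with the product sigma-algebra: an open set is a countable union of
    balls with rational centre and radius, and such balls are products of intervals. *)
Lemma measurable_open4 (U : set E) : open U -> measurable (U : set E4).
Proof.
move=> oU.
have -> : (U : set E4) = \bigcup_(p : (rat * rat * rat * rat) * rat)
    (if `[< ball (ratpt p.1) (ratr p.2) `<=` U >]
     then ball (ratpt p.1) (ratr p.2) : set E4 else set0).
  apply/seteqP; split => [x Ux|x [p _]]; last first.
    by case: ifPn => // /asboolP; apply.
  have : nbhs (x : E) U by apply: open_nbhs_nbhs.
  move=> /nbhs_ballP[e /= e0 eU].
  have [|q] := @rat_in_itvoo R 0 (e / 2); first by rewrite divr_gt0.
  rewrite in_itv /= => /andP[q0 qe].
  have ratn (t : R) : exists s : rat, `|ratr s - t| < ratr q.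
    have [|s] := @rat_in_itvoo R (t - ratr q) (t + ratr q); first by rewrite ltrD2l; lra.
    by rewrite in_itv /= => /andP[s1 s2]; exists s; rewrite ltr_norml; lra.
  case: x Ux eU => [[[x1 x2] x3] x4] Ux eU.
  have [s1 h1] := ratn x1; have [s2 h2] := ratn x2.
  have [s3 h3] := ratn x3; have [s4 h4] := ratn x4.
  have bx : ball (ratpt (s1, s2, s3, s4)) (ratr q) (x1, x2, x3, x4).
    by [].
  exists ((s1, s2, s3, s4), q) => //=; case: ifPn => [_ //|/asboolP []].
  move=> y by'; apply: eU.
  have := ball_triangle (ball_sym bx) by'.
  by apply: le_ball; lra.
apply: countable_bigcupT_measurable => [|p].
  exact: countableP.
by case: ifPn => _; [exact: measurable_ball4|exact: measurable0].
Qed.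

Lemma continuous_meas4 (f : E -> R) : continuous f -> meas4 f.
Proof.
move=> /continuousP cf; apply: (measurability _ (RGenOpens.measurableE R)).
move=> _ [_ [a [b ->] <-]]; rewrite setTI; apply: measurable_open4.
exact/cf/interval_open.
Qed.

Definition box4 (I : interval R) : set E4 :=
  (([set` I] `*` [set` I]) `*` [set` I]) `*` [set` I].

Lemma measurable_box4 I : measurable (box4 I).
Proof. by do !apply: measurableX => //; exact: measurable_itv. Qed.

Lemma box4P I (x : E) : box4 I x <->
  [/\ x.1.1.1 \in I, x.1.1.2 \in I, x.1.2 \in I & x.2 \in I].
Proof.
case: x => [[[x1 x2] x3] x4]; split => [[[[]]]//|[]//].
Qed.

Lemma lam4_box I : mu (box4 I) = (lebesgue_measure [set` I] ^+ 4)%E.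
Proof.
have mI : measurable ([set` I] : set mR) by exact: measurable_itv.
have m2 : measurable ([set` I] `*` [set` I] : set (mR * mR)%type).
  exact: measurableX.
have m3 : measurable ([set` I] `*` [set` I] `*` [set` I] : set (mR * mR * mR)%type).
  exact: measurableX.
rewrite /lam4 /= /box4.
rewrite (product_measure1E (prod_sfm (prod_sfm (lam1 R) (lam1 R)) (lam1 R)) (lam1 R) m3 mI).
rewrite /= (product_measure1E (prod_sfm (lam1 R) (lam1 R)) (lam1 R) m2 mI).
rewrite /= (product_measure1E (lam1 R) (lam1 R) mI mI).
by rewrite -!muleA.
Qed.

Lemma lam4_cube : mu (box4 `[0, 1]) = 1%E.
Proof.
rewrite lam4_box lebesgue_measure_itv /= lte_fin ltr01 oppr0 adde0.
by rewrite !mule1.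
Qed.

Lemma lam4_box_lty (a b : R) : (mu (box4 `[a, b]) < +oo)%E.
Proof.
rewrite lam4_box lebesgue_measure_itv /=; case: ifPn => _.
  by rewrite -!EFinD -!EFinM ltry.
by rewrite !mule0 ltry.
Qed.

Lemma compact_box4 (a b : R) : compact (box4 `[a, b] : set E).
Proof.
by do 3 (apply: compact_setX; last exact: segment_compact); exact: segment_compact.
Qed.

Lemma box4_norm (r : R) (x : E) : box4 `[- r, r] x <-> `|x| <= r.
Proof.
case: x => [[[x1 x2] x3] x4].
have -> : `|((x1, x2, x3, x4) : E)| =
  Num.max (Num.max (Num.max `|x1| `|x2|) `|x3|) `|x4| by [].
rewrite box4P /= !in_itv /= !ge_max -!andbA !ler_norml.
by split=> [[? ? ? ?]|/and4P[]//]; apply/and4P.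
Qed.

Lemma compact_sub_box4 (K : set E) : compact K ->
  exists n : nat, K `<=` box4 `[- n%:R, n%:R].
Proof.
move=> /compact_bounded [M [_ HM]].
have /HM Hb : M < `|M| + 1 by rewrite (le_lt_trans (ler_norm M))// ltrDl.
pose n := Num.bound (`|M| + 1).
have nM : `|M| + 1 <= n%:R by apply/ltW/archi_boundP; rewrite addr_ge0.
by exists n => x /Hb /= xM; apply/box4_norm; exact: le_trans xM nM.
Qed.

End R4meas.

(** * Test functions and the fundamental lemma *)

Section bump1.
Variable R : realType.
Implicit Types t : R.

(** The factors t^-n make the span of this family closed under differentiation, so the smoothness of
    exp(-1/t) needs no formula for higher derivatives. *)
Definition hb (n : nat) t : R := if 0 < t then t ^- n * expR (- t^-1) else 0.

Lemma hb_ge0 n t : 0 <= hb n t.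
Proof.
rewrite /hb; case: ifPn => // t0.
by rewrite mulr_ge0 ?expR_ge0// invr_ge0 exprn_ge0// ltW.
Qed.

Lemma hb_le0 n t : t <= 0 -> hb n t = 0.
Proof. by rewrite /hb leNgt => /negbTE ->. Qed.

Lemma hbS n t : hb n t = t * hb n.+1 t.
Proof.
rewrite /hb; case: ifPn => [t0|]; last by rewrite mulr0.
by rewrite exprS invfM !mulrA divff ?mul1r// gt_eqF.
Qed.

(** With s = 1/t, exp(s) = exp(s/n)^n >= (s/n)^n, whence the constant n^n. *)
Lemma hb_bound n : exists2 C : R, 0 <= C & forall t, hb n t <= C.
Proof.
exists (n%:R ^+ n); first by rewrite exprn_ge0.
move=> t; rewrite /hb; case: ifPn => [t0|_]; last by rewrite exprn_ge0.
case: n => [|n].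
  by rewrite expr0 invr1 mul1r expr0 -expR0 ler_expR oppr_le0 invr_ge0 ltW.
rewrite expRN ler_pdivrMr ?expR_gt0//.
have s0 : 0 < t^-1 by rewrite invr_gt0.
have n0 : (n.+1%:R : R) != 0 by rewrite pnatr_eq0.
have -> : expR t^-1 = expR (t^-1 / n.+1%:R) ^+ n.+1.
  by rewrite -expRM_natr mulfVK.
rewrite -exprMn -exprVn; apply: lerXn2r; rewrite ?nnegrE.
- exact: ltW.
- by rewrite mulr_ge0// expR_ge0.
- have := expR_ge1Dx (t^-1 / n.+1%:R) => h.
  rewrite -ler_pdivrMl ?ltr0n// mulrC; apply: le_trans h.
  by rewrite lerDr.
Qed.

Lemma is_derive_congr (f g : R -> R) t (a b : R) :
  is_derive t 1 f a -> f =1 g -> a = b -> is_derive t 1 g b.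
Proof. by move=> H /funext <- <-. Qed.

Lemma is_derive_hb n t : is_derive t 1 (hb n) (hb n.+2 t - n%:R * hb n.+1 t).
Proof.
have [t0|t0|->] := ltgtP t 0.
- rewrite !hb_le0 ?ltW// mulr0 subr0.
  apply: (@near_eq_is_derive _ _ _ (cst 0)) => //.
  by near=> s; rewrite hb_le0// ltW//; near: s; exact: lt_nbhsl.
- apply: (@near_eq_is_derive _ _ _ (fun s : R => s ^- n * expR (- s^-1))) => //.
    near=> s; rewrite /hb ifT//; near: s; exact: lt_nbhsr.
  have tn0 : t != 0 by rewrite gt_eqF.
  have d1 : is_derive t 1 (fun s : R => - s^-1) (t ^- 2).
    have := @is_deriveV R id t 1 1 tn0 _ => H.
    have := @is_deriveN R R R (fun s : R => s^-1) t 1 _ (H (is_derive_id _ _)).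
    move/is_derive_congr; apply=> //.
    by rewrite /GRing.scale /= mulr1 opprK.
  have d2 : is_derive t 1 (fun s : R => expR (- s^-1)) (t ^- 2 * expR (- t^-1)).
    have := @is_derive1_comp R expR (fun s : R => - s^-1) t _ _ _ d1.
    by rewrite mulrC; apply.
  have d3 : is_derive t 1 (fun s : R => s ^- n) (- n%:R * t ^- n.+1).
    have tn : t ^+ n != 0 by rewrite expf_neq0.
    have H := @is_deriveX R R id n t 1 1 (is_derive_id _ _).
    have H' : is_derive t 1 (fun s : R => s ^+ n) (n%:R * t ^+ n.-1).
      by move/is_derive_congr : H; apply => [x|];
        [rewrite exprfctE|rewrite /GRing.scale /= mulr1].
    have := @is_deriveV R (fun s => s ^+ n) t _ 1 tn H'.
    move/is_derive_congr; apply=> //; rewrite /GRing.scale /=.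
    case: n {H H' tn} => [|n]; first by rewrite mul0r mulr0 oppr0 mul0r.
    rewrite !exprS /=; field.
    by rewrite tn0 expf_neq0.
  have := @is_deriveM R R (fun s : R => s ^- n) (fun s : R => expR (- s^-1)) t 1 _ _ d3 d2.
  move/is_derive_congr; apply=> //; rewrite /GRing.scale /= /hb t0 !exprS.
  by field; rewrite tn0 expf_neq0.
- rewrite !hb_le0// mulr0 subr0.
  have [C C0 HC] := hb_bound n.+2.
  (* Since hb n h = h^2 hb (n + 2) h, the quotient at 0 is h hb (n + 2) h, and boundedness of the
     last factor suffices. *)
  have cv : (fun h : R => h^-1 *: ((hb n \o shift 0) (h *: 1) - hb n 0)) @ 0^'
      --> (0 : R).
    apply/cvgr0Pnorm_lt => e e0; near=> h.
    have hn0 : h != 0 by near: h; exact: nbhs_dnbhs_neq.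
    rewrite /GRing.scale /= mulr1 addr0 (hb_le0 _ (lexx 0)) subr0 hbS hbS.
    rewrite mulKf// normrM.
    apply: (@le_lt_trans _ _ (`|h| * (C + 1))).
      by rewrite ler_wpM2l// ger0_norm ?hb_ge0// (le_trans (HC h))// lerDl.
    rewrite -ltr_pdivlMr ?ltr_wpDl//; near: h.
    apply: dnbhs0_lt; rewrite divr_gt0// ltr_wpDl//.
  by apply: DeriveDef; [exact: (cvgP _ cv)|exact: cvg_lim cv].
Unshelve. all: by end_near. Qed.

End bump1.

(** * Smooth bumps converging to indicators of open boxes *)

Section bump4.
Variable R : realType.
Local Notation E := (R4 R).

Definition aff (l : E -> R) :=
  (forall x, differentiable l x) /\ forall v, exists c, forall x, 'D_v l x = c.

(* Stable under directional derivatives, hence consisting of smooth functions. *)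
Inductive cls : (E -> R) -> Prop :=
| cls_cst c : cls (fun=> c)
| cls_hb n l : aff l -> cls (fun x => hb n (l x))
| cls_add f g : cls f -> cls g -> cls (fun x => f x + g x)
| cls_mul f g : cls f -> cls g -> cls (fun x => f x * g x).

Lemma differentiable_hb n (t : R) : differentiable (hb n) t.
Proof. by apply/derivable1_diffP; have [] := is_derive_hb n t. Qed.

Lemma cls_derive f : cls f ->
  (forall x, differentiable f x) /\ forall v, cls ('D_v f).
Proof.
elim=> {f} [c|n l [dl cl]|f g _ [df cf] _ [dg cg]|f g Cf [df cf] Cg [dg cg]].
- split=> [x|v]; first exact: differentiable_cst.
  rewrite (_ : 'D_v _ = fun=> 0); first exact: cls_cst.
  by apply/funext => x; rewrite (@derive_cst _ _ _ c).
- have dc x : differentiable (fun x => hb n (l x)) x.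
    by apply: (@differentiable_comp _ _ _ _ l (hb n)) => //; exact: differentiable_hb.
  split=> // v; have [c Hc] := cl v.
  rewrite (_ : 'D_v _ = fun x =>
    (hb n.+2 (l x) + - n%:R * hb n.+1 (l x)) * c); last first.
    apply/funext => x; rewrite deriveE//.
    have -> : 'd (fun x => hb n (l x)) x v = 'd (hb n \o l) x v by [].
    rewrite diff_comp//=; last exact: differentiable_hb.
    rewrite -(deriveE _ (dl x)) Hc.
    have [h1 h2] := is_derive_hb n (l x).
    rewrite diff1E; last exact: differentiable_hb.
    by rewrite derive1E h2 /GRing.scale /= mulNr mulrC.
  apply: cls_mul; last exact: cls_cst.
  apply: cls_add; first by apply: cls_hb.
  by apply: cls_mul; [exact: cls_cst|exact: cls_hb].
- split=> [x|v]; first exact: differentiableD.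
  rewrite (_ : 'D_v _ = fun x => 'D_v f x + 'D_v g x); first exact: cls_add.
  by apply/funext => x; rewrite deriveD//; exact: diff_derivable.
- split=> [x|v]; first exact: differentiableM.
  rewrite (_ : 'D_v _ = fun x => f x * 'D_v g x + g x * 'D_v f x).
    by apply: cls_add; apply: cls_mul.
  by apply/funext => x; rewrite deriveM//; exact: diff_derivable.
Qed.

Lemma cls_smooth f : cls f -> smooth f.
Proof.
move=> Cf k; elim: k f Cf => [|k IH] f /cls_derive[df cf] /=.
  by move=> x; exact: differentiable_continuous.
by split=> // v; apply: IH.
Qed.

Lemma aff_lin (l : E -> R) (a b : R) : linear l -> continuous l ->
  aff (fun x => a * (l x - b)).
Proof.
move=> ll cl.
pose mm := GRing.isLinear.Build R E R *:%R l ll.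
pose L : {linear E -> R} := HB.pack l mm.
have dl x : differentiable l x by apply: (@linear_differentiable _ _ _ L); exact: cl.
have da x : differentiable (fun x => a * (l x - b)) x.
  apply: (@differentiableZ _ _ _ (fun x => l x - b)).
  by apply: differentiableB.
split=> // v; exists (a * l v) => x.
rewrite deriveE//.
have -> : 'd (fun x => a * (l x - b)) x = 'd (a \*: (l \- cst b)) x :> (E -> R) by [].
rewrite diffZ; last by apply: differentiableB.
rewrite /= diffB// diff_cst /= subr0.
by rewrite (@diff_lin _ _ _ L x cl).
Qed.

Lemma cts_co1 : continuous (fun x : E => x.1.1.1).
Proof.
move=> x; apply: (@continuous_comp _ _ _ (fun x : E => x.1.1) fst).
  apply: (@continuous_comp _ _ _ (fun x : E => x.1) fst); exact: cvg_fst.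
exact: cvg_fst.
Qed.
Lemma cts_co2 : continuous (fun x : E => x.1.1.2).
Proof.
move=> x; apply: (@continuous_comp _ _ _ (fun x : E => x.1.1) snd).
  apply: (@continuous_comp _ _ _ (fun x : E => x.1) fst); exact: cvg_fst.
exact: cvg_snd.
Qed.
Lemma cts_co3 : continuous (fun x : E => x.1.2).
Proof.
move=> x; apply: (@continuous_comp _ _ _ (fun x : E => x.1) snd).
  exact: cvg_fst.
exact: cvg_snd.
Qed.
Lemma cts_co4 : continuous (fun x : E => x.2).
Proof. by move=> x; exact: cvg_snd. Qed.

Lemma lin_co1 : linear (fun x : E => x.1.1.1).
Proof. by move=> k [[[? ?] ?] ?] [[[? ?] ?] ?]. Qed.
Lemma lin_co2 : linear (fun x : E => x.1.1.2).
Proof. by move=> k [[[? ?] ?] ?] [[[? ?] ?] ?]. Qed.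
Lemma lin_co3 : linear (fun x : E => x.1.2).
Proof. by move=> k [[[? ?] ?] ?] [[[? ?] ?] ?]. Qed.
Lemma lin_co4 : linear (fun x : E => x.2).
Proof. by move=> k [[[? ?] ?] ?] [[[? ?] ?] ?]. Qed.

(** Each factor is exp(-1 / ((n + 1) c)) with c the distance to a face, and tends to 1 inside the
    box. Indicators of open boxes are thus pointwise limits of test functions, with values in
    [0, 1], and no mollification is required. *)
Definition boxbump (n : nat) (a b : E) (x : E) : R :=
  hb 0 (n.+1%:R * (x.1.1.1 - a.1.1.1)) * hb 0 (- n.+1%:R * (x.1.1.1 - b.1.1.1)) *
  (hb 0 (n.+1%:R * (x.1.1.2 - a.1.1.2)) * hb 0 (- n.+1%:R * (x.1.1.2 - b.1.1.2))) *
  (hb 0 (n.+1%:R * (x.1.2 - a.1.2)) * hb 0 (- n.+1%:R * (x.1.2 - b.1.2))) *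
  (hb 0 (n.+1%:R * (x.2 - a.2)) * hb 0 (- n.+1%:R * (x.2 - b.2))).

Lemma boxbump_smooth n a b : smooth (boxbump n a b).
Proof.
apply: cls_smooth.
apply: cls_mul; [apply: cls_mul; [apply: cls_mul|]|]; apply: cls_mul; apply: cls_hb.
- exact: (aff_lin _ _ lin_co1 cts_co1).
- exact: (aff_lin _ _ lin_co1 cts_co1).
- exact: (aff_lin _ _ lin_co2 cts_co2).
- exact: (aff_lin _ _ lin_co2 cts_co2).
- exact: (aff_lin _ _ lin_co3 cts_co3).
- exact: (aff_lin _ _ lin_co3 cts_co3).
- exact: (aff_lin _ _ lin_co4 cts_co4).
- exact: (aff_lin _ _ lin_co4 cts_co4).
Qed.

Lemma hb0_01 (t : R) : 0 <= hb 0 t <= 1.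
Proof.
rewrite hb_ge0 /= /hb; case: ifPn => // t0.
by rewrite expr0 invr1 mul1r -expR0 ler_expR oppr_le0 invr_ge0 ltW.
Qed.

Definition obox (a b : E) : set E :=
  ((`]a.1.1.1, b.1.1.1[ `*` `]a.1.1.2, b.1.1.2[) `*` `]a.1.2, b.1.2[) `*` `]a.2, b.2[.
Definition cbox (a b : E) : set E :=
  ((`[a.1.1.1, b.1.1.1] `*` `[a.1.1.2, b.1.1.2]) `*` `[a.1.2, b.1.2]) `*` `[a.2, b.2].

Lemma boxbump_01 n a b x : 0 <= boxbump n a b x <= 1.
Proof.
rewrite /boxbump.
have M (p q : R) : 0 <= p <= 1 -> 0 <= q <= 1 -> 0 <= p * q <= 1.
  by move=> /andP[p0 p1] /andP[q0 q1]; rewrite mulr_ge0//= mulr_ile1.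
by do 3 (apply: (M); last by apply: (M); exact: hb0_01); apply: (M); exact: hb0_01.
Qed.

Lemma hb0_neq0 (c t s : R) : 0 < c ->
  (hb 0 (c * (t - s)) != 0 -> s < t) /\ (hb 0 (- c * (t - s)) != 0 -> t < s).
Proof.
move=> c0; split; apply: contraNT; rewrite -leNgt => h; apply/eqP/hb_le0.
  by rewrite pmulr_rle0// subr_le0.
by rewrite mulNr oppr_le0 pmulr_rge0// subr_ge0.
Qed.

Lemma boxbump_neq0 n a b x : boxbump n a b x != 0 -> obox a b x.
Proof.
have n0 : 0 < n.+1%:R :> R by [].
rewrite /boxbump !mulf_eq0 !negb_or -!andbA => /and5P[a1 a2 a3 a4 /and4P[a5 a6 a7 a8]].
have {}a1 := (hb0_neq0 x.1.1.1 a.1.1.1 n0).1 a1.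
have {}a2 := (hb0_neq0 x.1.1.1 b.1.1.1 n0).2 a2.
have {}a3 := (hb0_neq0 x.1.1.2 a.1.1.2 n0).1 a3.
have {}a4 := (hb0_neq0 x.1.1.2 b.1.1.2 n0).2 a4.
have {}a5 := (hb0_neq0 x.1.2 a.1.2 n0).1 a5.
have {}a6 := (hb0_neq0 x.1.2 b.1.2 n0).2 a6.
have {}a7 := (hb0_neq0 x.2 a.2 n0).1 a7.
have {}a8 := (hb0_neq0 x.2 b.2 n0).2 a8.
by rewrite /obox; do !split; rewrite /= in_itv /=; apply/andP.
Qed.

Lemma obox_cbox a b : obox a b `<=` cbox a b.
Proof.
move=> x [[[h1 h2] h3] h4].
by do !split; apply: subset_itv_oo_cc.
Qed.

Lemma compact_cbox a b : compact (cbox a b).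
Proof.
by do 3 (apply: compact_setX; last exact: segment_compact); exact: segment_compact.
Qed.

Lemma boxbump_test n a b : test_fun (boxbump n a b).
Proof.
split; first exact: boxbump_smooth.
apply: (@subclosed_compact _ _ (cbox a b)).
- exact: closed_closure.
- exact: compact_cbox.
rewrite closureE => x; apply; split.
  apply: compact_closed; [exact: norm_hausdorff|exact: compact_cbox].
by move=> y /= /boxbump_neq0 /obox_cbox.
Qed.

Lemma hb0_cvg (c : R) : 0 < c -> (fun n => hb 0 (n.+1%:R * c)) @ \oo --> (1 : R).
Proof.
move=> c0.
have -> : (fun n => hb 0 (n.+1%:R * c)) = expR \o (fun n => - (c^-1 * n.+1%:R^-1)).
  apply/funext => n; rewrite /hb mulr_gt0//= expr0 invr1 mul1r invfM.
  by rewrite mulrC.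
rewrite -[X in _ --> X]expR0; apply: continuous_cvg; first exact: continuous_expR.
rewrite -[X in _ --> X]oppr0; apply: cvgN; rewrite -[X in _ --> X](mulr0 c^-1); apply: cvgM.
  exact: cvg_cst.
exact: cvg_harmonic.
Qed.

Lemma boxbump_cvg a b x : (fun n => boxbump n a b x) @ \oo --> (\1_(obox a b) x : R).
Proof.
rewrite indicE; have [xo|xo] := boolP (x \in obox a b); last first.
  rewrite (_ : (fun n => _) = cst 0); first exact: cvg_cst.
  apply/funext => n; apply/eqP; apply: contraNT xo => /boxbump_neq0.
  by rewrite inE.
move: xo; rewrite inE => -[[[]]] /=; rewrite !in_itv /=.
move=> /andP[h1 h2] /andP[h3 h4] /andP[h5 h6] /andP[h7 h8].
have N (s t : R) : s < t -> (fun n => hb 0 (n.+1%:R * (t - s))) @ \oo --> (1 : R).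
  by move=> st; apply: hb0_cvg; rewrite subr_gt0.
have P (s t : R) : t < s -> (fun n => hb 0 (- n.+1%:R * (t - s))) @ \oo --> (1 : R).
  move=> st; under eq_fun do rewrite mulNr -mulrN opprB.
  by apply: hb0_cvg; rewrite subr_gt0.
have -> : true%:R = 1 * 1 * (1 * 1) * (1 * 1) * (1 * 1) :> R by rewrite !mulr1.
rewrite /boxbump.
by do 3 (apply: cvgM; last by apply: cvgM; [apply: (N)|apply: (P)]); apply: cvgM; [apply: (N)|apply: (P)].
Qed.

End bump4.

(** * Generators of product sigma-algebras *)

Section prod_gen.
Context d1 d2 (T1 : measurableType d1) (T2 : measurableType d2).

(** The full space need not belong to a generating family; the exhaustions [U1] and [U2] write A x
    T2 and T1 x B as countable unions of products of generators. *)
Lemma measurable_prod_gen (G1 : set (set T1)) (G2 : set (set T2))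
    (U1 : nat -> set T1) (U2 : nat -> set T2) :
  @measurable _ T1 = <<s G1 >> -> @measurable _ T2 = <<s G2 >> ->
  (forall n, G1 (U1 n)) -> \bigcup_n U1 n = setT ->
  (forall n, G2 (U2 n)) -> \bigcup_n U2 n = setT ->
  @measurable _ (T1 * T2)%type = <<s [set A `*` B | A in G1 & B in G2] >>.
Proof.
move=> M1 M2 GU1 TU1 GU2 TU2; set G := [set _ | _ in _ & _ in _].
have SG : sigma_algebra setT <<s G >> by exact: smallest_sigma_algebra.
apply/seteqP; split; last first.
  apply: smallest_sub; first exact: sigma_algebra_measurable.
  move=> _ [A GA] [B GB] <-; apply: measurableX.
    by rewrite M1; exact: sub_sigma_algebra.
  by rewrite M2; exact: sub_sigma_algebra.
rewrite measurable_prod_measurableType; apply: smallest_sub => //.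
have cC C : <<s G >> C -> <<s G >> (~` C).
  by move=> GC; rewrite -setTD; apply: sigma_algebraCD.
have H1 A : measurable A -> <<s G >> (A `*` [set: T2]).
  rewrite M1; suff : <<s G1 >> `<=` [set A | <<s G >> (A `*` [set: T2])] by apply.
  apply: smallest_sub.
    split.
    - by rewrite /= set0X; exact: sigma_algebra0.
    - move=> B /= GB; rewrite setTD (_ : _ `*` _ = ~` (B `*` setT)); first exact: cC.
      apply/seteqP; split => -[x y] /=; first by move=> [Bx _] [].
      by move=> h; split=> // Bx; apply: h.
    - move=> F GF /=; rewrite setX_bigcupl; exact: sigma_algebra_bigcup.
  move=> A' GA' /=; rewrite -TU2 setX_bigcupr.
  apply: sigma_algebra_bigcup => n; apply: sub_sigma_algebra.
  by exists A' => //; exists (U2 n).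
have H2 B : measurable B -> <<s G >> ([set: T1] `*` B).
  rewrite M2; suff : <<s G2 >> `<=` [set B | <<s G >> ([set: T1] `*` B)] by apply.
  apply: smallest_sub.
    split.
    - by rewrite /= setX0; exact: sigma_algebra0.
    - move=> A /= GA; rewrite setTD (_ : _ `*` _ = ~` (setT `*` A)); first exact: cC.
      apply/seteqP; split => -[x y] /=; first by move=> [_ Bx] [].
      by move=> h; split=> // Bx; apply: h.
    - move=> F GF /=; rewrite setX_bigcupr; exact: sigma_algebra_bigcup.
  move=> B' GB' /=; rewrite -TU1 setX_bigcupl.
  apply: sigma_algebra_bigcup => n; apply: sub_sigma_algebra.
  by exists (U1 n) => //; exists B'.
move=> _ [A mA] [B mB] <-.
have -> : A `*` B = ~` (~` (A `*` [set: T2]) `|` ~` ([set: T1] `*` B)).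
  rewrite setCU !setCK; apply/seteqP; split => -[x y] /=; first by case.
  by move=> [[? _] [_ ?]].
apply: (cC); rewrite -bigcup2E; apply: sigma_algebra_bigcup => -[|[|n]] /=.
- by apply: (cC); exact: H1.
- by apply: (cC); exact: H2.
- exact: sigma_algebra0.
Qed.

Lemma setI_closed_prod (G1 : set (set T1)) (G2 : set (set T2)) :
  setI_closed G1 -> setI_closed G2 ->
  setI_closed [set A `*` B | A in G1 & B in G2].
Proof.
move=> I1 I2 _ _ [A GA] [B GB] <- [C GC] [D GD] <-; rewrite -setXI.
by exists (A `&` C); [exact: I1|exists (B `&` D) => //; exact: I2].
Qed.

End prod_gen.

(** * Locally integrable functions that vanish against test functions *)

Section fundamental.
Variable R : realType.
Local Notation E := (R4 R).
Local Notation mR := (measurableTypeR R).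
Local Notation E4 := (E4 R).
Local Notation mu := (lam4 R).

Definition oitv : set (set mR) := [set A | exists a b : R, A = `]a, b[%classic].

Lemma setI_closed_oitv : setI_closed oitv.
Proof.
move=> _ _ [a [b ->]] [c [d ->]]; exists (Num.max a c), (Num.min b d).
apply/seteqP; split => x /=; rewrite !in_itv /= gt_max lt_min.
  by move=> [/andP[-> ->] /andP[-> ->]].
by move=> /andP[/andP[-> ->] /andP[-> ->]].
Qed.

Lemma bigcup_oitv : \bigcup_n (`](- n%:R : R), n%:R[%classic : set mR) = setT.
Proof.
rewrite -subTset => x _; exists (Num.bound `|x : R|) => //=; rewrite in_itv /=.
by have := archi_boundP (normr_ge0 (x : R)); rewrite ltr_norml.
Qed.

Definition oboxes : set (set E4) :=
  [set A `*` B | A in [set A `*` B | A in [set A `*` B | A in oitv & B in oitv] & B in oitv] & B in oitv].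

Lemma measurable_oboxes : @measurable _ E4 = <<s oboxes >>.
Proof.
have M : @measurable _ mR = <<s oitv >> := RGenOpens.measurableE R.
have Un n : oitv (`](- n%:R : R), n%:R[%classic) by exists (- n%:R), n%:R.
have UT (T1 T2 : Type) (A : nat -> set T1) (B : nat -> set T2) :
    (forall n m, (n <= m)%N -> A n `<=` A m) -> (forall n m, (n <= m)%N -> B n `<=` B m) ->
    \bigcup_n A n = setT -> \bigcup_n B n = setT -> \bigcup_n (A n `*` B n) = setT.
  move=> nA nB TA TB; rewrite -subTset => -[x y] _.
  have [n _ Ax] : (\bigcup_n A n) x by rewrite TA.
  have [k _ By] : (\bigcup_n B n) y by rewrite TB.
  exists (n + k)%N => //; split; [exact: (nA _ _ (leq_addr k n)) Ax|].
  exact: (nB _ _ (leq_addl n k)) By.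
have ndI n m : (n <= m)%N -> `](- n%:R : R), n%:R[%classic `<=` `](- m%:R : R), m%:R[%classic.
  by move=> nm; apply: subset_itv; rewrite bnd_simp ?lerN2 ler_nat.
have nd2 (T1 T2 : Type) (A : nat -> set T1) (B : nat -> set T2) :
    (forall n m, (n <= m)%N -> A n `<=` A m) -> (forall n m, (n <= m)%N -> B n `<=` B m) ->
    forall n m, (n <= m)%N -> A n `*` B n `<=` A m `*` B m.
  by move=> nA nB n m nm [x y] [Ax By]; split; [exact: (nA n)|exact: (nB n)].
have T1 := bigcup_oitv.
pose I n := `](- n%:R : R), n%:R[%classic : set mR.
have T2 := UT _ _ I I ndI ndI T1 T1.
have n2 := nd2 _ _ I I ndI ndI.
have T3 := UT _ _ _ I n2 ndI T2 T1.
have M2 := measurable_prod_gen M M Un T1 Un T1.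
have Un2 n : [set A `*` B | A in oitv & B in oitv] (I n `*` I n).
  by exists (I n); [exact: Un|exists (I n); [exact: Un|]].
have M3 := measurable_prod_gen M2 M Un2 T2 Un T1.
have Un3 n : [set A `*` B | A in [set A `*` B | A in oitv & B in oitv] & B in oitv] (I n `*` I n `*` I n).
  by exists (I n `*` I n); [exact: Un2|exists (I n); [exact: Un|]].
exact: (measurable_prod_gen M3 M Un3 T3 Un T1).
Qed.

Lemma setI_closed_oboxes : setI_closed oboxes.
Proof. by do 3 (apply: setI_closed_prod; last exact: setI_closed_oitv); exact: setI_closed_oitv. Qed.

Lemma oboxesP (A : set E4) : oboxes A -> exists a b : E, A = obox a b.
Proof.
move=> [_ [_ [_ [a1 [b1 ->]] [_ [a2 [b2 ->]] <-]] [_ [a3 [b3 ->]] <-]] [_ [a4 [b4 ->]] <-]].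
by exists (a1, a2, a3, a4), (b1, b2, b3, b4).
Qed.


Definition locint (q : E -> R) := meas4 q /\
  forall n : nat, mu.-integrable (box4 `[- n%:R, n%:R]) (EFin \o q).

Lemma measurable_obox (a b : E) : measurable (obox a b : set E4).
Proof. by do !apply: measurableX => //; exact: measurable_itv. Qed.

Lemma obox_int0 q : locint q ->
  (forall phi, test_fun phi -> \int[mu]_x (q x * phi x) = 0) ->
  forall a b : E, (\int[mu]_(x in obox a b) (q x)%:E = 0)%E.
Proof.
move=> [mq Iq] q0 a b.
have [N cN] := compact_sub_box4 (@compact_cbox R a b).
have mb n : meas4 (boxbump n a b).
  by apply: continuous_meas4; exact: (@boxbump_smooth R n a b 0%N).
have mN : measurable (box4 `[- N%:R, N%:R] : set E4) by exact: measurable_box4.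
have mo := measurable_obox a b.
pose g x := (`|q x| * \1_(box4 `[- N%:R, N%:R]) x)%:E.
have bN n x : `|q x * boxbump n a b x| <= `|q x| * \1_(box4 `[- N%:R, N%:R]) x.
  rewrite normrM ler_wpM2l// indicE.
  have /andP[b0 b1] := boxbump_01 n a b x; rewrite ger0_norm//.
  have [xN|xN] := boolP (x \in _) => //=.
  have [->//|/boxbump_neq0/obox_cbox/cN] := eqVneq (boxbump n a b x) 0.
  by move/mem_set; rewrite (negbTE xN).
have Ig : mu.-integrable setT g.
  have := integrable_norm (Iq N); rewrite integrable_mkcond//.
  apply: eq_integrable => // x _; rewrite /g patchE indicE.
  by case: ifPn; rewrite ?mulr1 ?mulr0.
have := @dominated_cvg _ _ R mu setT measurableT
  (fun n x => (q x * boxbump n a b x)%:E) (fun x => (q x * \1_(obox a b) x)%:E) g.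
move=> H.
have cv : (\int[mu]_x (q x * boxbump n a b x)%:E)%E @[n --> \oo] -->
    (\int[mu]_x (q x * \1_(obox a b) x)%:E)%E.
  apply: H.
  - by move=> n; apply/measurable_EFinP; apply: measurable_funM.
  - move=> x _; apply: cvg_EFin; first exact: nearW.
    by apply: cvgM; [exact: cvg_cst|exact: boxbump_cvg].
  - by [].
  - exact: Ig.
  - by move=> n x _; rewrite /g lee_fin; exact: bN.
have {}cv : (\int[mu]_x (q x * \1_(obox a b) x)%:E = 0)%E.
  have : (fun n => \int[mu]_x (q x * boxbump n a b x)%:E)%E = cst 0%E.
    apply/funext => n; rewrite -intgK; first by rewrite q0//; exact: boxbump_test.
    have mf : meas4 (fun x : E => q x * boxbump n a b x) by exact: measurable_funM.
    exact: (intg_le mf (bN n) Ig).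
  by move=> e; move: cv; rewrite e => /cvg_lim <-//; rewrite lim_cst.
rewrite -cv integral_mkcond; apply: eq_integral => x _.
by rewrite patchE indicE; case: ifPn; rewrite ?mulr1 ?mulr0.
Qed.

(** The integral of q vanishes on open boxes, as a limit of pairings with bumps, and a pi-lambda
    argument extends this to all measurable sets. Intersecting with the box [B n] keeps q
    integrable, so that complements can be treated by subtraction. *)
Lemma fundamental q : locint q ->
  (forall phi, test_fun phi -> \int[mu]_x (q x * phi x) = 0) ->
  {ae mu, forall x, q x = 0}.
Proof.
move=> [mq Iq] q0.
pose nn (n : nat) : E := (n%:R, n%:R, n%:R, n%:R).
pose B n : set E4 := obox (- nn n) (nn n).
have oB n : oboxes (B n).
  by do 3 (eexists; [|eexists; [by do 2 eexists|reflexivity]]); do 2 eexists.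
have mB n : measurable (B n) by exact: measurable_obox.
have IB n : mu.-integrable (B n) (EFin \o q).
  apply: (integrableS _ _ _ (Iq n)) => //; first exact: measurable_box4.
  move=> x /obox_cbox [[[h1 h2] h3] h4].
  by do !split.
have P n (A : set E4) : measurable A -> (\int[mu]_(x in A `&` B n) (q x)%:E = 0)%E.
  rewrite measurable_oboxes.
  move: A; apply: (dynkin_induction measurable_oboxes setI_closed_oboxes).
  - rewrite /= setTI; exact: obox_int0.
  - move=> A oA /=; have /oboxesP[a [b ->]] := setI_closed_oboxes oA (oB n).
    exact: obox_int0.
  - move=> A mA /= H.
    have BE : B n = (A `&` B n) `|` (~` A `&` B n) by rewrite -setIUl setUv setTI.
    have : (\int[mu]_(x in B n) (q x)%:E = 0)%E by exact: obox_int0.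
    rewrite {1}BE integral_setU_EFin//.
    + by rewrite H add0e.
    + exact: measurableI.
    + by apply: measurableI => //; exact: measurableC.
    + rewrite -BE; exact: measurable_funTS.
    + by apply/disj_setPS => x [[? _] [? _]].
  - move=> F mF tF H /=; rewrite setI_bigcupl integral_bigcup//.
    + by apply: eseries0 => i _ _; exact: H.
    + by apply: trivIset_setIr.
    + by move=> k; apply: measurableI.
    + apply: (integrableS _ _ _ (IB n)) => //.
        by apply: bigcupT_measurable => k; apply: measurableI.
      by move=> x [k _ []].
have Hn n : ae_eq mu (B n) (EFin \o q) (cst 0%E).
  apply: integral_ae_eq => // A AB mA; rewrite integral0.
  by rewrite -(P n A mA) (setIidl AB).
have : {ae mu, forall x, forall n, B n x -> q x = 0}.
  by apply: ae_foralln => n; apply: filterS (Hn n) => x /= h Bx; have [] := h Bx.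
apply: filterS => -[[[x1 x2] x3] x4] h.
pose n := Num.bound (`|x1 : R| + `|x2 : R| + `|x3 : R| + `|x4 : R|).
have hn : `|x1 : R| + `|x2 : R| + `|x3 : R| + `|x4 : R| < n%:R.
  by apply: archi_boundP; rewrite !addr_ge0.
apply: (h n).
have b (y : R) : `|y| < n%:R -> `](- n%:R), n%:R[%classic y.
  by rewrite /= in_itv /= ltr_norml.
have h1 := normr_ge0 (x1 : R); have h2 := normr_ge0 (x2 : R).
have h3 := normr_ge0 (x3 : R); have h4 := normr_ge0 (x4 : R).
by do !split; apply: b; lra.
Qed.

End fundamental.

(** * Weak gradients *)

Section testfun.
Variable R : realType.
Local Notation E := (R4 R).
Local Notation E4 := (E4 R).
Local Notation mu := (lam4 R).

(** The weights against which weak convergence is tested. They include test functions, their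
    derivatives and indicators of boxes, and every L^2 or L^4 function is integrable against
    them. *)
Definition bdd_supp (f : E -> R) := [/\ meas4 f, exists2 C : R, 0 <= C & forall x, `|f x| <= C &
  exists N : nat, forall x, f x != 0 -> box4 `[- N%:R, N%:R] x].

Lemma continuous_bdd_supp (f : E -> R) (K : set E) : continuous f -> compact K ->
  (forall x, f x != 0 -> K x) -> bdd_supp f.
Proof.
move=> cf cK fK; split; first exact: continuous_meas4.
- have cfK : compact (f @` K).
    apply: continuous_compact => //; exact: continuous_subspaceT.
  have [M [_ HM]] := compact_bounded cfK.
  have /HM Hb : M < `|M| + 1 by rewrite (le_lt_trans (ler_norm M))// ltrDl.
  exists (`|M| + 1) => [|x]; first by rewrite addr_ge0.
  have [->|/fK Kx] := eqVneq (f x) 0; first by rewrite normr0 addr_ge0.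
  by apply: (Hb (f x)); exists x.
- have [N HN] := compact_sub_box4 cK; exists N => x /fK; exact: HN.
Qed.

Lemma test_continuous (phi : E -> R) : test_fun phi -> continuous phi.
Proof. by move=> [sm _]; exact: (sm 0%N). Qed.

Lemma test_bdd_supp (phi : E -> R) : test_fun phi -> bdd_supp phi.
Proof.
move=> T; apply: (@continuous_bdd_supp _ (closure [set x | phi x != 0])).
- exact: test_continuous.
- by case: T.
- by move=> x px; apply: subset_closure.
Qed.

Lemma testD_bdd_supp (phi : E -> R) v : test_fun phi -> bdd_supp ('D_v phi).
Proof.
move=> [sm cK]; apply: (@continuous_bdd_supp _ (closure [set x | phi x != 0])) => //.
  by case: (sm 1%N) => _ /(_ v).
move=> x; apply: contraNP => nx; apply/eqP.
have [->|v0] := eqVneq v 0; first by rewrite derive0.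
rewrite -[RHS](@derive_cst _ _ _ (0 : R) x v); apply: near_eq_derive => //.
have : nbhs x (~` closure [set x | phi x != 0]).
  by apply: open_nbhs_nbhs; split => //; apply: closed_openC; exact: closed_closure.
apply: filterS => y ny; apply/eqP; apply: contrapT => /negP py.
by apply: ny; apply: subset_closure.
Qed.

(** The bound by 1 + h covers u in L^2 and u in L^4 at once, with h = u^2 or h = u^4. *)
Lemma bdd_supp_intg (u h f : E -> R) : meas4 u -> intg mu h ->
  (forall x, `|u x| <= 1 + h x) -> bdd_supp f -> intg mu (fun x => u x * f x).
Proof.
move=> mu_ Ih uh [mf [C C0 fC] [N fN]].
have I1 : intg mu (\1_(box4 `[- N%:R, N%:R]) : E -> R).
  by apply: intg_indic; [exact: measurable_box4|exact: lam4_box_lty].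
have mf' : meas4 (fun x => u x * f x) by exact: measurable_funM.
have h1 x : 0 <= 1 + h x by exact: le_trans (uh x).
have ub x : `|u x * f x| <= C * \1_(box4 `[- N%:R, N%:R]) x + C * `|h x|.
  rewrite normrM; have [->|fx] := eqVneq (f x) 0.
    by rewrite normr0 mulr0 addr_ge0// mulr_ge0.
  rewrite indicE mem_set ?mulr1; last exact: fN.
  rewrite -[X in X + _]mulr1 -mulrDr mulrC ler_pM//.
  by apply: (le_trans (uh x)); rewrite lerD2l ler_norm.
apply: (intg_le mf' ub); apply: intgD; apply: intgZ => //.
exact: integrable_norm.
Qed.

Lemma bdd_supp_indic (n : nat) : bdd_supp (\1_(box4 `[- n%:R, n%:R])).
Proof.
split; first by apply: measurable_indic; exact: measurable_box4.
- by exists 1 => // x; rewrite indicE; case: (_ \in _); rewrite ?normr1 ?normr0.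
- exists n => x; rewrite indicE; have [/set_mem//|] := boolP (x \in _).
  by rewrite eqxx.
Qed.

Lemma bdd_supp_L2 (f : E -> R) : bdd_supp f -> L2 mu f.
Proof.
move=> bf; have [mf [C C0 fC] _] := bf; split=> //.
have I0 : intg mu (fun=> 0 : R) by exact: integrable0.
have b (x : E) : `|C^-1 * f x| <= 1 + 0.
  rewrite addr0 normrM; have [->|Cn] := eqVneq C 0.
    by rewrite invr0 normr0 mul0r.
  have Cp : 0 < C by rewrite lt_def Cn.
  by rewrite normfV (gtr0_norm Cp) mulrC ler_pdivrMr// mul1r.
have m : meas4 (fun x => C^-1 * f x) by exact: measurable_funM.
have := intgZ C (bdd_supp_intg m I0 b bf).
apply: intg_ext => x; have [C0'|Cn] := eqVneq C 0; last by rewrite mulrA mulVKf// expr2.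
have := fC x; rewrite C0' normr_le0 => /eqP ->; by rewrite expr0n !mulr0.
Qed.

Lemma bdd_supp_locint (u h : E -> R) : meas4 u -> intg mu h ->
  (forall x, `|u x| <= 1 + h x) -> locint u.
Proof.
move=> mu_ Ih uh; split=> // n.
have mB : measurable (box4 `[- n%:R, n%:R] : set E4) by exact: measurable_box4.
rewrite integrable_mkcond//.
have := @bdd_supp_intg u h (\1_(box4 `[- n%:R, n%:R])) mu_ Ih uh.
move=> /(_ (bdd_supp_indic n)); apply: eq_integrable => // x _ /=.
by rewrite patchE indicE; case: ifPn; rewrite ?mulr1 ?mulr0.
Qed.

Lemma derive_affine (f : E -> R) (r : R) (a v x : E) :
  (forall y, differentiable f y) ->
  differentiable (fun x => f (r *: x + a)) x /\
  'D_v (fun x => f (r *: x + a)) x = r * 'D_v f (r *: x + a).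
Proof.
move=> df.
have dS : differentiable (fun x : E => r *: x + a) x.
  by apply: (@differentiableD _ _ _ (fun x : E => r *: x) (cst a)).
have dc : differentiable (f \o (fun x : E => r *: x + a)) x.
  exact: differentiable_comp.
split=> //; rewrite deriveE; last exact: dc.
rewrite (_ : 'd _ x v = 'd (f \o (fun x : E => r *: x + a)) x v)//.
rewrite diff_comp//= deriveE//.
have -> : 'd (fun x : E => r *: x + a) x v = r *: v.
  rewrite -(deriveE _ dS).
  have := @deriveD _ _ _ (fun x : E => r *: x) (cst a) x v.
  rewrite derive_cst addr0 => ->.
  - by rewrite (@deriveZ _ _ _ id)// derive_id.
  - by apply: (@derivableZ _ _ _ id); exact: derivable_id.
  - exact: derivable_cst.
by rewrite linearZ.
Qed.

Lemma Ck_affine k (f : E -> R) (c r : R) (a : E) : Ck k f ->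
  Ck k (fun x => c * f (r *: x + a)).
Proof.
elim: k f c => [|k IH] f c /=.
  move=> cf x; apply: cvgM; first exact: cvg_cst.
  apply: (@continuous_comp _ _ _ (fun x : E => r *: x + a) f); last exact: cf.
  apply: cvgD; last exact: cvg_cst.
  by apply: cvgZ; [exact: cvg_cst|exact: cvg_id].
move=> [df cf]; have dd x v := @derive_affine f r a v x df.
split=> [x|v].
  by apply: (@differentiableZ _ _ _ (fun x => f (r *: x + a))); have [] := dd x 0.
rewrite (_ : 'D_v _ = fun x => (c * r) * 'D_v f (r *: x + a)); first exact: (IH ('D_v f) (c * r) (cf v)).
apply/funext => x; have [d1 d2] := dd x v.
rewrite (@deriveZ _ _ _ (fun x => f (r *: x + a))); last exact: diff_derivable.
by rewrite d2 /GRing.scale /= mulrA.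
Qed.

Lemma test_affine (phi : E -> R) (r : R) (a : E) : r != 0 -> test_fun phi ->
  test_fun (fun x => phi (r *: x + a)).
Proof.
move=> r0 [sm cK]; split.
  move=> k; have := Ck_affine 1 r a (sm k).
  by rewrite (_ : (fun x => _) = (fun x => phi (r *: x + a)))//;
    apply/funext => x; rewrite mul1r.
pose S' (x : E) := r^-1 *: x - r^-1 *: a.
have cS' : continuous S'.
  move=> x; apply: cvgD; last exact: cvg_cst.
  by apply: cvgZ; [exact: cvg_cst|exact: cvg_id].
have cK' : compact (S' @` closure [set x | phi x != 0]).
  by apply: continuous_compact => //; exact: continuous_subspaceT.
apply: (@subclosed_compact _ _ (S' @` closure [set x | phi x != 0])) => //.
  exact: closed_closure.
rewrite [X in X `<=` _]closureE => x; apply; split.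
  by apply: compact_closed => //; exact: norm_hausdorff.
move=> y /= py; exists (r *: y + a); first exact: subset_closure.
by rewrite /S' scalerDr scalerA mulVf// scale1r addrK.
Qed.

End testfun.

(** * Weak gradients, energy and rescaling *)

Section H1.
Variable R : realType.
Local Notation E := (R4 R).
Local Notation E4 := (E4 R).
Local Notation mu := (lam4 R).
Implicit Types (u v w phi : E -> R) (g k : 'I_4 -> E -> R).

Definition L4 u := meas4 u /\ intg mu (fun x => u x ^+ 4).

(* [Hdot1] with a prescribed weak gradient, in terms of real-valued integrals. *)
Definition H1 u g := [/\ L4 u, forall i, L2 mu (g i) &
  forall i phi, test_fun phi ->
    \int[mu]_x (u x * 'D_(e4 R i) phi x) = - \int[mu]_x (g i x * phi x)].

Lemma norm_le_1D4 (a : R) : `|a| <= 1 + a ^+ 4.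
Proof.
rewrite ler_norml; have h : 0 <= (a ^+ 2 - 1) ^+ 2 by exact: sqr_ge0.
have h1 : 0 <= (a - 1) ^+ 2 by exact: sqr_ge0.
have h2 : 0 <= (a + 1) ^+ 2 by exact: sqr_ge0.
apply/andP; split; nra.
Qed.

Lemma norm_le_1D2 (a : R) : `|a| <= 1 + a ^+ 2.
Proof.
rewrite ler_norml.
have h1 : 0 <= (a - 1) ^+ 2 by exact: sqr_ge0.
have h2 : 0 <= (a + 1) ^+ 2 by exact: sqr_ge0.
apply/andP; split; nra.
Qed.

Lemma L4_bdd_supp u f : L4 u -> bdd_supp f -> intg mu (fun x => u x * f x).
Proof. by move=> [mu_ Iu]; apply: (bdd_supp_intg mu_ Iu) => x; exact: norm_le_1D4. Qed.

Lemma L2_bdd_supp u f : L2 mu u -> bdd_supp f -> intg mu (fun x => u x * f x).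
Proof. by move=> [mu_ Iu]; apply: (bdd_supp_intg mu_ Iu) => x; exact: norm_le_1D2. Qed.

Lemma test_L2 phi : test_fun phi -> L2 mu phi.
Proof. by move=> /test_bdd_supp; exact: bdd_supp_L2. Qed.

Lemma L4_locint u : L4 u -> locint u.
Proof. by move=> [mu_ Iu]; apply: (bdd_supp_locint mu_ Iu) => x; exact: norm_le_1D4. Qed.

Lemma L2_locint u : L2 mu u -> locint u.
Proof. by move=> [mu_ Iu]; apply: (bdd_supp_locint mu_ Iu) => x; exact: norm_le_1D2. Qed.

Lemma Lp4_L4 u : Lp4 4 u <-> L4 u.
Proof.
have e : (fun x => (`|u x| ^+ 4)%:E) = (fun x => (u x ^+ 4)%:E).
  by apply/funext => x; rewrite -normrX ger0_norm// exprn_even_ge0.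
rewrite /Lp4 e; split=> [[m1 i1]|[m1 i1]]; split=> //.
  apply: intg_ge0P => //; first exact: measurable_funX.
  by move=> x; rewrite exprn_even_ge0.
exact: integrable_lty i1.
Qed.

Lemma Lp4_L2 u : Lp4 2 u <-> L2 mu u.
Proof.
have e : (fun x => (`|u x| ^+ 2)%:E) = (fun x => (u x ^+ 2)%:E).
  by apply/funext => x; rewrite -normrX ger0_norm// sqr_ge0.
rewrite /Lp4 e; split=> [[m1 i1]|[m1 i1]]; split=> //.
  apply: intg_ge0P => //; first exact: measurable_funX.
  by move=> x; rewrite sqr_ge0.
exact: integrable_lty i1.
Qed.

Lemma H1P u g : (Lp4 4 u /\ L2_weak_grad u g) <-> H1 u g.
Proof.
split=> [[/Lp4_L4 Lu [Lg wg]]|[Lu Lg wg]].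
  split=> // [i|i phi tp]; first exact/Lp4_L2.
  have [i1 [i2 e]] := wg i phi tp.
  apply: EFin_inj; rewrite EFinN intgK// intgK//.
split; first exact/Lp4_L4.
split=> [i|i phi tp]; first exact/Lp4_L2.
have i1 : intg mu (fun x => u x * 'D_(e4 R i) phi x).
  by apply: L4_bdd_supp => //; exact: testD_bdd_supp.
have i2 : intg mu (fun x => g i x * phi x).
  by apply: L2_bdd_supp => //; exact: test_bdd_supp.
split=> //; split=> //.
have := congr1 EFin (wg i phi tp); rewrite EFinN intgK// intgK//.
Qed.

Lemma Hdot1P u : Hdot1 u <-> exists g, H1 u g.
Proof.
split=> [[Lu [g Hg]]|[g /H1P[Lu Hg]]]; first by exists g; exact/H1P.
by split=> //; exists g.
Qed.

Lemma H1_grad u : Hdot1 u -> H1 u (grad u).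
Proof.
move=> [Lu [g Hg]]; apply/H1P; split=> //.
by rewrite /grad; case: xgetP => [k _ //|/(_ g)].
Qed.

(** [grad] is an arbitrary choice among weak gradients; uniqueness allows the energy to be computed
    with whichever gradient is explicit. *)
Lemma H1_unique u g k : H1 u g -> H1 u k ->
  forall i, {ae mu, forall x, g i x = k i x}.
Proof.
move=> [Lu Lg wg] [_ Lk wk] i.
suff : {ae mu, forall x, g i x - k i x = 0}.
  by apply: ae_imp => x /eqP; rewrite subr_eq0 => /eqP.
apply: fundamental; first by apply: L2_locint; exact: L2B.
move=> phi tp.
have -> : \int[mu]_x ((g i x - k i x) * phi x) =
    \int[mu]_x (g i x * phi x) - \int[mu]_x (k i x * phi x).
  rewrite -intB; first by apply: eq_Rintegral => x _; rewrite mulrBl.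
  - by apply: L2_bdd_supp => //; exact: test_bdd_supp.
  - by apply: L2_bdd_supp => //; exact: test_bdd_supp.
by apply/eqP; rewrite subr_eq0 -eqr_opp -wg// wk.
Qed.

Definition En u : R := \sum_(i < 4) \int[mu]_x (grad u i x) ^+ 2.

Lemma EnE u g : H1 u g -> En u = \sum_(i < 4) \int[mu]_x (g i x) ^+ 2.
Proof.
move=> Hg; have Hu : Hdot1 u by apply/Hdot1P; exists g.
have Hk := H1_grad Hu; apply: eq_bigr => i _.
have [_ /(_ i)[m1 _] _] := Hg; have [_ /(_ i)[m2 _] _] := Hk.
apply: int_ae; [exact: measurable_funX|exact: measurable_funX|].
by apply: ae_imp (H1_unique Hk Hg i) => x ->.
Qed.

Lemma En_ge0 u : 0 <= En u.
Proof. by apply: sumr_ge0 => i _; apply: int_ge0 => x; exact: sqr_ge0. Qed.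

Lemma KfunE u w : Hdot1 u -> Hdot1 w -> Kfun u w = En u + En w.
Proof.
move=> /H1_grad[_ Lu _] /H1_grad[_ Lw _].
have -> : Kfun u w = \int[mu]_x (\sum_(i < 4) (grad u i x ^+ 2 + grad w i x ^+ 2)) by [].
have I i : intg mu (fun x => grad u i x ^+ 2 + grad w i x ^+ 2).
  by apply: intgD; exact: L2_intg.
rewrite /En -big_split /=.
under eq_Rintegral do rewrite !big_ord_recl big_ord0 addr0.
rewrite !big_ord_recl big_ord0 addr0.
rewrite (intD (I _) (intgD (I _) (intgD (I _) (I _)))).
rewrite (intD (I _) (intgD (I _) (I _))) (intD (I _) (I _)).
by rewrite !(intD (L2_intg (Lu _)) (L2_intg (Lw _))).
Qed.

Lemma L4D u v : L4 u -> L4 v -> L4 (fun x => u x + v x).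
Proof.
move=> [mu_ Iu] [mv Iv].
have ms : meas4 (fun x => u x + v x) by exact: measurable_funD.
have m4 : meas4 (fun x => (u x + v x) ^+ 4) by exact: measurable_funX.
split=> //.
have b x : `|(u x + v x) ^+ 4| <= 8 * u x ^+ 4 + 8 * v x ^+ 4.
  rewrite ger0_norm ?exprn_even_ge0//.
  set a := u x; set b := v x.
  have h1 : (a + b) ^+ 2 <= 2 * a ^+ 2 + 2 * b ^+ 2.
    have := sqr_ge0 (a - b); nra.
  have h2 : 0 <= (a + b) ^+ 2 by exact: sqr_ge0.
  have -> : (a + b) ^+ 4 = ((a + b) ^+ 2) ^+ 2 by rewrite -exprM.
  have := sqr_ge0 (a ^+ 2 - b ^+ 2).
  nra.
by apply: (intg_le m4 b); apply: intgD; exact: intgZ.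
Qed.

Lemma L4Z u (c : R) : L4 u -> L4 (fun x => c * u x).
Proof.
move=> [mu_ Iu]; split; first exact: measurable_funM.
apply: (@intg_ext _ _ _ _ (fun x : E4 => c ^+ 4 * u x ^+ 4)).
  by move=> x; rewrite exprMn.
exact: intgZ.
Qed.

Lemma H1D u v g k : H1 u g -> H1 v k ->
  H1 (fun x => u x + v x) (fun i x => g i x + k i x).
Proof.
move=> [Lu Lg wg] [Lv Lk wk]; split=> [|i|i phi tp].
- exact: L4D.
- exact: L2D.
have bt := test_bdd_supp tp; have bD := @testD_bdd_supp R phi (e4 R i) tp.
have -> : \int[mu]_x ((u x + v x) * 'D_(e4 R i) phi x) =
    \int[mu]_x (u x * 'D_(e4 R i) phi x) + \int[mu]_x (v x * 'D_(e4 R i) phi x).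
  by rewrite -intD; [apply: eq_Rintegral => x _; rewrite mulrDl|exact: L4_bdd_supp..].
have -> : \int[mu]_x ((g i x + k i x) * phi x) =
    \int[mu]_x (g i x * phi x) + \int[mu]_x (k i x * phi x).
  by rewrite -intD; [apply: eq_Rintegral => x _; rewrite mulrDl|exact: L2_bdd_supp..].
by rewrite wg// wk// opprD.
Qed.

Lemma H1Z u g (c : R) : H1 u g -> H1 (fun x => c * u x) (fun i x => c * g i x).
Proof.
move=> [Lu Lg wg]; split=> [|i|i phi tp].
- exact: L4Z.
- exact: L2Z.
have bt := test_bdd_supp tp; have bD := @testD_bdd_supp R phi (e4 R i) tp.
have -> : \int[mu]_x ((c * u x) * 'D_(e4 R i) phi x) =
    c * \int[mu]_x (u x * 'D_(e4 R i) phi x).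
  by rewrite -intZ; [apply: eq_Rintegral => x _; rewrite mulrA|exact: L4_bdd_supp].
have -> : \int[mu]_x ((c * g i x) * phi x) = c * \int[mu]_x (g i x * phi x).
  by rewrite -intZ; [apply: eq_Rintegral => x _; rewrite mulrA|exact: L2_bdd_supp].
by rewrite wg// mulrN.
Qed.

Lemma H1B u v g k : H1 u g -> H1 v k ->
  H1 (fun x => u x - v x) (fun i x => g i x - k i x).
Proof.
move=> Hu Hv; have := H1D Hu (H1Z (-1) Hv).
rewrite (_ : (fun x => u x + -1 * v x) = (fun x => u x - v x)); last first.
  by apply/funext => x; rewrite mulN1r.
by rewrite (_ : (fun i x => g i x + -1 * k i x) = (fun i x => g i x - k i x))//;
  apply/funext => i; apply/funext => x; rewrite mulN1r.
Qed.

(** In these parameters the inner map is a [scaling_map] of factor r^4. That factor is cancelled by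
    the fourth power of r u and by the square of r^2 grad u, so the L^4 norm and the energy are both
    preserved. *)
Definition resc (r : R) (a : E) u : E -> R := fun x => r * u (r *: x + a).

Lemma rescaleE (r : R) (y : E) u :
  rescale r y u = resc r^-1 (- (r^-1 *: y)) u.
Proof. by apply/funext => x; rewrite /rescale /resc scalerBr. Qed.

Lemma H1_resc u g (r : R) (a : E) : 0 < r -> H1 u g ->
  H1 (resc r a u) (fun i x => r ^+ 2 * g i (r *: x + a)).
Proof.
move=> r0 [Lu Lg wg].
have SM := scaling_map_lam4 a r0.
have r4 : r ^+ 4 != 0 by rewrite expf_neq0// gt_eqF.
have [mS _ _] := SM.
split=> [|i|i phi tp].
- have [mu_ Iu] := Lu; apply: L4Z; split; first exact: measurableT_comp mu_ mS.
  by have [] := integral_scaling SM Iu.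
- have [mg Ig] := Lg i; apply: L2Z; split; first exact: measurableT_comp mg mS.
  by have [] := integral_scaling SM Ig.
(* The test function is moved to the original variable, where the integration by parts of u is
   available. *)
pose psi x := phi (r^-1 *: x - r^-1 *: a).
have tpsi : test_fun psi by apply: test_affine => //; rewrite invr_eq0 gt_eqF.
have phiE x : phi x = psi (r *: x + a).
  by rewrite /psi scalerDr scalerA mulVf ?gt_eqF// scale1r addrK.
have DphiE x : 'D_(e4 R i) phi x = r * 'D_(e4 R i) psi (r *: x + a).
  have dpsi y : differentiable psi y by have [sm _] := tpsi; have [] := sm 1%N.
  have [_ <-] := @derive_affine R psi r a (e4 R i) x dpsi.
  have phiF : phi = (fun x => psi (r *: x + a)) by apply/funext.
  by rewrite -phiF.
have Iu := L4_bdd_supp Lu (@testD_bdd_supp R psi (e4 R i) tpsi).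
have Ig := L2_bdd_supp (Lg i) (test_bdd_supp tpsi).
have [Iu' Eu] := integral_scaling SM Iu.
have [Ig' Eg] := integral_scaling SM Ig.
have -> : \int[mu]_x (resc r a u x * 'D_(e4 R i) phi x) =
    r ^+ 2 * \int[mu]_x (u (r *: (x : E) + a) * 'D_(e4 R i) psi (r *: (x : E) + a)).
  by rewrite -intZ//; apply: eq_Rintegral => x _; rewrite DphiE /resc; ring.
have -> : \int[mu]_x (r ^+ 2 * g i (r *: (x : E) + a) * phi x) =
    r ^+ 2 * \int[mu]_x (g i (r *: (x : E) + a) * psi (r *: (x : E) + a)).
  by rewrite -intZ//; apply: eq_Rintegral => x _; rewrite phiE; ring.
rewrite -mulrN; congr (_ * _); apply: (mulfI r4); rewrite mulrN -Eu -Eg.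
exact: wg.
Qed.

Lemma En_resc u (r : R) (a : E) : 0 < r -> Hdot1 u -> En (resc r a u) = En u.
Proof.
move=> r0 Hu; have Hg := H1_grad Hu.
rewrite (EnE (H1_resc a r0 Hg)); apply: eq_bigr => i _.
have [_ Lg _] := Hg; have [_ Ig] := Lg i.
have [I' ->] := integral_scaling (scaling_map_lam4 a r0) Ig.
by rewrite -intZ//; apply: eq_Rintegral => x _; ring.
Qed.

End H1.

(** * Translations and difference quotients *)

Section fubiniR.
Context d1 d2 (T1 : measurableType d1) (T2 : measurableType d2) (R : realType).
Variable m1 : {sigma_finite_measure set T1 -> \bar R}.
Variable m2 : {sigma_finite_measure set T2 -> \bar R}.
Implicit Types f : T1 * T2 -> R.

Lemma meas_int f : measurable_fun setT f ->
  measurable_fun setT (fun y => \int[m1]_x f (x, y)).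
Proof.
move=> mf; have mfe : measurable_fun setT (EFin \o f) by exact/measurable_EFinP.
apply: measurableT_comp; first exact: fine_measurable.
rewrite (_ : (fun y => _) = (fun y =>
  \int[m1]_x ((EFin \o f)^\+ (x, y)) - \int[m1]_x ((EFin \o f)^\- (x, y)))%E).
  apply: emeasurable_funB.
    apply: (measurable_fun_fubini_tonelli_G (EFin \o f)^\+%E) => //.
    exact: measurable_funepos.
  apply: (measurable_fun_fubini_tonelli_G (EFin \o f)^\-%E) => //.
  exact: measurable_funeneg.
apply/funext => y; rewrite integralE.
by congr (_ - _)%E; apply: eq_integral => x _; rewrite !(funeposE, funenegE).
Qed.

Lemma prod_intg (p : T1 -> R) (q : T2 -> R) : intg m1 p -> intg m2 q ->
  intg (prod_sfm m1 m2) (fun z => p z.1 * q z.2).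
Proof.
move=> Ip Iq; have mp := intg_meas Ip; have mq := intg_meas Iq.
have mz : measurable_fun setT (fun z : T1 * T2 => p z.1 * q z.2).
  by apply: measurable_funM; apply: measurableT_comp.
apply/integrableP; split; first exact/measurable_EFinP.
rewrite tonelli1//; last by apply: measurableT_comp => //; exact/measurable_EFinP.
have e x : (\int[m2]_y `|(EFin \o (fun z : T1 * T2 => p z.1 * q z.2)%R) (x, y)| =
   `|p x|%:E * \int[m2]_y `|(q y)%:E|)%E.
  rewrite -ge0_integralZl//.
  - by apply: eq_integral => y _; rewrite /= normrM.
  - by apply: measurableT_comp => //; exact/measurable_EFinP.
under eq_integral do rewrite e.
rewrite ge0_integralZr//.
- move/integrableP : Ip => [_ Ipo]; move/integrableP : Iq => [_ Iqo].
  by rewrite lte_mul_pinfty ?ge0_fin_numE ?integral_ge0.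
- by apply/measurable_EFinP; apply: measurableT_comp.
- exact: integral_ge0.
Qed.

Lemma fubiniR f : intg (prod_sfm m1 m2) f ->
  (forall x, intg m2 (fun y => f (x, y))) ->
  (forall y, intg m1 (fun x => f (x, y))) ->
  \int[m1]_x (\int[m2]_y f (x, y)) = \int[m2]_y (\int[m1]_x f (x, y)).
Proof.
move=> If I1 I2; rewrite /Rintegral; congr fine.
have := @Fubini _ _ _ _ R m1 m2 (EFin \o f) If => H.
transitivity (\int[m1]_x \int[m2]_y (EFin \o f) (x, y))%E.
  by apply: eq_integral => x _; rewrite -(intgK (I1 x)).
rewrite H; apply: eq_integral => y _.
by rewrite -(intgK (I2 y)).
Qed.

End fubiniR.

Section transl.
Variable R : realType.
Local Notation E := (R4 R).
Local Notation E4 := (E4 R).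
Local Notation mu := (lam4 R).
Implicit Types (u v w phi : E -> R) (g k : 'I_4 -> E -> R).

Lemma scaling_map_transl (a : E) :
  @scaling_map R _ E4 mu (fun x : E => x + a) 1.
Proof.
have := scaling_map_lam4 a (ltr01 : 0 < 1 :> R); rewrite expr1n.
by rewrite (_ : (fun x : E4 => _) = (fun x : E => x + a))//;
  apply/funext => x; rewrite scale1r.
Qed.

Lemma intg_transl u (a : E) : intg mu u ->
  intg mu (fun x : E => u (x + a)) /\ \int[mu]_x u ((x : E) + a) = \int[mu]_x u x.
Proof.
by move=> Iu; have [I1 ->] := integral_scaling (scaling_map_transl a) Iu; rewrite mul1r.
Qed.

Lemma meas_transl u (a : E) : meas4 u -> meas4 (fun x : E => u (x + a)).
Proof. by move=> mu_; have [mS _ _] := scaling_map_transl a; exact: measurableT_comp mu_ mS. Qed.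

Lemma L2_transl u (a : E) : L2 mu u ->
  L2 mu (fun x : E => u (x + a)) /\ \int[mu]_x u ((x : E) + a) ^+ 2 = \int[mu]_x u x ^+ 2.
Proof.
move=> [mu_ Iu]; have [I1 E1] := intg_transl a Iu.
by split=> //; split=> //; exact: meas_transl.
Qed.

Lemma L4_transl u (a : E) : L4 u -> L4 (fun x => u (x + a)).
Proof.
move=> [mu_ Iu]; have [I1 E1] := intg_transl a Iu.
by split=> //; exact: meas_transl.
Qed.

Lemma test_transl phi (a : E) : test_fun phi -> test_fun (fun x => phi (x + a)).
Proof.
move=> tp; have := test_affine a (oner_neq0 R) tp.
by rewrite (_ : (fun x => phi (1 *: x + a)) = (fun x => phi (x + a)))//;
  apply/funext => x; rewrite scale1r.
Qed.

Lemma derive_transl phi (a v x : E) : test_fun phi ->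
  'D_v (fun x => phi (x + a)) x = 'D_v phi (x + a).
Proof.
move=> [sm _]; have dp y : differentiable phi y by have [] := sm 1%N.
have [_] := @derive_affine R phi 1 a v x dp.
rewrite scale1r mul1r => <-.
suff -> : (fun x => phi (1 *: x + a)) = (fun x => phi (x + a)) by [].
by apply/funext => z; rewrite scale1r.
Qed.

End transl.

(** * L^2 bounds on differences of translates *)

Section diffquot.
Variable R : realType.
Local Notation E := (R4 R).
Local Notation E4 := (E4 R).
Local Notation mu := (lam4 R).
Local Notation lam := (lam1 R).
Implicit Types (u v w phi : E -> R) (g k : 'I_4 -> E -> R).

Lemma intg_itv (a b : R) : intg lam (\1_(`[a, b]%classic) : R -> R).
Proof.
apply: intg_indic; first exact: measurable_itv.
rewrite /lam1 /= lebesgue_measure_itv /=.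
by case: ifPn => _; rewrite -?EFinD ltry.
Qed.

Lemma int_itv0 (t : R) : 0 < t -> \int[lam]_s (\1_(`[0, t]%classic) s : R) = t.
Proof.
move=> t0; apply: EFin_inj; rewrite intgK; last exact: intg_itv.
rewrite integral_indic//.
by rewrite setIT /lam1 /= lebesgue_measure_itv /= lte_fin t0 oppr0 adde0.
Qed.

(** The line is run backwards because a translation of u by t e becomes one of phi by - t e after
    the change of variables. *)
Lemma line_FTC phi (x e : E) (t : R) : 0 < t -> test_fun phi ->
  \int[lam]_s (\1_(`[0, t]%classic) s * 'D_e phi (x - s *: e)) =
  phi x - phi (x - t *: e).
Proof.
move=> t0 tp; have [sm _] := tp.
have [dp cp] := sm 1%N.
pose psi y := - phi y.
have dpsi y : differentiable psi y by apply: differentiableN.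
pose F (s : R) := psi (x - s *: e).
have cl : continuous (fun s : R => x - s *: e).
  move=> s; apply: cvgB; first exact: cvg_cst.
  by apply: cvgZ; [exact: cvg_id|exact: cvg_cst].
have cF : continuous F.
  move=> s; apply: cvgN.
  by apply: (continuous_comp (cl s)); exact: test_continuous.
have cf : continuous (fun s : R => 'D_e phi (x - s *: e)).
  move=> s; apply: (@continuous_comp _ _ _ (fun s : R => x - s *: e) ('D_e phi)).
    exact: cl.
  exact: cp.
have dE (s : R) : derivable F s 1 /\ derive1 F s = 'D_e phi (x - s *: e).
  have eqf : (fun h : R => h^-1 *: (F (h + s) - F s)) =
     (fun h : R => h^-1 *: ((psi \o shift (x - s *: e)) (h *: (- e)) - psi (x - s *: e))).
    apply/funext => h /=; rewrite /F; congr (_ *: (psi _ - _)).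
    by rewrite scalerN scalerDl opprD addrCA.
  have eqf' : (fun h : R => h^-1 *: ((F \o shift s) (h *: 1) - F s)) =
     (fun h : R => h^-1 *: (F (h + s) - F s)).
    by apply/funext => h /=; rewrite [h *: 1]mulr1.
  split; first by rewrite /derivable eqf' eqf; apply: diff_derivable.
  rewrite /derive1 eqf -[LHS]/('D_(- e) psi (x - s *: e)).
  rewrite (@deriveN _ _ _ phi); last exact: diff_derivable.
  by rewrite !deriveE// linearN opprK.
have H : (\int[@lebesgue_measure R]_(s in `[0%R, t]) ('D_e phi (x - s *: e))%:E =
    (F t)%:E - (F 0)%:E)%E.
  apply: continuous_FTC2 => //.
  - exact: continuous_subspaceT.
  - split=> [s _||].
    + by have [] := dE s.
    + exact: cvg_at_right_filter (cF 0).
    + exact: cvg_at_left_filter (cF t).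
  - by move=> s _; have [_ ->] := dE s.
have -> : phi x - phi (x - t *: e) = fine ((F t)%:E - (F 0)%:E)%E.
  by rewrite /F /psi /= scale0r subr0 opprK addrC.
rewrite -H integral_mkcond /Rintegral; congr fine; apply: eq_integral => s _.
by rewrite patchE indicE; case: ifPn => _; rewrite ?mul1r ?mul0r.
Qed.

Lemma meas_shift_line (h : E -> R) (e : E) : meas4 h ->
  measurable_fun setT ((fun z : E4 * measurableTypeR R => h ((z.1 : E) - z.2 *: e))).
Proof.
move=> mh.
have := @meas_affine R _ (E4 * measurableTypeR R)%type fst (fun z => - (z.2 : R)) (cst e).
move=> /(_ measurable_fst) H.
have mS : measurable_fun setT ((fun z : E4 * measurableTypeR R =>
    (z.1 : E) - z.2 *: e) : _ -> E4).
  rewrite (_ : (fun z => _) = (fun z : E4 * measurableTypeR R => (z.1 : E) + (- (z.2 : R)) *: (cst e z : E))).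
    apply: H => //.
    by apply: (@measurableT_comp _ _ _ _ _ _ (@GRing.opp R)) => //; exact: measurable_snd.
  by apply/funext => z; rewrite scaleNr.
exact: measurableT_comp mh mS.
Qed.

(** Duality replaces the approximation of u by smooth functions. Against a test function phi, q is
    the integral over s in [0, t] of the pairing of [g i] with phi(x - s e). This functional [L] is
    bounded on L^2, so [riesz] represents it by some G with |G|^2 <= t^2 A, and q = G almost
    everywhere. *)
Lemma diff_quot u g i (t : R) : 0 < t -> H1 u g ->
  let q := fun x : E => u (x + t *: e4 R i) - u x in
  L2 mu q /\ \int[mu]_x q x ^+ 2 <= t ^+ 2 * \int[mu]_x g i x ^+ 2.
Proof.
move=> t0 [Lu Lg wg] q; set e := e4 R i; set A := \int[mu]_x g i x ^+ 2.
have Lgi := Lg i; have [mg Ig] := Lgi.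
pose J : set R := `[0, t]%classic.
pose c (h : E -> R) (s : R) := \int[mu]_x (g i x * h ((x : E) - s *: e)).
have LT h s : L2 mu h -> L2 mu (fun x : E => h (x - s *: e)).
  by move=> /(L2_transl (- (s *: e)))[].
have mc h : L2 mu h -> measurable_fun setT (c h : measurableTypeR R -> R).
  move=> [mh _]; apply: (@meas_int _ _ E4 (measurableTypeR R) R mu
    (fun z => g i z.1 * h ((z.1 : E) - z.2 *: e))).
  apply: measurable_funM; last exact: meas_shift_line.
  exact: (measurableT_comp mg).
have cb h s : L2 mu h -> `|c h s| <= 2^-1 * (t * A + t^-1 * \int[mu]_x h x ^+ 2).
  move=> Lh; have Ls := LT h s Lh.
  have EB : \int[mu]_x h ((x : E) - s *: e) ^+ 2 = \int[mu]_x h x ^+ 2.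
    by have [] := L2_transl (- (s *: e)) Lh.
  set B := \int[mu]_x h x ^+ 2 in EB *.
  (* The values l = 1/t and l = -1/t give |c h s| <= (t A + B / t) / 2, weighted so that integration
     over [0, t] produces (t^2 A + B) / 2. *)
  have P (l : R) : 0 <= A + 2 * l * c h s + l ^+ 2 * B.
    by rewrite -EB -int_sqrDZ//; apply: int_ge0 => x; exact: sqr_ge0.
  have P1 := P t^-1; have P2 := P (- t^-1).
  have tv : t * t^-1 = 1 by rewrite divff// gt_eqF.
  have tv0 : 0 < t^-1 by rewrite invr_gt0.
  rewrite ler_norml; set s' := t^-1 in P1 P2 tv tv0 *.
  have E1 : t * (A + 2 * s' * c h s + s' ^+ 2 * B) = t * A + 2 * c h s + s' * B.
    by rewrite /s'; field; rewrite gt_eqF.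
  have E2 : t * (A + 2 * (- s') * c h s + (- s') ^+ 2 * B) = t * A - 2 * c h s + s' * B.
    by rewrite /s'; field; rewrite gt_eqF.
  have Q1 : 0 <= t * A + 2 * c h s + s' * B by rewrite -E1 mulr_ge0// ltW.
  have Q2 : 0 <= t * A - 2 * c h s + s' * B by rewrite -E2 mulr_ge0// ltW.
  apply/andP; split; lra.
have IJ : intg lam (\1_J : R -> R) by exact: intg_itv.
have Ic h : L2 mu h -> intg lam (fun s => \1_J s * c h s).
  move=> Lh.
  have m1 : measurable_fun setT (fun s : measurableTypeR R => \1_J s * c h s).
    by apply: measurable_funM; [exact: intg_meas IJ|exact: mc].
  have b s : `|\1_J s * c h s| <= 2^-1 * (t * A + t^-1 * \int[mu]_x h x ^+ 2) * \1_J s.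
    rewrite normrM mulrC [`|\1_J s|]ger0_norm; last by rewrite indicE; case: (_ \in _).
    by rewrite ler_wpM2r ?cb// indicE; case: (_ \in _).
  exact: (intg_le m1 b (intgZ _ IJ)).
pose L h := \int[lam]_s (\1_J s * c h s).
have LD (h k : E4 -> R) (l : R) : L2 mu h -> L2 mu k -> L (fun x => h x + l * k x) = L h + l * L k.
  move=> Lh Lk; rewrite /L -intZ; last exact: Ic.
  rewrite -intD; [|exact: Ic|by apply: intgZ; exact: Ic].
  apply: eq_Rintegral => s _.
  suff -> : c (fun x => h x + l * k x) s = c h s + l * c k s by ring.
  rewrite /c -intZ; last by apply: L2_mul => //; exact: LT.
  rewrite -intD; [|by apply: L2_mul => //; exact: LT|].
    by apply: eq_Rintegral => x _; ring.
  by apply: intgZ; apply: L2_mul => //; exact: LT.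
have LC h : L2 mu h -> 2 * L h <= t ^+ 2 * A + \int[mu]_x h x ^+ 2.
  move=> Lh; set B := \int[mu]_x h x ^+ 2.
  have : L h <= \int[lam]_s (2^-1 * (t * A + t^-1 * B) * \1_J s).
    apply: int_le; [exact: Ic|exact: intgZ|] => s.
    rewrite mulrC ler_wpM2r//.
    exact: le_trans (ler_norm _) (cb h s Lh).
  rewrite intZ// int_itv0//.
  have -> : 2^-1 * (t * A + t^-1 * B) * t = 2^-1 * (t ^+ 2 * A + B).
    by field; rewrite gt_eqF.
  lra.
have [G LG GL] := riesz LD LC.
have GA : \int[mu]_x G x ^+ 2 <= t ^+ 2 * A.
  have := LC G LG; rewrite -GL//.
  have -> : \int[mu]_x (G x * G x) = \int[mu]_x G x ^+ 2.
    by apply: eq_Rintegral => x _; rewrite expr2.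
  lra.
have Lq : L4 q.
  rewrite /q; have L4t := L4_transl (t *: e) Lu.
  have := L4D L4t (L4Z (-1) Lu).
  by rewrite (_ : (fun x => _ + -1 * _) = q)//; apply/funext => x; rewrite /q mulN1r.
have key phi : test_fun phi -> \int[mu]_x (q x * phi x) = L phi.
  move=> tp; have bs := test_bdd_supp tp.
  have bD := @testD_bdd_supp R phi e tp.
  have bst : bdd_supp (fun x : E => phi (x - t *: e)).
    exact: (test_bdd_supp (test_transl (- (t *: e)) tp)).
  have Iut := L4_bdd_supp Lu bst; have Iu := L4_bdd_supp Lu bs.
  have -> : \int[mu]_x (q x * phi x) =
      \int[mu]_x (u x * phi ((x : E) - t *: e)) - \int[mu]_x (u x * phi x).
    have [I1 <-] := intg_transl (t *: e) Iut.
    rewrite -intB//; apply: eq_Rintegral => x _.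
    by rewrite /q addrK; ring.
  rewrite -intB//.
  pose f (z : E4 * measurableTypeR R) :=
    u z.1 * (\1_J z.2 * 'D_e phi ((z.1 : E) - z.2 *: e)).
  have mDp : meas4 ('D_e phi) by case: bD.
  have mu_ : meas4 u by case: Lu.
  have mf : measurable_fun setT f.
    apply: measurable_funM; first exact: measurableT_comp mu_ _.
    apply: measurable_funM; last exact: (meas_shift_line e mDp).
    exact: measurableT_comp (intg_meas IJ) _.
  have [_ [C C0 DC] [N DN]] := bD.
  have I0 (x : E) : intg lam (fun s => \1_J s * 'D_e phi (x - s *: e)).
    have m0 : measurable_fun setT (fun s : measurableTypeR R => \1_J s * 'D_e phi (x - s *: e)).
      apply: measurable_funM; first exact: intg_meas IJ.
      exact: (measurable_fun_pair2 x (meas_shift_line e mDp)).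
    have b s : `|\1_J s * 'D_e phi (x - s *: e)| <= C * \1_J s.
      rewrite normrM mulrC [`|\1_J s|]ger0_norm; last by rewrite indicE; case: (_ \in _).
      by rewrite ler_wpM2r// indicE; case: (_ \in _).
    exact: (intg_le m0 b (intgZ _ IJ)).
  have -> : \int[mu]_x (u x * phi ((x : E) - t *: e) - u x * phi x) =
      - \int[mu]_x (\int[lam]_s f (x, s)).
    have -> : \int[mu]_x (\int[lam]_s f (x, s)) =
        \int[mu]_x (u x * phi x - u x * phi ((x : E) - t *: e)).
      by apply: eq_Rintegral => x _; rewrite /f /= intZ// line_FTC// mulrBr.
    by rewrite !intB// opprB.
  (* Shifts by s e with 0 <= s <= t move the support by at most t |e|, so a single box serves for
     every s and f is dominated by a product. *)
  pose N' := Num.bound (N%:R + t * `|e|).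
  have HN' : N%:R + t * `|e| <= N'%:R.
    by apply/ltW/archi_boundP; rewrite addr_ge0// mulr_ge0// ltW.
  have fb z : `|f z| <= (`|u z.1| * \1_(box4 `[- N'%:R, N'%:R]) z.1) * (C * \1_J z.2).
    case: z => x s; rewrite /f /= !normrM -!mulrA ler_wpM2l//.
    have [->|Dn] := eqVneq ('D_e phi (x - s *: e)) 0.
      by rewrite normr0 mulr0 !mulr_ge0// indicE; case: (_ \in _).
    rewrite [\1_J s]indicE; have [sJ|sJ] := boolP (s \in J); last first.
      by rewrite normr0 mul0r !mulr0.
    rewrite normr1 mul1r mulr1 indicE mem_set ?mul1r//.
    have /box4_norm xN := DN _ Dn; apply/box4_norm.
    rewrite -[x](@subrK _ (s *: e)) (le_trans (ler_normD _ _))//.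
    apply: le_trans HN'; rewrite lerD// normrZ ler_wpM2r//.
    by move: sJ; rewrite inE /J /= in_itv /= => /andP[s0 st]; rewrite ger0_norm.
  have If : intg (prod_sfm mu lam) f.
    have [_ Iu4] := Lu.
    have mn : meas4 (fun x => `|u x|) by exact: measurableT_comp.
    have nb (x : E) : `| `|u x| | <= 1 + u x ^+ 4.
      by rewrite normr_id; exact: norm_le_1D4.
    have IuB := bdd_supp_intg mn Iu4 nb (bdd_supp_indic R N').
    exact: (intg_le mf fb (prod_intg IuB (intgZ C IJ))).
  have I1 x : intg lam (fun s => f (x, s)).
    have mfx : measurable_fun setT (fun s => f (x, s)) by exact: measurable_fun_pair2 mf.
    have b s : `|f (x, s)| <= (`|u x| * \1_(box4 `[- N'%:R, N'%:R]) x) * (C * \1_J s).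
      exact: (fb (x, s)).
    by apply: (intg_le mfx b); apply: intgZ; exact: intgZ.
  have I2' s : intg mu (fun x => u x * 'D_e phi ((x : E) - s *: e)).
    have bDs := @testD_bdd_supp R _ e (test_transl (- (s *: e)) tp).
    apply: intg_ext (L4_bdd_supp Lu bDs) => x.
    by rewrite derive_transl.
  have I2 s : intg mu (fun x => f (x, s)).
    apply: intg_ext (intgZ (\1_J s) (I2' s)) => x.
    by rewrite /f /=; ring.
  rewrite (fubiniR If I1 I2).
  have IL := Ic phi (test_L2 tp).
  rewrite /L.
  have -> : \int[lam]_y \int[mu]_x f (x, y) = \int[lam]_s (-1 * (\1_J s * c phi s)).
    apply: eq_Rintegral => s _.
    have -> : \int[mu]_x f (x, s) = \1_J s * \int[mu]_x (u x * 'D_e phi ((x : E) - s *: e)).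
      by rewrite -intZ//; apply: eq_Rintegral => x _; rewrite /f /=; ring.
    have -> : \int[mu]_x (u x * 'D_e phi ((x : E) - s *: e)) = - c phi s.
      rewrite -(wg i _ (test_transl (- (s *: e)) tp)).
      by apply: eq_Rintegral => x _; rewrite derive_transl.
    by ring.
  by rewrite intZ// mulN1r opprK.
(* At this point q is known to be in L^4 but not in L^2, so it is compared with G as a locally
   integrable function. *)
have : {ae mu, forall x, q x - G x = 0}.
  apply: fundamental.
    have [m1 I1] := L4_locint Lq; have [m2 I2] := L2_locint LG.
    split; first exact: measurable_funB.
    by move=> n; apply: (integrableB _ (I1 n) (I2 n)); exact: measurable_box4.
  move=> phi tp; have bs := test_bdd_supp tp.
  have -> : \int[mu]_x ((q x - G x) * phi x) = \int[mu]_x (q x * phi x) - \int[mu]_x (G x * phi x).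
    rewrite -intB; [|exact: L4_bdd_supp|exact: L2_bdd_supp].
    by apply: eq_Rintegral => x _; rewrite mulrBl.
  rewrite key// GL ?subrr//; exact: test_L2.
move=> ae0.
have [mG IG] := LG; have [mq Iq] := Lq.
have eqi : (\int[mu]_x (q x ^+ 2)%:E = \int[mu]_x (G x ^+ 2)%:E)%E.
  apply: ae_eq_integral => //.
  - by apply/measurable_EFinP; exact: measurable_funX.
  - by apply/measurable_EFinP; exact: measurable_funX.
  - apply: ae_imp ae0 => x /eqP; rewrite subr_eq0 => /eqP -> _ //.
have L2q : L2 mu q.
  apply: L2_of_int_lt => //; rewrite eqi -intgK// ltry//.
by split=> //; rewrite {1}/Rintegral eqi.
Qed.


Lemma diff_quot_signed u g i (t : R) : H1 u g ->
  let q := fun x : E => u (x + t *: e4 R i) - u x in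
  L2 mu q /\ \int[mu]_x q x ^+ 2 <= t ^+ 2 * \int[mu]_x g i x ^+ 2.
Proof.
move=> Hu q; have [t0|t0|t0] := ltgtP t 0; last 1 first.
- have q0 : q = cst 0 by apply/funext => x; rewrite /q t0 scale0r addr0 subrr.
  rewrite q0; split.
    split=> //; apply: (@intg_ext _ _ _ _ (cst 0)) => [x|]; last exact: integrable0.
    by rewrite /= expr0n.
  have -> : \int[mu]_x (cst 0 x : R) ^+ 2 = \int[mu]_x (0 : R).
    by apply: eq_Rintegral => x _; rewrite /= expr0n.
  rewrite Rintegral_cst// mul0r mulr_ge0 ?sqr_ge0//.
  by apply: int_ge0 => x; exact: sqr_ge0.
- have nt0 : 0 < - t by rewrite oppr_gt0.
  have [L1 B1] := diff_quot i nt0 Hu.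
  have [L2' E2] := L2_transl (t *: e4 R i) L1.
  have qE (x : E) : u (x + t *: e4 R i + - t *: e4 R i) - u (x + t *: e4 R i) = - q x.
    by rewrite /q scaleNr addrK opprB.
  have Lq : L2 mu q.
    have := L2Z (-1) L2'; rewrite (_ : (fun x => _) = q)//.
    by apply/funext => x; rewrite qE mulN1r opprK.
  split=> //; rewrite -sqrrN; apply: le_trans B1.
  rewrite -E2 le_eqVlt; apply/orP; left; apply/eqP.
  by apply: eq_Rintegral => x _; rewrite qE sqrrN.
- exact: diff_quot.
Qed.

Lemma vec_decomp (h : E) : h = h.1.1.1 *: e4 R ord0 + h.1.1.2 *: e4 R (inord 1)
   + h.1.2 *: e4 R (inord 2) + h.2 *: e4 R ord_max.
Proof.
rewrite /e4 /= !inordK//=; case: h => [[[h1 h2] h3] h4] /=.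
have sc (c a b d e : R) : c *: ((a, b, d, e) : E) = (c * a, c * b, c * d, c * e) by [].
have ad (a b c d a' b' c' d' : R) : ((a, b, c, d) : E) + (a', b', c', d') =
  (a + a', b + b', c + c', d + d') by [].
by rewrite !sc !ad !(mulr0, mulr1, addr0, add0r).
Qed.

Lemma sqr_sum4_le (b1 b2 b3 b4 : R) :
  (b1 + b2 + (b3 + b4)) ^+ 2 <= 4 * (b1 ^+ 2 + b2 ^+ 2 + b3 ^+ 2 + b4 ^+ 2).
Proof.
have h (x y : R) : (x + y) ^+ 2 <= 2 * (x ^+ 2 + y ^+ 2) by have := sqr_ge0 (x - y); nra.
have := h (b1 + b2) (b3 + b4); have := h b1 b2; have := h b3 b4; lra.
Qed.

(** The translation by h is split into four moves along the axes; translation invariance brings each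
    back to [diff_quot_signed]. The 4 is the number of squared terms, and each coordinate of h is at
    most the maximum norm |h|. *)
Lemma diff_bound u g (h : E) : H1 u g ->
  let q := fun x : E => u (x + h) - u x in
  L2 mu q /\ \int[mu]_x q x ^+ 2 <= 4 * `|h| ^+ 2 * En u.
Proof.
move=> Hu q.
pose a1 := h.1.1.1 *: e4 R ord0; pose a2 := h.1.1.2 *: e4 R (inord 1).
pose a3 := h.1.2 *: e4 R (inord 2); pose a4 := h.2 *: e4 R ord_max.
have [L1 B1] := diff_quot_signed ord0 h.1.1.1 Hu.
have [L2' B2] := diff_quot_signed (inord 1) h.1.1.2 Hu.
have [L3 B3] := diff_quot_signed (inord 2) h.1.2 Hu.
have [L4' B4] := diff_quot_signed ord_max h.2 Hu.
have [M2 E2] := L2_transl a1 L2'.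
have [M3 E3] := L2_transl (a1 + a2) L3.
have [M4 E4] := L2_transl (a1 + a2 + a3) L4'.
have qE : q = (fun x : E => ((u (x + a1) - u x) + (u (x + a1 + a2) - u (x + a1)))
  + ((u (x + (a1 + a2) + a3) - u (x + (a1 + a2)))
    + (u (x + (a1 + a2 + a3) + a4) - u (x + (a1 + a2 + a3))))).
  apply/funext => x; rewrite /q [in LHS](vec_decomp h) -/a1 -/a2 -/a3 -/a4.
  by rewrite !addrA; ring.
have Lq : L2 mu q.
  by rewrite qE; apply: L2D; apply: L2D.
split=> //.
pose S (x : E) := 4 * ((u (x + a1) - u x) ^+ 2 + (u (x + a1 + a2) - u (x + a1)) ^+ 2
  + (u (x + (a1 + a2) + a3) - u (x + (a1 + a2))) ^+ 2
    + (u (x + (a1 + a2 + a3) + a4) - u (x + (a1 + a2 + a3))) ^+ 2).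
have I1 := L2_intg L1; have I2 := L2_intg M2; have I3 := L2_intg M3; have I4 := L2_intg M4.
have : \int[mu]_x q x ^+ 2 <= \int[mu]_x S x.
  apply: int_le; first exact: L2_intg.
    by apply: intgZ; apply: intgD => //; apply: intgD => //; apply: intgD.
  move=> x; rewrite qE /S.
  exact: sqr_sum4_le.
rewrite /S intZ; last by apply: intgD => //; apply: intgD => //; apply: intgD.
rewrite intD//; last by apply: intgD => //; apply: intgD.
rewrite intD//; last exact: intgD.
rewrite intD// E2 E3 E4 (EnE Hu) => /le_trans; apply.
rewrite -mulrA ler_pM2l//.
have n1 : `|h.1.1.1| <= `|h| by case: (h) => [[[? ?] ?] ?]; rewrite !le_max lexx.
have n2 : `|h.1.1.2| <= `|h| by case: (h) => [[[? ?] ?] ?]; rewrite !le_max lexx !orbT.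
have n3 : `|h.1.2| <= `|h| by case: (h) => [[[? ?] ?] ?]; rewrite !le_max lexx !orbT.
have n4 : `|h.2| <= `|h| by case: (h) => [[[? ?] ?] ?]; rewrite !le_max lexx !orbT.
have sq (a : R) : `|a| <= `|h| -> a ^+ 2 <= `|h| ^+ 2.
  by move=> ah; rewrite -[a ^+ 2]real_normK ?num_real// lerXn2r ?nnegrE.
have g0 i : 0 <= \int[mu]_x g i x ^+ 2 by apply: int_ge0 => x; exact: sqr_ge0.
rewrite !big_ord_recl big_ord0 addr0.
have -> : lift ord0 ord0 = inord 1 :> 'I_4 by apply/val_inj; rewrite /= inordK.
have -> : lift ord0 (lift ord0 ord0) = inord 2 :> 'I_4 by apply/val_inj; rewrite /= inordK.
have -> : lift ord0 (lift ord0 (lift ord0 ord0)) = ord_max :> 'I_4 by exact/val_inj.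
have T i (a X : R) : `|a| <= `|h| -> X <= a ^+ 2 * \int[mu]_x g i x ^+ 2 ->
    X <= `|h| ^+ 2 * \int[mu]_x g i x ^+ 2.
  by move=> ah Xa; apply: (le_trans Xa); apply: ler_wpM2r; [exact: g0|exact: sq].
rewrite !mulrDr !addrA.
exact: lerD (lerD (lerD (T _ _ _ n1 B1) (T _ _ _ n2 B2)) (T _ _ _ n3 B3)) (T _ _ _ n4 B4).
Qed.

End diffquot.

(** * Refined Sobolev inequality *)

(** Comparisons whose operands still contain a conditional are postponed, so nested [min] and [max]
    are split from the inside out. *)
Ltac case_minmax := rewrite /Order.min /Order.max;
  repeat match goal with
  | |- context [if (?x < ?y)%O then _ else _] =>
    lazymatch x with
    | context [if _ then _ else _] => fail
    | _ => lazymatch y with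
           | context [if _ then _ else _] => fail
           | _ => case: (ltP x y) => ?
           end
    end
  end.

Section trunc.
Variable R : realType.
Implicit Types a b l s : R.

(** The slice of |a| between the heights l and 2 l. Slices at successive dyadic heights fit
    together, and [clamp] is the running sum, up to its bottom level. *)
Definition tr l a : R := Num.min (Num.max (`|a| - l) 0) l.

Lemma tr_ge0 l a : 0 <= l -> 0 <= tr l a.
Proof. by move=> l0; rewrite /tr le_min le_max lexx orbT l0. Qed.

Lemma tr_le l a : 0 <= l -> tr l a <= `|a|.
Proof.
move=> l0; rewrite /tr ge_min; apply/orP; left.
by rewrite ge_max normr_ge0 andbT lerBlDr lerDl.
Qed.

Lemma tr_le_l l a : tr l a <= l.
Proof. by rewrite /tr ge_min lexx orbT. Qed.

Lemma tr_top l a : 2 * l <= `|a| -> tr l a = l.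
Proof.
move=> la; apply/min_idPr; rewrite le_max; apply/orP; left; lra.
Qed.

Definition clamp l s a : R := Num.min (Num.max `|a| l) s.

Lemma clamp_tr l s a : 0 <= l -> l <= s ->
  clamp l (2 * s) a = clamp l s a + tr s a.
Proof.
by move=> l0 ls; rewrite /clamp /tr; case_minmax; lra.
Qed.

Lemma clamp_lip l s a b : `|clamp l s a - clamp l s b| <= `|a - b|.
Proof.
have h : `| `|a| - `|b| | <= `|a - b| by exact: ler_dist_dist.
apply: le_trans h; rewrite /clamp.
set x := `|a|; set y := `|b|; case: (lerP 0 (x - y)) => h;
  [rewrite (ger0_norm h)|rewrite (ltr0_norm h)]; rewrite ler_norml;
  by case_minmax; apply/andP; split; lra.
Qed.

Lemma clamp_tr_sign l s s' a b : 0 <= s' ->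
  0 <= (clamp l s a - clamp l s b) * (tr s' a - tr s' b).
Proof.
move=> s0.
wlog ab : a b / `|b| <= `|a|.
  move=> H; have [ab|ab] := leP `|b| `|a|; first exact: H.
  by rewrite -mulrNN !opprB; apply: H; exact: ltW.
apply: mulr_ge0; rewrite subr_ge0 /clamp /tr; move: ab;
  set x := `|a|; set y := `|b| => ab; case_minmax; lra.
Qed.

(** All slices are nondecreasing in |a|, so their increments share one sign and the sum of squares
    is at most the square of the sum. That sum is the increment of a clamp, which is 1-Lipschitz. *)
Lemma sum_tr_sqr (dl : R) n a b : 0 <= dl ->
  \sum_(j < n) (tr (dl * 2 ^+ j) a - tr (dl * 2 ^+ j) b) ^+ 2 <= (a - b) ^+ 2.
Proof.
move=> d0.
suff H : \sum_(j < n) (tr (dl * 2 ^+ j) a - tr (dl * 2 ^+ j) b) ^+ 2 <=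
    (clamp dl (dl * 2 ^+ n) a - clamp dl (dl * 2 ^+ n) b) ^+ 2.
  apply: (le_trans H).
  rewrite -[(clamp _ _ _ - _) ^+ 2]real_normK ?num_real//.
  rewrite -[(a - b) ^+ 2]real_normK ?num_real//.
  by rewrite lerXn2r ?nnegrE// clamp_lip.
elim: n => [|n IH]; first by rewrite big_ord0 sqr_ge0.
rewrite big_ord_recr /=.
have ds : dl <= dl * 2 ^+ n by rewrite ler_peMr// exprn_ege1// ler1n.
have -> : dl * 2 ^+ n.+1 = 2 * (dl * 2 ^+ n) by rewrite exprS; ring.
rewrite !(clamp_tr _ d0 ds).
have := @clamp_tr_sign dl (dl * 2 ^+ n) (dl * 2 ^+ n) a b (le_trans d0 ds).
move: IH; set S := \sum_(j < n) _; nra.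
Qed.

Lemma meas_tr d (T : measurableType d) l (f : T -> R) : measurable_fun setT f ->
  measurable_fun setT (fun x => tr l (f x)).
Proof.
move=> mf; apply: measurable_minr => //; apply: measurable_maxr => //.
by apply: measurable_funB => //; exact: measurableT_comp.
Qed.

(* [a] lies in one of the dyadic shells [2 l_j <= |a| < 4 l_j]. *)
Lemma dyadic_shell (dl : R) n a : 0 < dl -> 2 * dl <= `|a| -> `|a| < 2 * (dl * 2 ^+ n) ->
  a ^+ 4 <= \sum_(j < n) 256 * (dl * 2 ^+ j) ^+ 4 * (2 * (dl * 2 ^+ j) <= `|a|)%R%:R.
Proof.
move=> d0 la; elim: n => [|n IH]; first by rewrite expr0 mulr1 ltNge la.
rewrite big_ord_recr /=; set L := dl * 2 ^+ n; have L0 : 0 < L by rewrite mulr_gt0// exprn_gt0.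
have [h _|h] := ltP `|a| (2 * L).
  by rewrite mulr0 addr0; exact: IH.
have -> : dl * 2 ^+ n.+1 = 2 * L by rewrite exprS /L; ring.
move=> h2; rewrite mulr1 -[a ^+ 4]ger0_norm ?exprn_even_ge0// normrX.
apply: (@le_trans _ _ (256 * L ^+ 4)); last first.
  rewrite lerDr; apply: sumr_ge0 => j _; apply: mulr_ge0; last exact: ler0n.
  by apply: mulr_ge0; [exact: ler0n|exact: exprn_even_ge0].
have -> : 256 * L ^+ 4 = (4 * L) ^+ 4 by ring.
by rewrite lerXn2r ?nnegrE// ?mulr_ge0// ?ltW//; lra.
Qed.

End trunc.

(** * Level sets controlled by differences of truncations *)

Section sobolev.
Variable R : realType.
Local Notation E := (R4 R).
Local Notation E4 := (E4 R).
Local Notation mu := (lam4 R).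
Implicit Types (u v w f phi : E -> R) (g k : 'I_4 -> E -> R).

Definition cube : set E4 := box4 `[(0 : R), 1].

Lemma measurable_cube : measurable cube. Proof. exact: measurable_box4. Qed.
Lemma intg_cube : intg mu (\1_cube : E -> R).
Proof.
apply: intg_indic; first exact: measurable_cube.
exact: (lam4_box_lty 0 1).
Qed.
Lemma int_cube : \int[mu]_x (\1_cube x : R) = 1.
Proof.
apply: EFin_inj; rewrite intgK; last exact: intg_cube.
rewrite integral_indic//; last exact: measurable_cube.
by rewrite setIT; exact: lam4_cube.
Qed.
Lemma bdd_supp_cube : bdd_supp (\1_cube : E -> R).
Proof.
split; first by apply: measurable_indic; exact: measurable_cube.
- by exists 1 => // x; rewrite indicE; case: (_ \in _); rewrite ?normr1 ?normr0.
- exists 1%N => x; rewrite indicE; have [/set_mem/box4P h _|] := boolP (x \in _); last first.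
    by rewrite eqxx.
  by apply/box4P; move: h; rewrite !in_itv /= => -[? ? ? ?]; split; lra.
Qed.
Lemma cube_norm (h : E) : cube h -> `|h| <= 1.
Proof.
move=> /box4P hc; apply/box4_norm/box4P.
by move: hc; rewrite !in_itv /= => -[? ? ? ?]; split; lra.
Qed.
Lemma indic_ge0 d (T : measurableType d) (A : set T) x : 0 <= (\1_A x : R).
Proof. by rewrite indicE. Qed.

Lemma meas_joint f (r : R) : meas4 f ->
  measurable_fun setT (fun z : E4 * E4 => f ((z.1 : E) + r *: (z.2 : E))).
Proof.
move=> mf.
have mS := @meas_affine R _ (E4 * E4)%type fst (cst r) snd measurable_fst
  (@measurable_cst _ _ _ _ _ r) measurable_snd.
exact: measurableT_comp mf mS.
Qed.

(** Valued in [\bar R], so that Tonelli and the doubling bound apply to measurable functions before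
    any integrability is known. *)
Definition Dq f (h : E) : \bar R := (\int[mu]_x ((f ((x : E) + h) - f x) ^+ 2)%:E)%E.

Lemma Dq_ge0 f h : (0 <= Dq f h)%E.
Proof. by apply: integral_ge0 => x _; rewrite lee_fin sqr_ge0. Qed.

Lemma meas_diff_sqr f (h : E) : meas4 f ->
  @measurable_fun _ _ E4 _ setT (fun x : E => ((f (x + h) - f x) ^+ 2)%:E).
Proof.
move=> mf; apply/measurable_EFinP/measurable_funX/measurable_funB => //.
exact: meas_transl.
Qed.

(** The step 2 h is made in two steps h, and (p + q)^2 <= 2 p^2 + 2 q^2; translation invariance
    gives both the same integral. *)
Lemma Dq_double f h : meas4 f -> (Dq f (2 *: h) <= 4%:E * Dq f h)%E.
Proof.
move=> mf; have md := meas_diff_sqr h mf.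
have [mS _ HS] := scaling_map_transl h.
have E1 : Dq f h = (\int[mu]_x ((f ((x : E) + h + h) - f ((x : E) + h)) ^+ 2)%:E)%E.
  by rewrite /Dq (HS _ md) ?mul1e// => x; rewrite lee_fin sqr_ge0.
have md' : @measurable_fun _ _ E4 _ setT
    (fun x : E => ((f (x + h + h) - f (x + h)) ^+ 2)%:E).
  exact: measurableT_comp md mS.
have -> : (4%:E * Dq f h = 2%:E * Dq f h + 2%:E * Dq f h)%E.
  rewrite -ge0_muleDl ?lee_fin// -EFinD; congr (_%:E * _)%E; ring.
rewrite {1}E1 {2}/Dq -!ge0_integralZl//.
rewrite -ge0_integralD//; try exact: measurable_funeM.
apply: ge0_le_integral => //.
all: try by move=> x _; rewrite ?mule_ge0// lee_fin sqr_ge0.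
- exact: meas_diff_sqr.
- by apply: emeasurable_funD; exact: measurable_funeM.
move=> x _; rewrite -!EFinM -EFinD lee_fin.
have -> : (x : E) + 2 *: h = (x : E) + h + h by rewrite -addrA -mulr2n scaler_nat.
set a := f _; set b := f _; set c := f _.
have := sqr_ge0 ((a - c) - (c - b)); nra.
Qed.

Lemma Dq_pow f h n : meas4 f -> (Dq f (2 ^+ n *: h) <= (4 ^+ n)%:E * Dq f h)%E.
Proof.
move=> mf; elim: n => [|n IH]; first by rewrite !expr0 scale1r mul1e.
rewrite exprS -scalerA; apply: (le_trans (Dq_double _ mf)).
rewrite exprS EFinM -muleA lee_pmul2l//.
Qed.

Lemma Dq_meas f (r : R) : meas4 f ->
  @measurable_fun _ _ E4 _ setT (fun h : E => Dq f (r *: h)).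
Proof.
move=> mf.
apply: (@measurable_fun_fubini_tonelli_G _ _ E4 E4 R mu
  (fun z => ((f ((z.1 : E) + r *: (z.2 : E)) - f z.1) ^+ 2)%:E)).
  apply/measurable_EFinP/measurable_funX/measurable_funB; first exact: meas_joint.
  exact: measurableT_comp mf _.
by move=> z; rewrite lee_fin sqr_ge0.
Qed.

Lemma Dq_sum_tr f (dl : R) n h : meas4 f -> 0 <= dl ->
  (\sum_(j < n) Dq (fun x => tr (dl * 2 ^+ j) (f x)) h <= Dq f h)%E.
Proof.
move=> mf d0; rewrite /Dq -ge0_integral_sum//.
- apply: ge0_le_integral => //.
  + by move=> x _; apply: sume_ge0 => j _; rewrite lee_fin sqr_ge0.
  + by apply: emeasurable_sum => j; apply: meas_diff_sqr; exact: meas_tr.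
  + exact: meas_diff_sqr.
  + by move=> x _; rewrite sumEFin lee_fin sum_tr_sqr.
- by move=> j; apply: meas_diff_sqr; exact: meas_tr.
- by move=> j x _; rewrite lee_fin sqr_ge0.
Qed.

(** With y = x + r h the integral is the mean of |f| over the cube x + [0, r]^4, and the condition
    is invariant under [resc]. Integrability is included because the real-valued integral of a
    nonnegative function with infinite integral is 0 by convention. *)
Definition morrey (M : R) f := forall (x : E) (r : R), 0 < r ->
  intg mu (fun h : E => \1_cube h * `|f (x + r *: h)|) /\
  \int[mu]_h (\1_cube h * `|f (x + r *: (h : E))|) <= M / r.

(* At a point where [2 l <= |f x|] the truncation equals [l], while its average
   over the cube of side [4 M / l] at [x] is at most [l / 4]. *)
Lemma level_set_bound f (M l : R) : meas4 f -> morrey M f -> 0 < M -> 0 < l ->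
  ((2^-1 * l ^+ 2)%:E * mu [set x | (2 * l <= `|f x|)%R] <=
   \int[mu]_h ((\1_cube h)%:E * Dq (fun x => tr l (f x)) ((4 * M / l) *: (h : E))))%E.
Proof.
move=> mf HM M0 l0; set r := 4 * M / l.
have r0 : 0 < r by rewrite divr_gt0// mulr_gt0.
have l0' := ltW l0.
have mt : meas4 (fun x => tr l (f x)) by exact: meas_tr.
set A := [set x | _].
have mA : measurable (A : set E4).
  have -> : A = (fun x => `|f x|) @^-1` `[2 * l, +oo[%classic.
    by apply/seteqP; split=> x /=; rewrite in_itv /= andbT.
  rewrite -[_ @^-1` _]setTI; apply: (measurableT_comp _ mf) => //.
pose F (z : E4 * E4) : \bar R :=
  (\1_cube z.2 * (tr l (f ((z.1 : E) + r *: (z.2 : E))) - tr l (f z.1)) ^+ 2)%:E.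
have mF : measurable_fun setT F.
  apply/measurable_EFinP/measurable_funM.
    by apply: measurableT_comp => //; apply: measurable_indic; exact: measurable_cube.
  apply/measurable_funX/measurable_funB; first exact: (meas_joint r mt).
  exact: measurableT_comp mt _.
have F0 z : (0 <= F z)%E by rewrite lee_fin mulr_ge0 ?sqr_ge0// indic_ge0.
have pt (x : E) : ((2^-1 * l ^+ 2)%:E * (\1_A x)%:E <= \int[mu]_h F (x, h))%E.
  rewrite indicE; have [xA|xA] := boolP (x \in A); last first.
    by rewrite mule0 integral_ge0.
  rewrite mule1; move: xA; rewrite inE /A /= => xA.
  have [Ih Bh] := HM x r r0.
  have mth : meas4 (fun h : E => tr l (f (x + r *: h))).
    exact: measurable_fun_pair2 x (meas_joint r mt).
  have It : intg mu (fun h : E => \1_cube h * tr l (f (x + r *: h))).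
    have m1 : meas4 (fun h : E => \1_cube h * tr l (f (x + r *: h))).
      by apply: measurable_funM => //; exact: intg_meas intg_cube.
    have b (h : E) : `|\1_cube h * tr l (f (x + r *: h))| <= \1_cube h * `|f (x + r *: h)|.
      rewrite ger0_norm ?mulr_ge0 ?indic_ge0 ?tr_ge0//.
      by rewrite ler_wpM2l ?indic_ge0// tr_le.
    exact: (intg_le m1 b Ih).
  have Bt : \int[mu]_h (\1_cube h * tr l (f (x + r *: (h : E)))) <= l / 4.
    apply: le_trans (_ : M / r <= _); last first.
      by rewrite /r le_eqVlt; apply/orP; left; apply/eqP; field; rewrite !gt_eqF.
    apply: le_trans Bh; apply: int_le => // h.
    by rewrite ler_wpM2l ?indic_ge0// tr_le.
  (* From (l - b)^2 >= l^2 - 2 l b and an average of b at most l / 4, the mean square difference is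
     at least l^2 - l^2 / 2: this is the factor 1/2. *)
  have Is : intg mu (fun h : E => l ^+ 2 * \1_cube h - 2 * l * (\1_cube h * tr l (f (x + r *: h)))).
    by apply: intgB; apply: intgZ => //; exact: intg_cube.
  apply: (@le_trans _ _ (\int[mu]_h (l ^+ 2 * \1_cube h - 2 * l * (\1_cube h * tr l (f (x + r *: (h : E)))))%:E)%E).
    rewrite -intgK// lee_fin intB; [|by apply: intgZ; exact: intg_cube|exact: intgZ].
    rewrite intZ; last exact: intg_cube.
    rewrite int_cube intZ// mulr1.
    have := ler_wpM2l (ltW l0) Bt; nra.
  have IF : intg mu (fun h : E => \1_cube h * (tr l (f (x + r *: h)) - tr l (f x)) ^+ 2).
    have m1 : meas4 (fun h : E => \1_cube h * (tr l (f (x + r *: h)) - tr l (f x)) ^+ 2).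
      apply: measurable_funM; first exact: intg_meas intg_cube.
      by apply: measurable_funX; exact: measurable_funB.
    have b (h : E) : `|\1_cube h * (tr l (f (x + r *: h)) - tr l (f x)) ^+ 2| <= l ^+ 2 * \1_cube h.
      have nn : 0 <= \1_cube h * (tr l (f (x + r *: h)) - tr l (f x)) ^+ 2.
        by apply: mulr_ge0; [exact: indic_ge0|exact: sqr_ge0].
      rewrite (ger0_norm nn) mulrC; apply: ler_wpM2r; first exact: indic_ge0.
      have := tr_ge0 (f x) (ltW l0); have := tr_ge0 (f (x + r *: h)) (ltW l0).
      have := tr_le_l l (f x); have := tr_le_l l (f (x + r *: h)); nra.
    exact: (intg_le m1 b (intgZ _ intg_cube)).
  apply: le_integral => // h _; rewrite lee_fin /= (tr_top xA).
  have := indic_ge0 cube h; set c := \1_cube h; set b := tr l _ => c0.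
  have := mulr_ge0 c0 (sqr_ge0 b); nra.
have -> : ((2^-1 * l ^+ 2)%:E * mu A = \int[mu]_x ((2^-1 * l ^+ 2)%:E * (\1_A x)%:E))%E.
  rewrite ge0_integralZl//.
  - by rewrite integral_indic// setIT.
  - by apply/measurable_EFinP; exact: measurable_indic.
  - by rewrite lee_fin mulr_ge0// sqr_ge0.
apply: (@le_trans _ _ (\int[mu]_x \int[mu]_h F (x, h))%E).
  apply: ge0_le_integral => //.
  - by move=> x _; rewrite mule_ge0// lee_fin// mulr_ge0// sqr_ge0.
  - by apply: measurable_funeM; apply/measurable_EFinP; exact: measurable_indic.
  - exact: (@measurable_fun_fubini_tonelli_F _ _ E4 E4 R mu F).
rewrite -tonelli1// tonelli2//.
rewrite le_eqVlt; apply/orP; left; apply/eqP; apply: eq_integral => h _.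
rewrite /F /= /Dq -ge0_integralZl//.
- exact: (@meas_diff_sqr (fun x => tr l (f x)) (r *: (h : E)) mt).
- by move=> x _; rewrite lee_fin sqr_ge0.
Qed.

End sobolev.

Section dominated.
Context d (T : measurableType d) (R : realType) (mu : {measure set T -> \bar R}).

Lemma int_dominated (f : nat -> T -> R) (h g : T -> R) :
  (forall n, measurable_fun setT (f n)) -> measurable_fun setT h -> intg mu g ->
  (forall n x, `|f n x| <= g x) -> (forall x, f n x @[n --> \oo] --> h x) ->
  (\int[mu]_x f n x) @[n --> \oo] --> \int[mu]_x h x.
Proof.
move=> mf mh Ig fg fh.
have hg x : `|h x| <= g x.
  have : `|f n x| @[n --> \oo] --> `|h x| by apply: cvg_norm; exact: fh.
  by move=> /cvgr_to_le; apply; apply: nearW => n; exact: fg.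
have If n : intg mu (f n) := intg_le (mf n) (fg n) Ig.
have Ih : intg mu h := intg_le mh hg Ig.
apply: fine_cvg.
have -> : ((\int[mu]_x h x)%R%:E = \int[mu]_x (h x)%:E)%E by exact: intgK.
apply: (@dominated_cvg _ _ _ mu setT measurableT _ _ (EFin \o g)) => //.
- by move=> n; apply/measurable_EFinP.
- by move=> x _; apply: cvg_EFin; [exact: nearW|exact: fh].
- by move=> n x _; rewrite lee_fin.
Qed.

Lemma int_cut_cvg (S : nat -> set T) (f : T -> R) :
  (forall n, measurable (S n)) -> intg mu f ->
  (forall x, f x != 0 -> \forall n \near \oo, S n x) ->
  (\int[mu]_x (f x * \1_(S n) x)) @[n --> \oo] --> \int[mu]_x f x.
Proof.
move=> mS If fS; have mf := intg_meas If.
apply: (@int_dominated _ _ (fun x => `|f x|)) => //.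
- by move=> n; apply: measurable_funM => //; exact: measurable_indic.
- exact: integrable_norm If.
- move=> n x; rewrite normrM ler_piMr// indicE; case: (_ \in _); by rewrite ?normr1 ?normr0.
- move=> x; apply: cvg_near_cst; have [->|fx] := eqVneq (f x) 0.
    by apply: nearW => n; rewrite mul0r.
  by apply: filterS (fS x fx) => n xS; rewrite indicE mem_set// mulr1.
Qed.

End dominated.

Section sobolev.
Variable R : realType.
Local Notation E := (R4 R).
Local Notation E4 := (E4 R).
Local Notation mu := (lam4 R).
Local Notation cube := (@cube R).
Implicit Types (u v w f phi : E -> R) (g k : 'I_4 -> E -> R).

Lemma measurable_level f (l : R) : meas4 f -> measurable ([set x | (l <= `|f x|)%R] : set E4).
Proof.
move=> mf; have -> : [set x | (l <= `|f x|)%R] = (fun x => `|f x|) @^-1` `[l, +oo[%classic.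
  by apply/seteqP; split=> x /=; rewrite in_itv /= andbT.
by rewrite -[_ @^-1` _]setTI; apply: (measurableT_comp _ mf).
Qed.

(* [Dq f (2 h) <= 4 Dq f h] moves every scale [4 M / l_j] down to the smallest
   one, where the truncations at the different levels add up to at most [Dq u]. *)
Lemma level_sum_bound u g (M dl : R) n : H1 u g -> morrey M u -> 0 < M -> 0 < dl ->
  (\sum_(j < n) ((dl * 2 ^+ j) ^+ 4)%:E * mu [set x | (2 * (dl * 2 ^+ j) <= `|u x|)%R] <=
   (128 * M ^+ 2 * En u)%:E)%E.
Proof.
move=> Hu HM M0 d0; have [[mu_ _] _ _] := Hu.
pose l (j : nat) := dl * 2 ^+ j.
have l0 j : 0 < l j by rewrite mulr_gt0// exprn_gt0.
pose r := 4 * M / l n.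
have r0 : 0 < r by rewrite divr_gt0// mulr_gt0.
have mI : @measurable_fun _ _ E4 _ setT (fun h => (\1_cube h : R)%:E).
  by apply/measurable_EFinP; exact: intg_meas (intg_cube R).
have I0 (h : E4) : (0 <= (\1_cube h : R)%:E)%E by rewrite lee_fin indic_ge0.
have mt j : meas4 (fun x => tr (l j) (u x)) by exact: meas_tr.
have mD j s : @measurable_fun _ _ E4 _ setT
    (fun h : E => (\1_cube h)%:E * Dq (fun x => tr (l j) (u x)) (s *: h))%E.
  by apply: emeasurable_funM => //; exact: Dq_meas.
have D0 j s (h : E4) : (0 <= (\1_cube h)%:E * Dq (fun x => tr (l j) (u x)) (s *: (h : E)))%E.
  by rewrite mule_ge0// Dq_ge0.
have step (j : 'I_n) : ((l j ^+ 4)%:E * mu [set x | (2 * l j <= `|u x|)%R] <=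
    (2 * l n ^+ 2)%:E * \int[mu]_h ((\1_cube h)%:E * Dq (fun x => tr (l j) (u x)) (r *: (h : E))))%E.
  have H := level_set_bound mu_ HM M0 (l0 j).
  have -> : (l j ^+ 4 = (2 * l j ^+ 2) * (2^-1 * l j ^+ 2))%R by field.
  rewrite EFinM -muleA.
  have c0 : (0 <= 2 * l j ^+ 2)%R by rewrite mulr_ge0// sqr_ge0.
  apply: (le_trans (lee_wpmul2l _ H)); first by rewrite lee_fin.
  have ln : l n = l j * 2 ^+ (n - j) by rewrite /l -mulrA -exprD subnKC// ltnW.
  (* The cost 4^(n - j) of n - j doublings is (l n / l j)^2, so all levels acquire the same weight 2
     (l n)^2 and can be summed under one integral. *)
  have -> : (2 * l n ^+ 2 = (2 * l j ^+ 2) * 4 ^+ (n - j))%R.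
    by rewrite ln exprMn -exprM mulnC exprM mulrA; congr (_ * _ ^+ _); ring.
  rewrite [X in (_ <= X * _)%E]EFinM -muleA; apply: lee_wpmul2l; first by rewrite lee_fin.
  rewrite -ge0_integralZl//.
  apply: ge0_le_integral => //.
  - by apply: measurable_funeM; exact: mD.
  move=> h _; rewrite muleCA; apply: lee_wpmul2l => //.
  have -> : (4 * M / l j) *: (h : E) = 2 ^+ (n - j) *: (r *: (h : E)).
    rewrite scalerA; congr (_ *: _); rewrite /r ln; field.
    by rewrite gt_eqF ?exprn_gt0// gt_eqF.
  exact: Dq_pow.
apply: (@le_trans _ _ (\sum_(j < n) (2 * l n ^+ 2)%:E *
    \int[mu]_h ((\1_cube h)%:E * Dq (fun x => tr (l j) (u x)) (r *: (h : E))))%E).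
  by apply: lee_sum => j _; exact: step.
have c0 : (0 <= (2 * l n ^+ 2)%:E)%E by rewrite lee_fin mulr_ge0// sqr_ge0.
rewrite -ge0_sume_distrr; last by move=> j _; apply: integral_ge0.
rewrite -ge0_integral_sum//.
have b : (\int[mu]_h (\sum_(j < n) (\1_cube h)%:E * Dq (fun x => tr (l j) (u x)) (r *: (h : E)))
   <= (4 * r ^+ 2 * En u)%:E)%E.
  apply: (@le_trans _ _ (\int[mu]_h ((4 * r ^+ 2 * En u)%:E * (\1_cube h)%:E))%E).
    apply: ge0_le_integral => //.
    - by move=> h _; apply: sume_ge0.
    - by apply: emeasurable_sum => j; exact: mD.
    - exact: measurable_funeM.
    move=> h _; rewrite -ge0_sume_distrr; last by move=> j _; exact: Dq_ge0.
    rewrite muleC !indicE; have [hc|hc] := boolP (h \in cube); last by rewrite !mule0.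
    rewrite !mule1; apply: (le_trans (Dq_sum_tr _ _ mu_ (ltW d0))).
    have [Lq Bq] := diff_bound (r *: (h : E)) Hu.
    rewrite /Dq -intgK; last exact: L2_intg.
    rewrite lee_fin; apply: (le_trans Bq); rewrite ler_wpM2r ?En_ge0// ler_wpM2l//.
    rewrite normrZ exprMn real_normK ?num_real// ler_piMr ?sqr_ge0//.
    by rewrite exprn_ile1//; apply: cube_norm; exact: set_mem.
  rewrite ge0_integralZl//; last by rewrite lee_fin mulr_ge0 ?En_ge0// mulr_ge0// sqr_ge0.
  rewrite -intgK; last exact: intg_cube.
  by rewrite int_cube mule1.
(* As r = 4 M / l n, the product 2 (l n)^2 * 4 r^2 is 128 M^2: the level cancels. *)
apply: (le_trans (lee_wpmul2l c0 b)); rewrite -EFinM lee_fin le_eqVlt; apply/orP; left.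
by apply/eqP; rewrite /r; field; rewrite gt_eqF.
Qed.

(** The shells 2 * 2^-n <= |u| < 2 * 2^n exhaust the set where u is nonzero. Each is cut into 2 n
    dyadic levels starting at 2^-n, and [level_sum_bound] does not depend on their number. The
    constant 256 comes from [dyadic_shell] and 128 from [level_sum_bound]. *)
Lemma refined_sobolev : exists2 C : R, 0 < C & forall u g (M : R),
  H1 u g -> morrey M u -> 0 < M -> \int[mu]_x u x ^+ 4 <= C * M ^+ 2 * En u.
Proof.
exists (256 * 128); first by apply: mulr_gt0; rewrite ltr0n.
move=> u g M Hu HM M0; have [[mu_ Iu] _ _] := Hu.
pose A (l : R) := [set x : E | (l <= `|u x|)%R].
have mA l : measurable (A l : set E4) by exact: measurable_level.
pose S n := A (2 * 2 ^- n) `\` A (2 * 2 ^+ n).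
have mS n : measurable (S n : set E4) by exact: measurableD.
suff H n : \int[mu]_x (u x ^+ 4 * \1_(S n) x) <= (256 * 128) * M ^+ 2 * En u.
  have := @int_cut_cvg _ _ _ mu S _ mS Iu.
  move=> /(_ _)/cvgr_to_le; apply; last by exact: nearW.
  move=> x ux.
  have u0 : 0 < `|u x| by rewrite normr_gt0; apply: contraNneq ux => ->; rewrite expr0n.
  have n2 n : n%:R <= 2 ^+ n :> R by rewrite -natrX ler_nat ltnW// ltn_expl.
  have h1 := nbhs_infty_ger (2 / `|u x|); have h2 := nbhs_infty_ger (`|u x|).
  near=> n; have p0 : 0 < 2 ^+ n :> R by rewrite exprn_gt0.
  split; rewrite /A /=.
    have : 2 / `|u x| <= 2 ^+ n by apply: le_trans (n2 n); near: n.
    by rewrite ler_pdivrMr// ler_pdivrMr// mulrC.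
  apply/negP; rewrite -ltNge.
  have : `|u x| <= 2 ^+ n by apply: le_trans (n2 n); near: n.
  lra.
pose dl : R := 2 ^- n.
have d0 : 0 < dl by rewrite invr_gt0 exprn_gt0.
have dE : dl * 2 ^+ (n + n) = 2 ^+ n by rewrite /dl exprD mulKf// expf_neq0.
have Is : intg mu (fun x : E4 => u x ^+ 4 * \1_(S n) x).
  have m1 : meas4 (fun x => u x ^+ 4 * \1_(S n) x).
    by apply: measurable_funM; [exact: measurable_funX|exact: measurable_indic].
  have b (x : E) : `|u x ^+ 4 * \1_(S n) x| <= u x ^+ 4.
    have u4 : 0 <= u x ^+ 4 by rewrite exprn_even_ge0.
    rewrite normrM (ger0_norm u4) ler_piMr// indicE.
    by case: (_ \in _); rewrite ?normr1 ?normr0.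
  exact: (intg_le m1 b Iu).
rewrite -lee_fin intgK//.
have mAi j : @measurable_fun _ _ E4 _ setT (fun x => (\1_(A (2 * (dl * 2 ^+ j))) x : R)%:E).
  by apply/measurable_EFinP; exact: measurable_indic.
have l4 j : 0 <= (dl * 2 ^+ j) ^+ 4 by rewrite exprn_even_ge0.
have t0 j x : (0 <= (256 * (dl * 2 ^+ j) ^+ 4)%:E * (\1_(A (2 * (dl * 2 ^+ j))) x : R)%:E)%E.
  rewrite -EFinM lee_fin; apply: mulr_ge0; last exact: indic_ge0.
  by apply: mulr_ge0; [exact: ler0n|exact: l4].
apply: (@le_trans _ _ (\int[mu]_x (\sum_(j < n + n)
    (256 * (dl * 2 ^+ j) ^+ 4)%:E * (\1_(A (2 * (dl * 2 ^+ j))) x)%:E))%E).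
  apply: ge0_le_integral => //.
  - by move=> x _; rewrite lee_fin mulr_ge0 ?indic_ge0// exprn_even_ge0.
  - by apply/measurable_EFinP; exact: intg_meas Is.
  - by apply: emeasurable_sum => j; exact: measurable_funeM.
  move=> x _; have [[]|xS] := pselect (S n x); last first.
    by rewrite indicE memNset// mulr0; apply: sume_ge0 => j _; exact: t0.
  rewrite /A /= => x1 /negP; rewrite -ltNge => x2.
  under eq_bigr do rewrite -EFinM.
  rewrite sumEFin lee_fin indicE mem_set ?mulr1; last by split=> //=; apply/negP; rewrite -ltNge.
  rewrite -dE in x2; apply: (le_trans (dyadic_shell d0 x1 x2)).
  apply: ler_sum => j _; rewrite indicE.
  by rewrite (_ : (x \in _) = (2 * (dl * 2 ^+ j) <= `|u x|)%R)//; apply/idP/idP;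
    rewrite inE.
rewrite ge0_integral_sum; last 3 first.
- exact: measurableT.
- by move=> j; exact: measurable_funeM.
- by move=> j x _; exact: t0.
have -> : 256 * 128 * M ^+ 2 * En u = 256 * (128 * M ^+ 2 * En u) by ring.
have c0 : (0 <= 256%:E :> \bar R)%E by rewrite lee_fin ler0n.
rewrite EFinM; apply: le_trans (lee_wpmul2l c0 (level_sum_bound (n + n) Hu HM M0 d0)).
rewrite ge0_sume_distrr; last by move=> j _; rewrite mule_ge0// lee_fin.
apply: lee_sum => j _; rewrite ge0_integralZl//; last first.
  by rewrite lee_fin; apply: mulr_ge0; [exact: ler0n|exact: l4].
by rewrite integral_indic// setIT EFinM muleA.
Unshelve. all: by end_near.
Qed.

End sobolev.

(** * Sobolev inequality and nonvanishing averages *)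

Section sobolev.
Variable R : realType.
Local Notation E := (R4 R).
Local Notation E4 := (E4 R).
Local Notation mu := (lam4 R).
Local Notation cube := (@cube R).
Implicit Types (u v w f phi : E -> R) (g k : 'I_4 -> E -> R).

Lemma L4_resc u (r : R) (x : E) : 0 < r -> L4 u ->
  L4 (resc r x u) /\ \int[mu]_h (resc r x u h) ^+ 4 = \int[mu]_x u x ^+ 4.
Proof.
move=> r0 [mu_ Iu]; have [mS _ _] := scaling_map_lam4 x r0.
have [I' ->] := integral_scaling (scaling_map_lam4 x r0) Iu.
have e : (fun h => resc r x u h ^+ 4) = (fun h => r ^+ 4 * u (r *: h + x) ^+ 4).
  by apply/funext => h; rewrite /resc exprMn.
split; last by rewrite e intZ.
split; last by rewrite e; exact: intgZ.
apply: measurable_funM => //; exact: measurableT_comp mu_ mS.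
Qed.

Lemma young14 (l a : R) : 0 < l -> `|a| <= l + l ^- 3 * a ^+ 4.
Proof.
move=> l0; have e (y : R) : `|y| = l * (`|y| / l) by field; rewrite gt_eqF.
have h := norm_le_1D4 (a / l); have ln : l != 0 by rewrite gt_eqF.
rewrite normrM normfV (gtr0_norm l0) in h.
have := ler_wpM2l (ltW l0) h; rewrite -e => /le_trans; apply.
rewrite le_eqVlt; apply/orP; left; apply/eqP; field.
by rewrite ln.
Qed.

Lemma intg_cube_L4 u : L4 u -> intg mu (fun h : E4 => \1_cube h * `|u h|).
Proof.
move=> [mu_ Iu]; have ma : meas4 (fun x => `|u x|) by exact: measurableT_comp.
have ms := intg_meas (intg_cube R).
have m : meas4 (fun h : E4 => \1_cube h * `|u h|) by exact: measurable_funM.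
have b (h : E4) : `|\1_cube h * `|u h| | <= \1_cube h + u h ^+ 4.
  rewrite normrM normr_id ger0_norm ?indic_ge0// indicE.
  have := norm_le_1D4 (u h); have : 0 <= u h ^+ 4 by rewrite exprn_even_ge0.
  by case: (_ \in _); rewrite ?mul1r ?mul0r ?add0r.
exact: (intg_le m b (intgD (intg_cube R) Iu)).
Qed.

Lemma morrey_resc u (M : R) : L4 u ->
  (forall (x : E) (r : R), 0 < r -> \int[mu]_h (\1_cube h * `|resc r x u h|) <= M) ->
  morrey M u.
Proof.
move=> Lu HM x r r0; have [Lr _] := L4_resc x r0 Lu.
have I1 := intg_cube_L4 Lr.
have e : (fun h : E => \1_cube h * `|u (x + r *: h)|) =
    (fun h => r^-1 * (\1_cube h * `|resc r x u h|)).
  apply/funext => h; rewrite /resc normrM (gtr0_norm r0) [x + _]addrC.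
  by field; rewrite gt_eqF.
rewrite e; split; first exact: intgZ.
by rewrite intZ// mulrC ler_wpM2r ?invr_ge0 ?(ltW r0)// HM.
Qed.

(** Young's inequality with parameter t bounds the average by two terms, each at most t, at every
    scale because [resc] preserves the L^4 norm. *)
Lemma morrey_L4 u (t : R) : L4 u -> 0 < t -> \int[mu]_x u x ^+ 4 <= t ^+ 4 ->
  morrey (2 * t) u.
Proof.
move=> Lu t0 ut; apply: morrey_resc => // x r r0; have [Lr Er] := L4_resc x r0 Lu.
apply: (@le_trans _ _ (\int[mu]_h (t * \1_cube h + t ^- 3 * resc r x u h ^+ 4))).
  apply: int_le; first exact: intg_cube_L4.
    by apply: intgD; apply: intgZ; [exact: intg_cube|case: Lr].
  move=> h; have := young14 (resc r x u h) t0.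
  have : 0 <= t ^- 3 * resc r x u h ^+ 4.
    by rewrite mulr_ge0 ?exprn_even_ge0// invr_ge0 exprn_ge0// ltW.
  rewrite indicE; case: (_ \in _); rewrite ?mul1r ?mul0r ?mulr1 ?mulr0 ?add0r//.
rewrite intD; [|by apply: intgZ; exact: intg_cube|by apply: intgZ; case: Lr].
rewrite !intZ ?int_cube ?mulr1 ?Er; [|by case: Lr|exact: intg_cube].
have e : t ^- 3 * t ^+ 4 = t by field; rewrite gt_eqF.
rewrite (_ : 2 * t = t + t); last by ring.
by rewrite lerD2l -[leRHS]e ler_wpM2l// invr_ge0 exprn_ge0// ltW.
Qed.

Lemma int4_ge0 u : 0 <= \int[mu]_x u x ^+ 4.
Proof. by apply: int_ge0 => x; rewrite exprn_even_ge0. Qed.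

(** With t the L^4 norm, the refined inequality for M = 2 t reads t^4 <= 4 C t^2 En u; dividing by
    t^2 is possible once the case of zero norm is set apart. *)
Lemma sobolev : exists2 c : R, 0 < c &
  forall u g, H1 u g -> \int[mu]_x u x ^+ 4 <= (c * En u) ^+ 2.
Proof.
have [C C0 RS] := refined_sobolev R.
exists (4 * C); first by rewrite mulr_gt0.
move=> u g Hu; set A := \int[mu]_x _; have A0 : 0 <= A := int4_ge0 u.
have [->|An] := eqVneq A 0; first exact: sqr_ge0.
have Ap : 0 < A by rewrite lt_def An.
pose t := Num.sqrt (Num.sqrt A).
have t0 : 0 < t by rewrite !sqrtr_gt0.
have tA : t ^+ 4 = A.
  by rewrite (_ : t ^+ 4 = (t ^+ 2) ^+ 2); [rewrite !sqr_sqrtr ?sqrtr_ge0|rewrite -exprM].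
have [Lu _ _] := Hu.
have HM : morrey (2 * t) u by apply: morrey_L4 => //; rewrite tA.
have h : t ^+ 4 <= C * (2 * t) ^+ 2 * En u.
  by rewrite tA; apply: (RS _ _ _ Hu HM); rewrite mulr_gt0.
have h2 : t ^+ 2 <= 4 * C * En u.
  rewrite -(ler_pM2l (exprn_gt0 2 t0)) -exprD; apply: (le_trans h).
  by rewrite le_eqVlt; apply/orP; left; apply/eqP; ring.
rewrite -tA (_ : t ^+ 4 = (t ^+ 2) ^+ 2); last by rewrite -exprM.
by rewrite lerXn2r ?nnegrE ?exprn_ge0 ?(ltW t0)// !mulr_ge0 ?En_ge0 ?(ltW C0).
Qed.

(** Contrapositive of [refined_sobolev] with M = d, the offending cube being carried to the unit
    cube by [resc]. *)
Lemma nonvanishing : exists2 C : R, 0 < C & forall u g (d : R), H1 u g -> 0 < d ->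
  C * d ^+ 2 * En u < \int[mu]_x u x ^+ 4 ->
  exists (x : E) (r : R), 0 < r /\ d < \int[mu]_h (\1_cube h * `|resc r x u h|).
Proof.
have [C C0 RS] := refined_sobolev R; exists C => // u g d Hu d0.
apply: contraPP => H; apply/negP; rewrite -leNgt.
have [Lu _ _] := Hu.
apply: (RS _ _ _ Hu) => //; apply: morrey_resc => // x r r0.
by rewrite leNgt; apply/negP => h; apply: H; exists x, r.
Qed.

End sobolev.

(** * Weak limits and local compactness *)

Section monotone.
Context d (T : measurableType d) (R : realType) (mu : {measure set T -> \bar R}).

Lemma intg_of_cuts (S : nat -> set T) (f : T -> R) (B : R) :
  measurable_fun setT f -> (forall x, 0 <= f x) -> (forall n, measurable (S n)) ->
  (forall m n, (m <= n)%N -> S m `<=` S n) -> (forall x, \forall n \near \oo, S n x) ->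
  (forall n, intg mu (fun x => f x * \1_(S n) x)) ->
  (forall n, \int[mu]_x (f x * \1_(S n) x) <= B) -> intg mu f.
Proof.
move=> mf f0 mS ndS Sx If fB; apply: intg_ge0P => //.
apply: (@le_lt_trans _ _ B%:E); last exact: ltry.
have H : (\int[mu]_x (f x * \1_(S n) x)%R%:E)%E @[n --> \oo] --> (\int[mu]_x (f x)%:E)%E.
  have -> : (fun x => (f x)%:E) = (fun x => limn (fun n => (f x * \1_(S n) x)%:E)).
    apply/funext => x; apply/esym/cvg_lim => //; apply: cvg_near_cst.
    by apply: filterS (Sx x) => n xS; rewrite indicE mem_set// mulr1.
  apply: cvg_monotone_convergence => //.
  - by move=> n; apply/measurable_EFinP; exact: intg_meas (If n).
  - by move=> n x _; rewrite lee_fin mulr_ge0// indicE.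
  - move=> x _ m n mn; rewrite lee_fin ler_wpM2l// !indicE ler_nat.
    have [xm|//] := boolP (x \in S m); rewrite (_ : (x \in S n) = true)//.
    by apply/mem_set/(ndS _ _ mn)/set_mem.
apply: cvge_to_le H _; apply: nearW => n.
by rewrite -(intgK (If n)) lee_fin.
Qed.

End monotone.

Section weak.
Variable R : realType.
Local Notation E := (R4 R).
Local Notation E4 := (E4 R).
Local Notation mu := (lam4 R).
Implicit Types (u v w f phi : E -> R) (g k : 'I_4 -> E -> R).

(** Limits both the position and the size of v, so the powers of v needed as weights become bounded
    with bounded support. *)
Definition trunc v (n : nat) : set E4 :=
  box4 `[- n%:R, n%:R] `&` [set x | `|v x| <= n%:R].

Lemma measurable_trunc v n : meas4 v -> measurable (trunc v n).
Proof.
move=> mv; apply: measurableI; first exact: measurable_box4.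
have -> : [set x | `|v x| <= n%:R] = (fun x => `|v x|) @^-1` `]-oo, n%:R]%classic.
  by apply/seteqP; split=> x /=; rewrite in_itv.
by rewrite -[_ @^-1` _]setTI; apply: (measurableT_comp _ mv).
Qed.

Lemma trunc_mono v m n : (m <= n)%N -> trunc v m `<=` trunc v n.
Proof.
move=> mn x [/box4_norm xm vm]; have mn' : m%:R <= n%:R :> R by rewrite ler_nat.
by split; [apply/box4_norm|]; exact: le_trans mn'.
Qed.

Lemma trunc_near v x : \forall n \near \oo, trunc v n x.
Proof.
have h1 := nbhs_infty_ger (`|x : E|); have h2 := nbhs_infty_ger (`|v x|).
by near=> n; split; [apply/box4_norm|]; near: n.
Unshelve. all: by end_near. Qed.

Lemma bdd_supp_trunc v w n : meas4 v -> meas4 w -> (forall x, trunc v n x -> `|w x| <= n%:R ^+ 3) ->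
  bdd_supp (fun x => w x * \1_(trunc v n) x).
Proof.
move=> mv mw wn; have mt := measurable_trunc n mv; split.
- by apply: measurable_funM => //; exact: measurable_indic.
- exists (n%:R ^+ 3) => [|x]; first exact: exprn_ge0.
  rewrite indicE; have [/set_mem xt|_] := boolP (x \in _).
    by rewrite mulr1 wn.
  by rewrite mulr0 normr0 exprn_ge0.
- exists n => x; rewrite indicE; have [/set_mem[]//|_] := boolP (x \in _).
  by rewrite mulr0 eqxx.
Qed.

Lemma bdd_suppM f w : bdd_supp f -> meas4 w ->
  (forall n : nat, exists2 C : R, 0 <= C & forall x, box4 `[- n%:R, n%:R] x -> `|w x| <= C) ->
  bdd_supp (fun x => f x * w x).
Proof.
move=> [mf [C C0 fC] [n fn]] mw /(_ n)[D D0 wD]; split; first exact: measurable_funM.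
- exists (C * D) => [|x]; first exact: mulr_ge0.
  rewrite normrM; have [->|/fn xn] := eqVneq (f x) 0.
    by rewrite normr0 mul0r mulr_ge0.
  by apply: ler_pM => //; exact: wD.
- by exists n => x fw; apply: fn; apply: contraNneq fw => ->; rewrite mul0r.
Qed.

(** An integrable weight with values in ]0, 1] and bounded below on each box, so that dividing by it
    preserves [bdd_supp]. *)
Definition gauss4 (x : E) : R :=
  gauss_fun x.1.1.1 * gauss_fun x.1.1.2 * gauss_fun x.1.2 * gauss_fun x.2.

Lemma gauss4_gt0 x : 0 < gauss4 x.
Proof. by rewrite !mulr_gt0// expR_gt0. Qed.

Lemma gauss4_intg : intg mu gauss4.
Proof.
have I : intg (lam1 R) gauss_fun by exact: integrableT_gauss.
exact: (prod_intg (prod_intg (prod_intg I I) I) I).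
Qed.

Lemma gauss4_le1 x : gauss4 x <= 1.
Proof. by rewrite /gauss4 !mulr_ile1 ?gauss_fun_le1 ?mulr_ge0 ?gauss_fun_ge0. Qed.

Lemma gauss4_lb (n : nat) x : box4 `[- n%:R, n%:R] x ->
  gauss_fun (n%:R : R) ^+ 4 <= gauss4 x.
Proof.
move=> /box4P; rewrite !in_itv /= -!ler_norml => -[h1 h2 h3 h4].
have H (t : R) : `|t| <= n%:R -> gauss_fun (n%:R : R) <= gauss_fun t.
  move=> tn; rewrite /gauss_fun ler_expR lerN2 -[t ^+ 2]real_normK ?num_real//.
  by rewrite lerXn2r ?nnegrE.
rewrite /gauss4 !exprS expr0 mulr1 -!mulrA.
by do !(apply: ler_pM; rewrite ?mulr_ge0 ?gauss_fun_ge0 ?H//).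
Qed.

(* The functions [u n * gauss4] are bounded in L^2; dividing their weak limit by
   [gauss4] gives [v], and testing with truncations of [v ^+ 3] bounds [v] in L^4. *)
Lemma weak_L4 (U : set_system nat) (u : nat -> E -> R) (B : R) : UltraFilter U ->
  (forall n, L4 (u n)) -> (forall n, \int[mu]_x (u n x) ^+ 4 <= B) ->
  exists2 v, L4 v & forall f, bdd_supp f ->
    (fun n => \int[mu]_x (u n x * f x)) @ U --> \int[mu]_x (v x * f x).
Proof.
move=> UU Lu uB; have mg := intg_meas gauss4_intg.
have Lug n : L2 mu (fun x => u n x * gauss4 x) /\
    \int[mu]_x (u n x * gauss4 x) ^+ 2 <= B + \int[mu]_x gauss4 x.
  have [mu_ Iu] := Lu n.
  have ms : meas4 (fun x => u n x * gauss4 x) by exact: measurable_funM.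
  have m2 : meas4 (fun x => (u n x * gauss4 x) ^+ 2) by exact: measurable_funX.
  have b x : (u n x * gauss4 x) ^+ 2 <= u n x ^+ 4 + gauss4 x.
    have := gauss4_le1 x; have := gauss4_gt0 x; set a := gauss4 x; set t := u n x => a0 a1.
    have h : a ^+ 2 <= a by rewrite expr2 ler_piMl// ltW.
    have h' : 0 <= a ^+ 2 by exact: sqr_ge0.
    have := sqr_ge0 (t ^+ 2 - a ^+ 2); have := sqr_ge0 (t ^+ 2).
    rewrite exprMn (_ : t ^+ 4 = (t ^+ 2) ^+ 2) -?exprM//.
    nra.
  have b' x : `|(u n x * gauss4 x) ^+ 2| <= u n x ^+ 4 + gauss4 x.
    by rewrite ger0_norm ?sqr_ge0.
  have I2 := intg_le m2 b' (intgD Iu gauss4_intg).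
  split=> //; apply: (@le_trans _ _ (\int[mu]_x (u n x ^+ 4 + gauss4 x))).
    by apply: int_le => //; apply: intgD => //; exact: gauss4_intg.
  rewrite intD//; last exact: gauss4_intg.
  by rewrite lerD2r.
have [V [LV HV]] := weak_limit UU (fun n => (Lug n).1) (fun n => (Lug n).2).
pose v x := V x / gauss4 x.
have gn x : gauss4 x != 0 by rewrite gt_eqF// gauss4_gt0.
have mV : meas4 (fun x => (gauss4 x)^-1).
  have -> : (fun x => (gauss4 x)^-1) = (fun x => expR (- ln (gauss4 x))).
    by apply/funext => x; rewrite expRN lnK// posrE gauss4_gt0.
  apply: measurableT_comp => //; apply: measurableT_comp => //.
  by apply: measurableT_comp => //; exact: measurable_ln.
have mv : meas4 v by apply: measurable_funM => //; exact: L2_meas LV.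
have bfg f : bdd_supp f -> bdd_supp (fun x => f x * (gauss4 x)^-1).
  move=> bf; apply: bdd_suppM => // n; exists (gauss_fun (n%:R : R) ^- 4).
    by rewrite invr_ge0 exprn_ge0// gauss_fun_ge0.
  move=> x /gauss4_lb h; rewrite normfV gtr0_norm ?gauss4_gt0//.
  by rewrite lef_pV2// posrE ?exprn_gt0 ?expR_gt0 ?gauss4_gt0.
have Hv f : bdd_supp f -> intg mu (fun x => v x * f x) /\
    (fun n => \int[mu]_x (u n x * f x)) @ U --> \int[mu]_x (v x * f x).
  move=> /bfg/bdd_supp_L2 Lf.
  have eV : (fun x => v x * f x) = (fun x => V x * (f x * (gauss4 x)^-1)).
    by apply/funext => x; rewrite /v; field.
  split; first by rewrite eV; exact: L2_mul.
  have := HV _ Lf; rewrite -eV.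
  rewrite (_ : (fun n => _) = (fun n => \int[mu]_x (u n x * f x)))//.
  by apply/funext => n; apply: eq_Rintegral => x _; field.
exists v; last by move=> f /Hv[].
split=> //.
have b3 n : bdd_supp (fun x => v x ^+ 3 * \1_(trunc v n) x).
  apply: bdd_supp_trunc => //; first exact: measurable_funX.
  by move=> x [_ vn]; rewrite normrX lerXn2r ?nnegrE.
have e4 n : (fun x => v x * (v x ^+ 3 * \1_(trunc v n) x)) = (fun x => v x ^+ 4 * \1_(trunc v n) x).
  by apply/funext => x; ring.
have I4 n : intg mu (fun x => v x ^+ 4 * \1_(trunc v n) x).
  by have [+ _] := Hv _ (b3 n); rewrite e4.
apply: (@intg_of_cuts _ _ _ mu (trunc v) _ B) => //.
- exact: measurable_funX.
- by move=> x; rewrite exprn_even_ge0.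
- by move=> n; exact: measurable_trunc.
- exact: trunc_mono.
- exact: trunc_near.
move=> n; have [_] := Hv _ (b3 n); rewrite e4; set A := \int[mu]_x _ => cA.
(* Young's inequality a b^3 <= a^4 / 4 + 3 b^4 / 4, with a = u m x and b = v x. The truncation makes
   A finite, so the last term can be absorbed. *)
suff : A <= 4^-1 * B + 3 / 4 * A by lra.
apply: (cvgr_to_le cA); apply: nearW => m; have [_ Im] := Lu m.
apply: (@le_trans _ _ (\int[mu]_x (4^-1 * u m x ^+ 4 + 3 / 4 * (v x ^+ 4 * \1_(trunc v n) x)))).
  apply: int_le.
  - by apply: L4_bdd_supp.
  - by apply: intgD; exact: intgZ.
  move=> x; rewrite indicE; case: (_ \in _); rewrite ?mulr1 ?mulr0 ?addr0; last first.
    by rewrite mulr_ge0// exprn_even_ge0.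
  set a := u m x; set b := v x.
  have := sqr_ge0 (a - b); have := sqr_ge0 (a ^+ 2 - b ^+ 2); nra.
rewrite intD; [|exact: intgZ..]; rewrite !intZ// -/A lerD2r.
by rewrite ler_wpM2l.
Qed.

End weak.

(** * Weak limits in the energy space and local L^2 convergence *)

Section rellich.
Variable R : realType.
Local Notation E := (R4 R).
Local Notation E4 := (E4 R).
Local Notation mu := (lam4 R).
Local Notation cube := (@cube R).
Local Notation bx N := (box4 `[- (N%:R : R), N%:R]).
Implicit Types (u v w f phi : E -> R) (g k : 'I_4 -> E -> R).

(** Functions and gradients have weak limits separately, the former because [sobolev] bounds them in
    L^4. Both sides of the integration by parts pass to the limit against a fixed test function, so
    the limits are related as function and gradient. *)
Lemma weak_H1 (U : set_system nat) (u : nat -> E -> R) (g : nat -> 'I_4 -> E -> R) (C : R) :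
  UltraFilter U -> (forall n, H1 (u n) (g n)) -> (forall n, En (u n) <= C) ->
  exists v k, [/\ H1 v k,
    forall f, bdd_supp f -> (fun n => \int[mu]_x (u n x * f x)) @ U --> \int[mu]_x (v x * f x) &
    forall i h, L2 mu h ->
      (fun n => \int[mu]_x (g n i x * h x)) @ U --> \int[mu]_x (k i x * h x)].
Proof.
move=> UU Hu uC.
have Lu n : L4 (u n) by case: (Hu n).
have [c c0 sob] := sobolev R.
have uB n : \int[mu]_x (u n x) ^+ 4 <= (c * C) ^+ 2.
  apply: (le_trans (sob _ _ (Hu n))).
  have C0 := le_trans (En_ge0 _) (uC n).
  by rewrite lerXn2r ?nnegrE ?mulr_ge0 ?En_ge0 ?(ltW c0)// ler_wpM2l// ltW.
have [v Lv Hv] := weak_L4 UU Lu uB.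
have /choice[k Hk] i : exists ki, L2 mu ki /\ forall h, L2 mu h ->
    (fun n => \int[mu]_x (g n i x * h x)) @ U --> \int[mu]_x (ki x * h x).
  apply: (@weak_limit _ _ _ mu U (fun n => g n i) C) => // n.
    by case: (Hu n).
  apply: le_trans (uC n); rewrite (EnE (Hu n)) (bigD1 i)//= lerDl.
  by apply: sumr_ge0 => j _; apply: int_ge0 => x; exact: sqr_ge0.
exists v, k; split=> //; last by move=> i; exact: (Hk i).2.
split=> // [i|i phi tp]; first exact: (Hk i).1.
have h1 := Hv _ (@testD_bdd_supp R phi (e4 R i) tp).
have h2 := (Hk i).2 _ (test_L2 tp).
have e : (fun n => \int[mu]_x (u n x * 'D_(e4 R i) phi x)) =
    (fun n => - \int[mu]_x (g n i x * phi x)).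
  by apply/funext => n; have [_ _ ->] := Hu n.
rewrite e in h1.
have h3 : (fun n => - \int[mu]_x (g n i x * phi x)) @ U --> - \int[mu]_x (k i x * phi x).
  by apply: cvgN; exact: h2.
exact: (cvg_unique _ h1 h3).
Qed.

Lemma L4_cube_L2 u : L4 u -> L2 mu (fun h => \1_cube h * u h).
Proof.
move=> [mu_ Iu]; have mi := intg_meas (intg_cube R).
have m1 : meas4 (fun h : E => \1_cube h * u h) by exact: measurable_funM.
have m2 : meas4 (fun h : E => (\1_cube h * u h) ^+ 2) by exact: measurable_funX.
split=> //.
have b (h : E) : `|(\1_cube h * u h) ^+ 2| <= \1_cube h + u h ^+ 4.
  rewrite ger0_norm ?sqr_ge0// indicE; case: (_ \in _); rewrite ?mul1r ?mul0r.
    have := sqr_ge0 (u h ^+ 2 - 1); have := sqr_ge0 (u h ^+ 2).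
    have -> : true%:R = 1 :> R by []; have := sqr_ge0 (u h); nra.
  by rewrite expr0n add0r exprn_even_ge0.
exact: (intg_le m2 b (intgD (intg_cube R) Iu)).
Qed.

Lemma L4_sqr_box u (N : nat) : L4 u -> intg mu (fun x => u x ^+ 2 * \1_(bx N) x).
Proof.
move=> [mu_ Iu]; have m2 : meas4 (fun x => u x ^+ 2) by exact: measurable_funX.
apply: (bdd_supp_intg m2 Iu) => [x|]; last exact: bdd_supp_indic.
rewrite ger0_norm ?sqr_ge0//; have := sqr_ge0 (u x ^+ 2 - 1).
have := sqr_ge0 (u x); have := sqr_ge0 (u x ^+ 2); nra.
Qed.

Lemma L2_cube : L2 mu (\1_cube : E -> R).
Proof. exact: bdd_supp_L2 (bdd_supp_cube R). Qed.

Lemma cube_sqr (h : E) : \1_cube h ^+ 2 = \1_cube h :> R.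
Proof. by rewrite indicE; case: (_ \in _); rewrite ?expr1n ?expr0n. Qed.

Lemma cube_cauchy_schwarz q : L2 mu q ->
  (\int[mu]_h (\1_cube h * q h)) ^+ 2 <= \int[mu]_h q h ^+ 2.
Proof.
move=> Lq; apply: (le_trans (cauchy_schwarz L2_cube Lq)).
by under eq_Rintegral do rewrite cube_sqr; rewrite int_cube mul1r.
Qed.

Definition avg (r : R) u (x : E) : R := \int[mu]_h (\1_cube h * u (r *: (h : E) + x)).

Lemma L4_scale u (r : R) (x : E) : 0 < r -> L4 u -> L4 (fun h => u (r *: h + x)).
Proof.
move=> r0 [mu_ Iu]; have [mS _ _] := scaling_map_lam4 x r0; split.
  exact: measurableT_comp mu_ mS.
by have [] := integral_scaling (scaling_map_lam4 x r0) Iu.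
Qed.

Lemma intg_avg u r x : 0 < r -> L4 u -> intg mu (fun h => \1_cube h * u (r *: (h : E) + x)).
Proof.
move=> r0 Lu; have := L4_bdd_supp (L4_scale x r0 Lu) (bdd_supp_cube R).
by apply: intg_ext => h; rewrite mulrC.
Qed.

Lemma avg_cvg0 (U : set_system nat) (u : nat -> E -> R) (r : R) (x : E) : Filter U ->
  0 < r -> (forall n, L4 (u n)) ->
  (forall f, bdd_supp f -> (fun n => \int[mu]_x (u n x * f x)) @ U --> (0 : R)) ->
  (fun n => avg r (u n) x) @ U --> (0 : R).
Proof.
move=> FU r0 Lu Hu.
pose f (y : E) : R := \1_cube (r^-1 *: y + - (r^-1 *: x)).
have rn : r != 0 by rewrite gt_eqF.
have bf : bdd_supp f.
  split.
  - have r0' : 0 < r^-1 by rewrite invr_gt0.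
    have [mS _ _] := scaling_map_lam4 (- (r^-1 *: x)) r0'.
    exact: measurableT_comp (intg_meas (intg_cube R)) mS.
  - by exists 1 => // y; rewrite /f indicE; case: (_ \in _); rewrite ?normr1 ?normr0.
  - exists (Num.bound (r + `|x|)) => y; rewrite /f indicE.
    have [/set_mem/cube_norm h _|] := boolP (_ \in _); last by rewrite eqxx.
    apply/box4_norm; apply: ltW; apply: le_lt_trans (archi_boundP _); last first.
      by rewrite addr_ge0// ltW.
    have -> : y = r *: (r^-1 *: y - r^-1 *: x) + x.
      by rewrite scalerBr !scalerA divff// !scale1r subrK.
    apply: (le_trans (ler_normD _ _)); rewrite lerD2r normrZ (gtr0_norm r0).
    by rewrite ler_piMr// ltW.
have e n : avg r (u n) x = r ^- 4 * \int[mu]_y (u n y * f y).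
  have [I1 ->] := integral_scaling (scaling_map_lam4 x r0) (L4_bdd_supp (Lu n) bf).
  rewrite mulKf ?expf_neq0//; apply: eq_Rintegral => h _.
  by rewrite /f scalerDr scalerA mulVf// scale1r addrK mulrC.
rewrite (_ : (fun n => _) = (fun n => r ^- 4 * \int[mu]_y (u n y * f y))); last exact/funext.
by rewrite -[X in _ --> X](mulr0 (r ^- 4)); apply: cvgM; [exact: cvg_cst|exact: Hu].
Qed.

(** The difference is an average of u(. + (x - y)) - u, controlled by Cauchy-Schwarz and
    [diff_bound]; r^-4 is the Jacobian. The Lipschitz constant depends on r and C only, hence is
    uniform along a bounded sequence. *)
Lemma avg_lip u g (r C : R) (x y : E) : 0 < r -> H1 u g -> En u <= C ->
  (avg r u x - avg r u y) ^+ 2 <= r ^- 4 * (4 * `|x - y| ^+ 2 * C).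
Proof.
move=> r0 Hu uC; have [Lu _ _] := Hu.
have [LQ BQ] := diff_bound (x - y) Hu.
rewrite /avg -intB; [|exact: intg_avg..].
have [mS _ _] := scaling_map_lam4 y r0.
have [IQ EQ] := integral_scaling (scaling_map_lam4 y r0) (L2_intg LQ).
have Lq : L2 mu (fun h : E => u (r *: h + y + (x - y)) - u (r *: h + y)).
  by split=> //; exact: measurableT_comp (L2_meas LQ) mS.
have -> : \int[mu]_h (\1_cube h * u (r *: (h : E) + x) - \1_cube h * u (r *: (h : E) + y)) =
    \int[mu]_h (\1_cube h * (u (r *: (h : E) + y + (x - y)) - u (r *: (h : E) + y))).
  apply: eq_Rintegral => h _; rewrite -mulrBr; congr (_ * (u _ - _)).
  by rewrite -addrA; congr (_ + _); rewrite addrC subrK.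
apply: (le_trans (cube_cauchy_schwarz Lq)).
have r4 : 0 < r ^+ 4 by rewrite exprn_gt0.
rewrite mulrC ler_pdivlMr// mulrC -EQ; apply: (le_trans BQ).
by rewrite ler_wpM2l// mulr_ge0// sqr_ge0.
Qed.

(** A Poincare-type splitting u^2 <= 2 (u - avg)^2 + 2 avg^2. The first part is a mean over h of
    squared differences, handled by Tonelli and [diff_bound] with |h| <= 1. *)
Lemma local_L2_bound u g (r e : R) (N : nat) : 0 < r -> H1 u g ->
  (forall x, bx N x -> `|avg r u x| <= e) ->
  \int[mu]_x (u x ^+ 2 * \1_(bx N) x) <=
  8 * r ^+ 2 * En u + 2 * e ^+ 2 * \int[mu]_x (\1_(bx N) x).
Proof.
move=> r0 Hu He; have [Lu _ _] := Hu; have [mu_ _] := Lu.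
have mB : measurable (bx N : set E4) by exact: measurable_box4.
have IB : intg mu (\1_(bx N) : E -> R).
  by apply: intg_indic => //; exact: lam4_box_lty.
pose F (z : E4 * E4) : \bar R :=
  (\1_cube z.2 * (u ((z.1 : E) + r *: (z.2 : E)) - u z.1) ^+ 2)%:E.
have mF : measurable_fun setT F.
  apply/measurable_EFinP/measurable_funM.
    by apply: measurableT_comp => //; apply: measurable_indic; exact: measurable_cube.
  apply/measurable_funX/measurable_funB; first exact: (meas_joint r mu_).
  exact: measurableT_comp mu_ _.
have F0 z : (0 <= F z)%E by rewrite lee_fin mulr_ge0 ?sqr_ge0// indic_ge0.
have pt (x : E) : ((u x ^+ 2 * \1_(bx N) x)%:E <=
    2%:E * \int[mu]_h F (x, h) + (2 * e ^+ 2 * \1_(bx N) x)%:E)%E.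
  have [xB|xB] := pselect (bx N x); last first.
    rewrite indicE memNset// !mulr0 adde0 mule_ge0//.
    by apply: integral_ge0 => h _.
  rewrite indicE mem_set// !mulr1.
  have Lp := L2B (L2Z (u x) L2_cube) (L4_cube_L2 (L4_scale x r0 Lu)).
  have Fe h : F (x, h) = ((u x * \1_cube h - \1_cube h * u (r *: (h : E) + x)) ^+ 2)%:E.
    rewrite /F /= [x + _]addrC; congr (_%:E).
    by rewrite -[X in X * _]cube_sqr; ring.
  under eq_integral do rewrite Fe.
  rewrite -intgK; last exact: L2_intg.
  rewrite -EFinM -EFinD lee_fin.
  have := cube_cauchy_schwarz Lp; set J := \int[mu]_h (_ ^+ 2).
  have -> : \int[mu]_h (\1_cube h * (u x * \1_cube h - \1_cube h * u (r *: (h : E) + x))) =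
      u x - avg r u x.
    rewrite /avg -[X in _ = X - _]mulr1 -(int_cube R) -intZ; last exact: intg_cube.
    rewrite -intB; [|apply: intgZ; exact: intg_cube|exact: intg_avg].
    apply: eq_Rintegral => h _; rewrite mulrBr mulrCA -expr2 mulrA -expr2 !cube_sqr.
    by rewrite mulrC.
  have := He x xB; rewrite ler_norml => /andP[]; set a := avg r u x; set b := u x => a1 a2.
  have h1 : a ^+ 2 <= e ^+ 2 by nra.
  have := sqr_ge0 (b - a - a); nra.
have Iu := L4_sqr_box N Lu.
have c0 : 0 <= 2 * e ^+ 2 by rewrite mulr_ge0// sqr_ge0.
have mFx := @measurable_fun_fubini_tonelli_F _ _ E4 E4 R mu F mF F0.
rewrite -lee_fin intgK// EFinD.
apply: (@le_trans _ _ (\int[mu]_x (2%:E * \int[mu]_h F (x, h) + (2 * e ^+ 2 * \1_(bx N) x)%:E))%E).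
  apply: ge0_le_integral => //.
  - by move=> x _; rewrite lee_fin mulr_ge0 ?sqr_ge0// indic_ge0.
  - by apply/measurable_EFinP; exact: intg_meas Iu.
  - apply: emeasurable_funD; first exact: measurable_funeM.
    by apply/measurable_EFinP; apply: measurable_funM => //; exact: intg_meas IB.
rewrite ge0_integralD//; last 4 first.
- by move=> x _; rewrite mule_ge0// integral_ge0.
- exact: measurable_funeM.
- by move=> x _; rewrite lee_fin mulr_ge0// indic_ge0.
- by apply/measurable_EFinP; apply: measurable_funM => //; exact: intg_meas IB.
rewrite -[X in (_ + X <= _)%E]intgK; last exact: intgZ.
rewrite intZ//; apply: leeD => //.
rewrite ge0_integralZl//; last by move=> x _; exact: integral_ge0.
have -> : (8 * r ^+ 2 * En u = 2 * (4 * r ^+ 2 * En u))%R by ring.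
rewrite EFinM; apply: lee_wpmul2l => //.
rewrite -tonelli1// tonelli2//.
apply: (@le_trans _ _ (\int[mu]_h ((4 * r ^+ 2 * En u)%:E * (\1_cube h)%:E))%E).
  apply: ge0_le_integral => //.
  - by move=> h _; apply: integral_ge0.
  - exact: (@measurable_fun_fubini_tonelli_G _ _ E4 E4 R mu F).
  - by apply: measurable_funeM; apply/measurable_EFinP; exact: intg_meas (intg_cube R).
  move=> h _; rewrite /F /=.
  have [Lq Bq] := diff_bound (r *: (h : E)) Hu.
  rewrite -intgK; last by apply: intgZ; exact: L2_intg.
  rewrite intZ; last exact: L2_intg.
  rewrite -EFinM lee_fin mulrC indicE; have [/set_mem/cube_norm hc|_] := boolP (h \in _); last first.
    by rewrite !mulr0.
  rewrite !mulr1; apply: (le_trans Bq); rewrite ler_wpM2r ?En_ge0// ler_wpM2l//.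
  by rewrite normrZ exprMn real_normK ?num_real// ler_piMr ?sqr_ge0// exprn_ile1.
rewrite ge0_integralZl//.
- by rewrite -intgK ?int_cube ?mule1//; exact: intg_cube.
- by apply/measurable_EFinP; exact: intg_meas (intg_cube R).
- by rewrite lee_fin mulr_ge0 ?En_ge0// mulr_ge0// sqr_ge0.
Qed.

(* Dominated convergence fails along an ultrafilter; instead the averages are
   equi-Lipschitz, so they tend to 0 uniformly on the compact box. *)
Lemma rellich (U : set_system nat) (u : nat -> E -> R) (g : nat -> 'I_4 -> E -> R) (C : R) N :
  ProperFilter U -> (forall n, H1 (u n) (g n)) -> (forall n, En (u n) <= C) ->
  (forall f, bdd_supp f -> (fun n => \int[mu]_x (u n x * f x)) @ U --> (0 : R)) ->
  (fun n => \int[mu]_x (u n x ^+ 2 * \1_(bx N) x)) @ U --> (0 : R).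
Proof.
move=> FU Hu uC wu; apply/cvgr0Pnorm_le => e e0.
have Lu n : L4 (u n) by case: (Hu n).
have C0 : 0 <= C := le_trans (En_ge0 _) (uC 0%N).
set m := \int[mu]_x (\1_(bx N) x : R).
have m0 : 0 <= m by apply: int_ge0 => x; exact: indic_ge0.
(* The scale r makes 8 r^2 C at most e / 2, and the threshold t below makes 2 t^2 m at most e / 2;
   the added 1 avoids division by 0. *)
pose r := Num.sqrt (e / (16 * (C + 1))).
have r2 : r ^+ 2 = e / (16 * (C + 1)).
  by rewrite sqr_sqrtr// divr_ge0 ?(ltW e0)// mulr_ge0// addr_ge0.
have r0 : 0 < r by rewrite sqrtr_gt0 divr_gt0// mulr_gt0// ltr_wpDl.
pose t := Num.sqrt (e / (4 * (m + 1))).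
have t2 : t ^+ 2 = e / (4 * (m + 1)).
  by rewrite sqr_sqrtr// divr_ge0 ?(ltW e0)// mulr_ge0// addr_ge0.
have t0 : 0 < t by rewrite sqrtr_gt0 divr_gt0// mulr_gt0// ltr_wpDl.
have : \forall n \near U, bx N `<=` (fun x : E => `|avg r (u n) x| <= t).
  have cB : compact (bx N : set E) by exact: compact_box4.
  move: cB => /compact_near_coveringP; apply => x _.
  (* The square root is the common Lipschitz constant of the averages, so within distance s of x
     they vary by at most t / 2. *)
  pose s := t / (2 * (1 + Num.sqrt (r ^- 4 * (4 * C)))).
  set q := Num.sqrt _ in s.
  have q0 : 0 <= q by exact: sqrtr_ge0.
  have s0 : 0 < s by rewrite divr_gt0// mulr_gt0// ltr_wpDr.
  have h1 : \forall n \near U, `|avg r (u n) x| < t / 2.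
    have h : (fun n => avg r (u n) x) @ U --> (0 : R) by exact: avg_cvg0.
    by move/cvgr0Pnorm_lt : h; apply; exact: divr_gt0.
  have h2 : \forall y \near x, `|x - y| < s 
    by apply: (@cvgr_dist_lt R E E (nbhs (x : E)) _ id x) => //; exact: cvg_id.
  exists ([set y : E | `|(x : E) - y| < s], [set n | `|avg r (u n) x| < t / 2]) => //=.
  move=> [y n] /= [ys nx].
  have := @avg_lip (u n) (g n) r C x y r0 (Hu n) (uC n).
  have -> : r ^- 4 * (4 * `|x - y| ^+ 2 * C) = (q * `|x - y|) ^+ 2.
    rewrite exprMn sqr_sqrtr; first by ring.
    by rewrite mulr_ge0 ?invr_ge0 ?exprn_even_ge0// mulr_ge0.
  rewrite -[(avg r _ x - _) ^+ 2]real_normK ?num_real// ler_pXn2r ?nnegrE ?mulr_ge0// => h3.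
  have h4 : q * `|x - y| <= t / 2.
    apply: (@le_trans _ _ (q * s)); first by rewrite ler_wpM2l// ltW.
    rewrite /s mulrA ler_pdivrMr ?mulr_gt0 ?ltr_wpDr//.
    rewrite (_ : t / 2 * (2 * (1 + q)) = t + q * t); last by field.
    by rewrite lerDr ltW.
  have -> : avg r (u n) y = avg r (u n) x - (avg r (u n) x - avg r (u n) y) by ring.
  apply: (le_trans (ler_normB _ _)).
  have := le_trans h3 h4; have := ltW nx; lra.
apply: filterS => n hn.
rewrite ger0_norm; last first.
  by apply: int_ge0 => x; rewrite mulr_ge0 ?sqr_ge0// indic_ge0.
apply: (le_trans (local_L2_bound r0 (Hu n) hn)); rewrite -/m.
apply: (@le_trans _ _ (8 * r ^+ 2 * C + 2 * t ^+ 2 * m)).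
  by rewrite lerD2r ler_wpM2l// mulr_ge0// sqr_ge0.
rewrite r2 t2.
have -> : e = e / 2 + e / 2 by field.
have p1 : 0 < C + 1 by rewrite ltr_wpDl.
have p2 : 0 < m + 1 by rewrite ltr_wpDl.
apply: lerD.
  rewrite (_ : _ * C = e / 2 * (C / (C + 1))); last by field; rewrite gt_eqF.
  by rewrite ler_piMr ?divr_ge0 ?(ltW e0)// ler_pdivrMr// mul1r lerDl.
rewrite (_ : _ * m = e / 2 * (m / (m + 1))); last by field; rewrite gt_eqF.
by rewrite ler_piMr ?divr_ge0 ?(ltW e0)// ler_pdivrMr// mul1r lerDl.
Qed.

End rellich.

(** * The functional N *)

Section density.
Variable R : realType.
Implicit Types a b c d : R.

Definition nd a b : R :=
  36^-1 * a ^+ 4 + 9 / 4 * b ^+ 4 + a ^+ 2 * b ^+ 2 + 9^-1 * (a ^+ 3 * b).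

(** The term a^3 b, of indefinite sign, is absorbed by the square (a (a + 4 b))^2 / 72, which
    consumes only a^4 / 72 and 2 a^2 b^2 / 9. *)
Lemma nd_ge a b : 72^-1 * (a ^+ 4 + b ^+ 4) <= nd a b.
Proof.
rewrite /nd; have := sqr_ge0 (a * (a + 4 * b)); have := sqr_ge0 (a * b).
have := sqr_ge0 (b ^+ 2); nra.
Qed.

Lemma nd_le a b : nd a b <= 3 * (a ^+ 4 + b ^+ 4).
Proof.
rewrite /nd; have := sqr_ge0 (a * (a - b)); have := sqr_ge0 (a * b).
have := sqr_ge0 (b ^+ 2); have := sqr_ge0 (a ^+ 2); have := sqr_ge0 (a ^+ 2 - b ^+ 2); nra.
Qed.

Lemma nd_ge0 a b : 0 <= nd a b.
Proof.
by apply: le_trans (nd_ge a b); rewrite mulr_ge0// addr_ge0// exprn_even_ge0.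
Qed.

Lemma ndM c a b : nd (c * a) (c * b) = c ^+ 4 * nd a b.
Proof. by rewrite /nd; ring. Qed.

Lemma mul_le_eps (eps s p q P Q : R) : 0 < eps -> s = (4 * eps)^-1 ->
  p ^+ 2 <= P -> q ^+ 2 <= Q -> - (eps * P + s * Q) <= p * q <= eps * P + s * Q.
Proof.
move=> e0 es pP qQ.
have s0 : 0 < s by rewrite es invr_gt0 mulr_gt0.
have e1 : eps * s = 4^-1 by rewrite es; field; rewrite gt_eqF.
have h1 := ler_wpM2l (ltW e0) pP; have h2 := ler_wpM2l (ltW s0) qQ.
have h3 : 0 <= eps * (p - 2 * s * q) ^+ 2 by rewrite mulr_ge0 ?sqr_ge0// ltW.
have h4 : 0 <= eps * (p + 2 * s * q) ^+ 2 by rewrite mulr_ge0 ?sqr_ge0// ltW.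
have k1 : eps * (p - 2 * s * q) ^+ 2 = eps * p ^+ 2 - 4 * (eps * s) * (p * q) + 4 * (eps * s) * (s * q ^+ 2).
  by ring.
have k2 : eps * (p + 2 * s * q) ^+ 2 = eps * p ^+ 2 + 4 * (eps * s) * (p * q) + 4 * (eps * s) * (s * q ^+ 2).
  by ring.
rewrite k1 e1 in h3; rewrite k2 e1 in h4.
apply/andP; split; lra.
Qed.

(** In the expansion each mixed term is a product of two quadratic monomials, at least one of them
    mixed. If the other is a pure square, the term is at most eps X^2 + s W or eps Y^2 + s W;
    otherwise it is at most W. The coefficients of the two kinds add up to 27 + 1/9 and 20 + 1/3,
    rounded to 28 and 21; 56 is 2 * 28, from X^2 <= 2 (a^4 + b^4). *)
Lemma nd_cross (eps s a b c d : R) : 0 < eps -> s = (4 * eps)^-1 ->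
  `|nd (a + c) (b + d) - nd a b - nd c d| <=
    56 * eps * (a ^+ 4 + b ^+ 4 + c ^+ 4 + d ^+ 4) +
    (28 * s + 21) * (a ^+ 2 * c ^+ 2 + a ^+ 2 * d ^+ 2 + b ^+ 2 * c ^+ 2 + b ^+ 2 * d ^+ 2).
Proof.
move=> e0 es.
pose X := a ^+ 2 + b ^+ 2; pose Y := c ^+ 2 + d ^+ 2.
have a2 := sqr_ge0 a; have b2 := sqr_ge0 b; have c2 := sqr_ge0 c; have d2 := sqr_ge0 d.
have X0 : 0 <= X by exact: addr_ge0.
have Y0 : 0 <= Y by exact: addr_ge0.
set W := a ^+ 2 * c ^+ 2 + _ + _ + _.
have WE : W = X * Y by rewrite /W /X /Y; ring.
have pa : (a ^+ 2) ^+ 2 <= X ^+ 2 by rewrite lerXn2r ?nnegrE// /X; lra.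
have pb : (b ^+ 2) ^+ 2 <= X ^+ 2 by rewrite lerXn2r ?nnegrE// /X; lra.
have pc : (c ^+ 2) ^+ 2 <= Y ^+ 2 by rewrite lerXn2r ?nnegrE// /Y; lra.
have pd : (d ^+ 2) ^+ 2 <= Y ^+ 2 by rewrite lerXn2r ?nnegrE// /Y; lra.
have ac0 := mulr_ge0 a2 c2; have ad0 := mulr_ge0 a2 d2.
have bc0 := mulr_ge0 b2 c2; have bd0 := mulr_ge0 b2 d2.
have qac : (a * c) ^+ 2 <= W by rewrite exprMn /W; lra.
have qad : (a * d) ^+ 2 <= W by rewrite exprMn /W; lra.
have qbc : (b * c) ^+ 2 <= W by rewrite exprMn /W; lra.
have qbd : (b * d) ^+ 2 <= W by rewrite exprMn /W; lra.
have XY : eps * X ^+ 2 + eps * Y ^+ 2 <= 2 * eps * (a ^+ 4 + b ^+ 4 + c ^+ 4 + d ^+ 4).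
  rewrite -mulrDr mulrAC [leRHS]mulrC; apply: ler_wpM2l; first exact: ltW.
  have := sqr_ge0 (a ^+ 2 - b ^+ 2); have := sqr_ge0 (c ^+ 2 - d ^+ 2).
  rewrite /X /Y; nra.
have W0 : 0 <= W by rewrite WE mulr_ge0.
have eX : 0 <= eps * X ^+ 2 by rewrite mulr_ge0 ?sqr_ge0// ltW.
have eY : 0 <= eps * Y ^+ 2 by rewrite mulr_ge0 ?sqr_ge0// ltW.
have sW : 0 <= s * W by rewrite mulr_ge0// es invr_ge0 mulr_ge0// ltW.
have T : 28 * (eps * X ^+ 2 + eps * Y ^+ 2) + 28 * (s * W) + 21 * W <=
    56 * eps * (a ^+ 4 + b ^+ 4 + c ^+ 4 + d ^+ 4) + (28 * s + 21) * W by lra.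
have H := @mul_le_eps eps s _ _ _ _ e0 es.
have /andP[A1 A2] := H _ _ _ _ pa qac; have /andP[B1 B2] := H _ _ _ _ pa qad.
have /andP[C1 C2] := H _ _ _ _ pa qbc; have /andP[D1 D2] := H _ _ _ _ pa qbd.
have /andP[E1 E2] := H _ _ _ _ pb qac; have /andP[F1 F2] := H _ _ _ _ pb qbd.
have /andP[G1 G2] := H _ _ _ _ pc qac; have /andP[I1 I2] := H _ _ _ _ pc qad.
have /andP[J1 J2] := H _ _ _ _ pc qbc; have /andP[K1 K2] := H _ _ _ _ pc qbd.
have /andP[L1 L2] := H _ _ _ _ pd qac; have /andP[M1 M2] := H _ _ _ _ pd qbd.
have H2 (p q : R) : p ^+ 2 <= W -> q ^+ 2 <= W -> - W <= p * q <= W.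
  move=> hp hq; apply/andP; split.
    have := sqr_ge0 (p + q); nra.
  have := sqr_ge0 (p - q); nra.
have /andP[N1 N2] := H2 _ _ qac qbd; have /andP[Q1 Q2] := H2 _ _ qac qad.
have /andP[P1 P2] := H2 _ _ qac qbc.
suff [h1 h2] : - (28 * (eps * X ^+ 2 + eps * Y ^+ 2) + 28 * (s * W) + 21 * W) <=
    nd (a + c) (b + d) - nd a b - nd c d /\ nd (a + c) (b + d) - nd a b - nd c d <=
    28 * (eps * X ^+ 2 + eps * Y ^+ 2) + 28 * (s * W) + 21 * W.
  rewrite ler_norml; apply/andP; split; last exact: le_trans h2 T.
  by apply: le_trans h1; rewrite lerN2.
have -> : nd (a + c) (b + d) - nd a b - nd c d =
  36^-1 * (4 * (a ^+ 2 * (a * c)) + 6 * (a * c) ^+ 2 + 4 * (c ^+ 2 * (a * c))) +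
  9 / 4 * (4 * (b ^+ 2 * (b * d)) + 6 * (b * d) ^+ 2 + 4 * (d ^+ 2 * (b * d))) +
  (2 * (a ^+ 2 * (b * d)) + (a * d) ^+ 2 + 2 * (b ^+ 2 * (a * c)) + 4 * ((a * c) * (b * d))
   + 2 * (d ^+ 2 * (a * c)) + (b * c) ^+ 2 + 2 * (c ^+ 2 * (b * d))) +
  9^-1 * (a ^+ 2 * (a * d) + 3 * (a ^+ 2 * (b * c)) + 3 * ((a * c) * (a * d)) + 3 * ((a * c) * (b * c))
   + 3 * (c ^+ 2 * (a * d)) + c ^+ 2 * (b * c)).
  by rewrite /nd; ring.
have := sqr_ge0 (a * c); have := sqr_ge0 (a * d); have := sqr_ge0 (b * c); have := sqr_ge0 (b * d).
clear WE H2 XY H T; move: A1 A2 B1 B2 C1 C2 D1 D2 E1 E2 F1 F2 G1 G2 I1 I2 J1 J2 K1 K2 L1 L2 M1 M2 N1 N2 Q1 Q2 P1 P2 W0 eX eY sW qac qad qbc qbd.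
move: (a ^+ 2 * (a * c)) (c ^+ 2 * (a * c)) (b ^+ 2 * (b * d)) (d ^+ 2 * (b * d)) (a ^+ 2 * (b * d))
  (b ^+ 2 * (a * c)) ((a * c) * (b * d)) (d ^+ 2 * (a * c)) (c ^+ 2 * (b * d)) (a ^+ 2 * (a * d))
  (a ^+ 2 * (b * c)) ((a * c) * (a * d)) ((a * c) * (b * c)) (c ^+ 2 * (a * d)) (c ^+ 2 * (b * c))
  ((a * c) ^+ 2) ((a * d) ^+ 2) ((b * c) ^+ 2) ((b * d) ^+ 2) (eps * X ^+ 2) (eps * Y ^+ 2) (s * W)
.
move: (W).
move=> *; split; lra.
Qed.

End density.

(** * Homogeneity and asymptotic splitting of N *)

Section functional.
Variable R : realType.
Local Notation E := (R4 R).
Local Notation E4 := (E4 R).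
Local Notation mu := (lam4 R).
Local Notation bx N := (box4 `[- (N%:R : R), N%:R]).
Implicit Types (u v w f phi : E -> R) (g k : 'I_4 -> E -> R).

Lemma expr4E (a : R) : a ^+ 4 = (a ^+ 2) ^+ 2. Proof. by rewrite -exprM. Qed.

Lemma L4_sqrM u v : L4 u -> L4 v -> intg mu (fun x => u x ^+ 2 * v x ^+ 2).
Proof.
move=> [mu_ Iu] [mv Iv].
have m : meas4 (fun x => u x ^+ 2 * v x ^+ 2).
  by apply: measurable_funM; exact: measurable_funX.
have b x : `|u x ^+ 2 * v x ^+ 2| <= u x ^+ 4 + v x ^+ 4.
  rewrite ger0_norm; last by apply: mulr_ge0; exact: sqr_ge0.
  have := sqr_ge0 (u x ^+ 2 - v x ^+ 2); have := sqr_ge0 (u x ^+ 2).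
  have := sqr_ge0 (v x ^+ 2); nra.
exact: (intg_le m b (intgD Iu Iv)).
Qed.

Lemma meas_nd u w : meas4 u -> meas4 w -> meas4 (fun x => nd (u x) (w x)).
Proof.
move=> m1 m2.
have X f n : meas4 f -> meas4 (fun x => f x ^+ n) by exact: measurable_funX.
have M f h : meas4 f -> meas4 h -> meas4 (fun x => f x * h x) by exact: measurable_funM.
have c (a : R) : @measurable_fun _ _ E4 _ setT (fun=> a) by exact: measurable_cst.
exact: measurable_funD (measurable_funD (measurable_funD (M _ _ (c _) (X _ _ m1))
  (M _ _ (c _) (X _ _ m2))) (M _ _ (X _ _ m1) (X _ _ m2)))
  (M _ _ (c _) (M _ _ (X _ _ m1) m2)).
Qed.

Lemma nd_intg u w : L4 u -> L4 w -> intg mu (fun x => nd (u x) (w x)).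
Proof.
move=> [mu_ Iu] [mw Iw]; have m := meas_nd mu_ mw.
have b x : `|nd (u x) (w x)| <= 3 * (u x ^+ 4 + w x ^+ 4).
  by rewrite ger0_norm ?nd_ge0// nd_le.
exact: (intg_le m b (intgZ _ (intgD Iu Iw))).
Qed.

Lemma NfunE u w : Nfun u w = \int[mu]_x nd (u x) (w x).
Proof. by []. Qed.

Lemma Nfun_ge0 u w : 0 <= Nfun u w.
Proof. by rewrite NfunE; apply: int_ge0 => x; exact: nd_ge0. Qed.

Lemma Nfun_le u w : L4 u -> L4 w ->
  Nfun u w <= 3 * (\int[mu]_x u x ^+ 4 + \int[mu]_x w x ^+ 4).
Proof.
move=> Lu Lw; have [_ Iu] := Lu; have [_ Iw] := Lw.
rewrite NfunE -intD// -intZ; last exact: intgD.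
apply: int_le; [exact: nd_intg|by apply: intgZ; exact: intgD|].
by move=> x; exact: nd_le.
Qed.

Lemma NfunZ (c : R) u w : L4 u -> L4 w ->
  Nfun (fun x => c * u x) (fun x => c * w x) = c ^+ 4 * Nfun u w.
Proof.
move=> Lu Lw; rewrite !NfunE -intZ; last exact: nd_intg.
by apply: eq_Rintegral => x _; rewrite ndM.
Qed.

Lemma Nfun_resc (r : R) (y : E) u w : 0 < r -> L4 u -> L4 w ->
  Nfun (resc r y u) (resc r y w) = Nfun u w.
Proof.
move=> r0 Lu Lw; have [I' e] := integral_scaling (scaling_map_lam4 y r0) (nd_intg Lu Lw).
rewrite !NfunE [RHS]e -intZ//; apply: eq_Rintegral => x _.
by rewrite -ndM.
Qed.

Lemma EnZ (c : R) u g : H1 u g -> En (fun x => c * u x) = c ^+ 2 * En u.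
Proof.
move=> Hu; rewrite (EnE (H1Z c Hu)) (EnE Hu) mulr_sumr; apply: eq_bigr => i _.
have [_ Lg _] := Hu; rewrite -intZ; last exact: L2_intg.
by apply: eq_Rintegral => x _; rewrite exprMn.
Qed.

(** Multiplying the pair by c = N^(-1/4) normalizes N to 1 and multiplies K by c^2 = N^(-1/2). The
    squared form avoids this root and also covers N = 0. *)
Lemma Ival_bound u w : Hdot1 u -> Hdot1 w ->
  0 <= Ival R -> Ival R ^+ 2 * Nfun u w <= (En u + En w) ^+ 2.
Proof.
move=> Hu Hw I0; have [N0|Nn] := eqVneq (Nfun u w) 0.
  by rewrite N0 mulr0 sqr_ge0.
have Np : 0 < Nfun u w by rewrite lt_def Nn Nfun_ge0.
pose s := Num.sqrt (Nfun u w).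
have s0 : 0 < s by rewrite sqrtr_gt0.
have s2 : s ^+ 2 = Nfun u w by rewrite sqr_sqrtr// ltW.
pose c := (Num.sqrt s)^-1.
have c2 : c ^+ 2 = s^-1 by rewrite exprVn sqr_sqrtr// ltW.
have G1 := H1_grad Hu; have G2 := H1_grad Hw.
have [Lu _ _] := G1; have [Lw _ _] := G2.
have Hcu : Hdot1 (fun x => c * u x) by apply/Hdot1P; eexists; exact: H1Z G1.
have Hcw : Hdot1 (fun x => c * w x) by apply/Hdot1P; eexists; exact: H1Z G2.
have Nc : Nfun (fun x => c * u x) (fun x => c * w x) = 1.
  rewrite NfunZ// expr4E c2 exprVn s2 mulVf//.
have Kc : Kfun (fun x => c * u x) (fun x => c * w x) = (En u + En w) / s.
  by rewrite KfunE// (EnZ _ G1) (EnZ _ G2) c2 -mulrDr mulrC.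
have : Ival R <= (En u + En w) / s.
  apply: ge_inf.
    exists 0 => _ [p [q [[Hp [Hq _]] [_ ->]]]].
    by rewrite KfunE// addr_ge0// En_ge0.
  exists (fun x => c * u x), (fun x => c * w x).
  by rewrite Nc Kc; split=> //; split=> //; split=> //; rewrite Nc.
rewrite ler_pdivlMr// => h; rewrite -s2 -exprMn lerXn2r ?nnegrE//.
- by rewrite mulr_ge0// ltW.
- by rewrite addr_ge0// En_ge0.
Qed.

Lemma sum_sqr_lower (c a b : R) : 0 < c -> 0 <= a -> 0 <= b ->
  1 <= 3 * ((c * a) ^+ 2 + (c * b) ^+ 2) -> (2 * c)^-1 <= a + b.
Proof.
move=> c0 a0 b0 h; rewrite -[leLHS]mul1r ler_pdivrMr ?mulr_gt0// leNgt.
apply/negP => ab; have := mulr_ge0 (ltW c0) a0; have := mulr_ge0 (ltW c0) b0.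
have {ab} : c * a + c * b < 1 / 2 by lra.
move: h; set p := c * a; set q := c * b; nra.
Qed.

(** Serves to show I > 0, without which I^2 N <= K^2 would say nothing. *)
Lemma K_lower : exists2 c : R, 0 < c & forall u w, Hdot1 u -> Hdot1 w ->
  Nfun u w = 1 -> c <= En u + En w.
Proof.
have [c c0 sob] := sobolev R; exists (2 * c)^-1; first by rewrite invr_gt0 mulr_gt0.
move=> u w /H1_grad G1 /H1_grad G2 N1; have [Lu _ _] := G1; have [Lw _ _] := G2.
apply: sum_sqr_lower => //; try exact: En_ge0.
rewrite -[leLHS]N1; apply: (le_trans (Nfun_le Lu Lw)); apply: ler_wpM2l => //.
by apply: lerD; [exact: sob G1|exact: sob G2].
Qed.

(** On [trunc v N] the factor v^2 is at most N^2 and local L^2 convergence applies. Elsewhere v^2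
    D^2 <= eta D^4 + v^4 / eta, where the first term is small by the choice of eta and the second is
    a tail of the integral of v^4, small for large N uniformly in n. *)
Lemma cross_cvg0 (U : set_system nat) v (D : nat -> E -> R) (B : R) : Filter U ->
  L4 v -> (forall n, L4 (D n)) -> (forall n, \int[mu]_x (D n x) ^+ 4 <= B) ->
  (forall N, (fun n => \int[mu]_x (D n x ^+ 2 * \1_(bx N) x)) @ U --> (0 : R)) ->
  (fun n => \int[mu]_x (v x ^+ 2 * D n x ^+ 2)) @ U --> (0 : R).
Proof.
move=> FU Lv LD DB cD; apply/cvgr0Pnorm_lt => e e0; have [mv Iv] := Lv.
have B0 : 0 <= B := le_trans (int4_ge0 _) (DB 0%N).
(* eta is fixed first, so that eta B <= e / 3; then N is chosen depending on eta, and only then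
   n. *)
pose eta := e / (3 * (B + 1)).
have B1 : 0 < B + 1 by rewrite ltr_wpDl.
have eta0 : 0 < eta by rewrite divr_gt0// mulr_gt0.
pose T N := \int[mu]_x (v x ^+ 4) - \int[mu]_x (v x ^+ 4 * \1_(trunc v N) x).
have mt N : measurable (trunc v N) by exact: measurable_trunc.
have It N : intg mu (fun x => v x ^+ 4 * \1_(trunc v N) x).
  have m : meas4 (fun x => v x ^+ 4 * \1_(trunc v N) x).
    by apply: measurable_funM; [exact: measurable_funX|exact: measurable_indic].
  have b x : `|v x ^+ 4 * \1_(trunc v N) x| <= v x ^+ 4.
    have v4 : 0 <= v x ^+ 4 by rewrite exprn_even_ge0.
    rewrite normrM (ger0_norm v4) ler_piMr// indicE.
    by case: (_ \in _); rewrite ?normr1 ?normr0.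
  exact: (intg_le m b Iv).
have [N TN] : exists N, eta^-1 * T N < e / 3.
  have h : \int[mu]_x (v x ^+ 4 * \1_(trunc v n) x) @[n --> \oo] --> \int[mu]_x (v x ^+ 4).
    by apply: int_cut_cvg => // x _; exact: trunc_near.
  have p0 : 0 < eta * (e / 3) by rewrite mulr_gt0// divr_gt0.
  have /cvgr_dist_lt/(_ _ p0) [N _ /(_ N (leqnn N)) /= hN] := h.
  exists N; rewrite mulrC ltr_pdivrMr// [ltRHS]mulrC.
  exact: le_lt_trans (ler_norm _) hN.
have I2 n M : intg mu (fun x => D n x ^+ 2 * \1_(bx M) x) by exact: L4_sqr_box.
have c0 : 0 < e / (3 * (N%:R ^+ 2 + 1)) by rewrite divr_gt0// mulr_gt0// ltr_wpDl// sqr_ge0.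
have /cvgr0Pnorm_lt/(_ _ c0) := cD N; apply: filterS => n.
have J0 : 0 <= \int[mu]_x (D n x ^+ 2 * \1_(bx N) x).
  by apply: int_ge0 => x; rewrite mulr_ge0 ?sqr_ge0// indic_ge0.
rewrite ger0_norm// => hn; rewrite ger0_norm; last first.
  by apply: int_ge0 => x; rewrite mulr_ge0 ?sqr_ge0.
have [mD ID] := LD n.
have h : \int[mu]_x (v x ^+ 2 * D n x ^+ 2) <= \int[mu]_x (N%:R ^+ 2 * (D n x ^+ 2 * \1_(bx N) x)
    + (eta * D n x ^+ 4 + eta^-1 * (v x ^+ 4 - v x ^+ 4 * \1_(trunc v N) x))).
  apply: int_le; first exact: L4_sqrM.
    apply: intgD; first exact: intgZ.
    by apply: intgD; apply: intgZ => //; exact: intgB.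
  move=> x; set a := v x; set b := D n x.
  have e1 : eta * eta^-1 = 1 by rewrite divff// gt_eqF.
  have k0 : 0 <= eta^-1 by rewrite invr_ge0 ltW.
  have q : 0 <= eta * b ^+ 4 by rewrite mulr_ge0 ?exprn_even_ge0// ltW.
  have [xt|xt] := pselect (trunc v N x).
    have [xb vN] := xt; rewrite !indicE !mem_set// !mulr1 subrr mulr0 addr0.
    apply: (@le_trans _ _ (N%:R ^+ 2 * b ^+ 2)); last by rewrite lerDl.
    rewrite ler_wpM2r ?sqr_ge0// -[a ^+ 2]real_normK ?num_real//.
    by rewrite lerXn2r ?nnegrE.
  rewrite [\1_(trunc v N) x]indicE memNset// mulr0 subr0.
  apply: (@le_trans _ _ (eta * b ^+ 4 + eta^-1 * a ^+ 4)); last first.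
    by rewrite lerDr mulr_ge0 ?sqr_ge0// mulr_ge0 ?sqr_ge0// indic_ge0.
  have k1 : 0 <= eta * (b ^+ 2 - eta^-1 * a ^+ 2) ^+ 2 by rewrite mulr_ge0 ?sqr_ge0// ltW.
  have k2 : eta * (b ^+ 2 - eta^-1 * a ^+ 2) ^+ 2 = eta * b ^+ 4
     - 2 * (eta * eta^-1) * (a ^+ 2 * b ^+ 2) + (eta * eta^-1) * (eta^-1 * a ^+ 4) by ring.
  rewrite k2 e1 in k1; have := mulr_ge0 (sqr_ge0 a) (sqr_ge0 b); lra.
apply: (le_lt_trans h).
rewrite intD; [|exact: intgZ|by apply: intgD; apply: intgZ => //; exact: intgB].
rewrite intD; [|exact: intgZ|by apply: intgZ; exact: intgB].
rewrite !intZ//; last exact: intgB.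
rewrite intB// -/(T N).
have h1 : N%:R ^+ 2 * \int[mu]_x (D n x ^+ 2 * \1_(bx N) x) < e / 3.
  apply: (@le_lt_trans _ _ ((N%:R ^+ 2 + 1) * \int[mu]_x (D n x ^+ 2 * \1_(bx N) x))).
    by rewrite ler_wpM2r// lerDl.
  move: hn; rewrite ltr_pdivlMr ?mulr_gt0 ?ltr_wpDl ?sqr_ge0//; lra.
have h2 : eta * \int[mu]_x (D n x ^+ 4) <= e / 3.
  apply: (@le_trans _ _ (eta * (B + 1))).
    by rewrite ler_wpM2l ?(ltW eta0)// (le_trans (DB n))// lerDl.
  by rewrite le_eqVlt; apply/orP; left; apply/eqP; rewrite /eta; field; rewrite gt_eqF.
lra.
Qed.

(** A Brezis-Lieb splitting obtained without pointwise convergence, which U does not provide: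
    [nd_cross] reduces the error to a small multiple of L^4 norms plus mixed products, and the
    latter vanish by [cross_cvg0]. *)
Lemma Nfun_split (U : set_system nat) v z (D G : nat -> E -> R) (B : R) : Filter U ->
  L4 v -> L4 z -> (forall n, L4 (D n)) -> (forall n, L4 (G n)) ->
  (forall n, \int[mu]_x (D n x) ^+ 4 <= B) -> (forall n, \int[mu]_x (G n x) ^+ 4 <= B) ->
  (forall N, (fun n => \int[mu]_x (D n x ^+ 2 * \1_(bx N) x)) @ U --> (0 : R)) ->
  (forall N, (fun n => \int[mu]_x (G n x ^+ 2 * \1_(bx N) x)) @ U --> (0 : R)) ->
  (fun n => Nfun (fun x => v x + D n x) (fun x => z x + G n x)
            - Nfun v z - Nfun (D n) (G n)) @ U --> (0 : R).
Proof.
move=> FU Lv Lz LD LG DB GB cD cG.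
pose W n := \int[mu]_x (v x ^+ 2 * D n x ^+ 2) + \int[mu]_x (v x ^+ 2 * G n x ^+ 2) +
   \int[mu]_x (z x ^+ 2 * D n x ^+ 2) + \int[mu]_x (z x ^+ 2 * G n x ^+ 2).
have cW : W @ U --> (0 : R).
  rewrite (_ : 0 = 0 + 0 + 0 + 0 :> R); last by rewrite !addr0.
  apply: cvgD; last exact: cross_cvg0.
  by apply: cvgD; [apply: cvgD|]; exact: cross_cvg0.
apply/cvgr0Pnorm_lt => e e0.
have B0 : 0 <= B := le_trans (int4_ge0 _) (DB 0%N).
pose M := \int[mu]_x (v x ^+ 4) + \int[mu]_x (z x ^+ 4) + B + B.
have M0 : 0 <= M by rewrite !addr_ge0// int4_ge0.
have M1 : 0 < M + 1 by rewrite ltr_wpDl.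
(* 112 = 2 * 56, so the L^4 part of [nd_cross] contributes at most e / 2. *)
pose eps := e / (112 * (M + 1)).
have eps0 : 0 < eps by rewrite divr_gt0// mulr_gt0.
pose s := (4 * eps)^-1.
have s0 : 0 < s by rewrite invr_gt0 mulr_gt0.
have S0 : 0 < 28 * s + 21 by rewrite addr_gt0// mulr_gt0.
have c0 : 0 < e / (2 * (28 * s + 21)) by rewrite divr_gt0// mulr_gt0.
have /cvgr0Pnorm_lt/(_ _ c0) := cW; apply: filterS => n /(le_lt_trans (ler_norm _)).
rewrite ltr_pdivlMr ?mulr_gt0// => hn.
have LvD := L4D Lv (LD n); have LzG := L4D Lz (LG n).
rewrite !NfunE.
have i1 := nd_intg LvD LzG; have i2 := nd_intg Lv Lz; have i3 := nd_intg (LD n) (LG n).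
rewrite -intB// -intB//; last exact: intgB.
apply: le_lt_trans (le_normr_Rintegral _ _) _ => //.
  by apply: intgB => //; exact: intgB.
have [_ Iv] := Lv; have [_ Iz] := Lz; have [_ ID] := LD n; have [_ IG] := LG n.
have j1 : intg mu (fun x => v x ^+ 4 + z x ^+ 4) by exact: intgD.
have j2 : intg mu (fun x => v x ^+ 4 + z x ^+ 4 + D n x ^+ 4) by exact: intgD.
have j3 : intg mu (fun x => v x ^+ 4 + z x ^+ 4 + D n x ^+ 4 + G n x ^+ 4) by exact: intgD.
have q1 := L4_sqrM Lv (LD n); have q2 := L4_sqrM Lv (LG n).
have q3 := L4_sqrM Lz (LD n); have q4 := L4_sqrM Lz (LG n).
have q12 := intgD q1 q2; have q123 := intgD q12 q3; have q1234 := intgD q123 q4.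
apply: (@le_lt_trans _ _ (\int[mu]_x (56 * eps * (v x ^+ 4 + z x ^+ 4 + D n x ^+ 4 + G n x ^+ 4)
   + (28 * s + 21) * (v x ^+ 2 * D n x ^+ 2 + v x ^+ 2 * G n x ^+ 2 + z x ^+ 2 * D n x ^+ 2
       + z x ^+ 2 * G n x ^+ 2)))).
  apply: int_le.
  - by apply: integrable_norm; apply: intgB => //; exact: intgB.
  - by apply: intgD; exact: intgZ.
  - by move=> x; exact: nd_cross.
rewrite intD; [|exact: intgZ..]; rewrite !intZ//.
rewrite [\int[mu]_x (_ + G n x ^+ 4)]intD// [\int[mu]_x (_ + D n x ^+ 4)]intD// intD//.
rewrite (intD q123 q4) (intD q12 q3) (intD q1 q2) -/(W n).
have h1 : 56 * eps * (\int[mu]_x v x ^+ 4 + \int[mu]_x z x ^+ 4 + \int[mu]_x D n x ^+ 4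
    + \int[mu]_x G n x ^+ 4) <= e / 2.
  apply: (@le_trans _ _ (56 * eps * (M + 1))).
    apply: ler_wpM2l; first by apply: mulr_ge0 => //; exact: ltW.
    rewrite /M; have := DB n; have := GB n; lra.
  by rewrite le_eqVlt; apply/orP; left; apply/eqP; rewrite /eps; field; rewrite gt_eqF.
rewrite [ltRHS]splitr; apply: (ler_ltD h1).
by rewrite ltr_pdivlMr// mulrC mulrA mulrC.
Qed.

End functional.

(** * Minimizing sequences *)

Section profile.
Variable R : realType.
Local Notation E := (R4 R).
Local Notation E4 := (E4 R).
Local Notation mu := (lam4 R).
Local Notation cube := (@cube R).
Local Notation bx N := (box4 `[- (N%:R : R), N%:R]).
Implicit Types (u v w f phi : E -> R) (g k : 'I_4 -> E -> R).

Lemma En_sub u v g k : H1 u g -> H1 v k ->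
  En (fun x => u x - v x) = En u - 2 * (\sum_(i < 4) \int[mu]_x (g i x * k i x)) + En v.
Proof.
move=> Hu Hv; rewrite (EnE (H1B Hu Hv)) (EnE Hu) (EnE Hv) mulr_sumr -sumrB -big_split /=.
have [_ Lg _] := Hu; have [_ Lk _] := Hv.
apply: eq_bigr => i _; have := int_sqrDZ (-1) (Lg i) (Lk i).
under eq_Rintegral do rewrite mulN1r.
by move=> ->; rewrite sqrrN expr1n mul1r mulrN1 mulNr.
Qed.

Lemma En_sub_le u v g k : H1 u g -> H1 v k ->
  En (fun x => u x - v x) <= 2 * En u + 2 * En v.
Proof.
move=> Hu Hv; have Hs := H1D Hu Hv; have := En_ge0 (fun x => u x + v x).
have [_ Lg _] := Hu; have [_ Lk _] := Hv.
have -> : En (fun x => u x + v x) = En u + 2 * (\sum_(i < 4) \int[mu]_x (g i x * k i x)) + En v.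
  rewrite (EnE Hs) (EnE Hu) (EnE Hv) mulr_sumr -!big_split /=.
  by apply: eq_bigr => i _; rewrite int_sqrD.
rewrite (En_sub Hu Hv); move: (En u) (En v) (\sum_i _) => a b c; lra.
Qed.

(** Expanding the square, En (V n) - En (V n - v) is 2 <grad (V n), k> - En v with k the gradient of
    v; weak convergence tested on k itself turns this into En v. The bound B is Sobolev applied to
    the remainders. *)
Lemma profile (U : set_system nat) (V : nat -> E -> R) (C : R) : UltraFilter U ->
  (forall n, Hdot1 (V n)) -> (forall n, En (V n) <= C) ->
  exists v (B : R), [/\ Hdot1 v, forall n, Hdot1 (fun x => V n x - v x),
    forall n, \int[mu]_x (V n x - v x) ^+ 4 <= B,
    forall N, (fun n => \int[mu]_x ((V n x - v x) ^+ 2 * \1_(bx N) x)) @ U --> (0 : R) &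
    (fun n => En (V n) - En (fun x => V n x - v x)) @ U --> En v].
Proof.
move=> UU HV VC; have G n : H1 (V n) (grad (V n)) by exact: H1_grad.
have [v [k [Hv wv wg]]] := weak_H1 UU G VC.
have [c c0 sob] := sobolev R.
have HD n := H1B (G n) Hv.
pose C' := 2 * C + 2 * En v.
have DC n : En (fun x => V n x - v x) <= C'.
  apply: (le_trans (En_sub_le (G n) Hv)); rewrite lerD2r.
  by rewrite ler_wpM2l.
have [Lv Lk _] := Hv.
exists v, ((c * C') ^+ 2); split.
- by apply/Hdot1P; exists k.
- by move=> n; apply/Hdot1P; eexists; exact: HD.
- move=> n; apply: (le_trans (sob _ _ (HD n))).
  have C0 := le_trans (En_ge0 _) (DC n).
  by rewrite lerXn2r ?nnegrE ?mulr_ge0 ?En_ge0 ?(ltW c0)// ler_wpM2l// ltW.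
- move=> N; apply: (@rellich R U _ _ C' N _ HD DC) => f bf.
  rewrite (_ : (fun n => _) = (fun n => \int[mu]_x (V n x * f x) - \int[mu]_x (v x * f x))).
    by apply/subr_cvg0; exact: wv.
  apply/funext => n; rewrite -intB; [|by apply: L4_bdd_supp; case: (G n)|exact: L4_bdd_supp].
  by apply: eq_Rintegral => x _; rewrite mulrBl.
- rewrite (_ : (fun n => _) = (fun n => 2 * (\sum_(i < 4) \int[mu]_x (grad (V n) i x * k i x)) - En v)).
    rewrite [X in _ --> X](_ : En v = 2 * En v - En v); last by move: (En v) => a; ring.
    apply: cvgB; last exact: cvg_cst.
    apply: cvgM; first exact: cvg_cst.
    rewrite (EnE Hv).
    apply: cvg_big => [|i _]; first exact: add_continuous.
    under [X in _ --> X]eq_Rintegral do rewrite expr2.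
    exact: wg.
  apply/funext => n; rewrite (En_sub (G n) Hv).
  by move: (En _) (\sum_i _) (En v) => a b e; ring.
Qed.

Lemma cube_int_cvg0 (U : set_system nat) (D : nat -> E -> R) : Filter U ->
  (forall n, L4 (D n)) ->
  (forall N, (fun n => \int[mu]_x (D n x ^+ 2 * \1_(bx N) x)) @ U --> (0 : R)) ->
  (fun n => \int[mu]_h (\1_cube h * `|D n h|)) @ U --> (0 : R).
Proof.
move=> FU LD cD; apply/cvgr0Pnorm_lt => e e0.
have e2 : 0 < e ^+ 2 by rewrite exprn_gt0.
have /cvgr0Pnorm_lt/(_ _ e2) := cD 1%N; apply: filterS => n.
move=> /(le_lt_trans (ler_norm _)) hn.
have La : L4 (fun x => `|D n x|).
  have [mD ID] := LD n; split; first exact: measurableT_comp.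
  by apply: intg_ext ID => x; rewrite -normrX ger0_norm// exprn_even_ge0.
have Lq := L4_cube_L2 La.
rewrite -(@ltr_pXn2r _ 2) ?nnegrE ?(ltW e0)// real_normK ?num_real//.
apply: le_lt_trans hn.
have -> : \int[mu]_h (\1_cube h * `|D n h|) = \int[mu]_h (\1_cube h * (\1_cube h * `|D n h|)).
  by apply: eq_Rintegral => h _; rewrite mulrA -expr2 cube_sqr.
apply: (le_trans (cube_cauchy_schwarz Lq)); apply: int_le; first exact: L2_intg.
  exact: L4_sqr_box.
move=> h; rewrite exprMn cube_sqr real_normK ?num_real// mulrC ler_wpM2l ?sqr_ge0//.
rewrite !indicE ler_nat; have [/set_mem hc|//] := boolP (h \in cube).
rewrite mem_set//; apply/box4P; move: hc => /box4P; rewrite !in_itv /= => -[? ? ? ?].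
by split; lra.
Qed.

Lemma cube_int_small u (t : R) : L4 u -> 0 < t -> \int[mu]_x u x ^+ 4 <= t ^+ 4 ->
  \int[mu]_h (\1_cube h * `|u h|) <= 2 * t.
Proof.
move=> Lu t0 ut; have [_] := morrey_L4 Lu t0 ut 0 ltr01.
by rewrite divr1; under eq_Rintegral do rewrite add0r scale1r.
Qed.

(** From 1 = N <= 3 (|u|_4^4 + |w|_4^4), one component has |.|_4^4 >= 1/6 and [nonvanishing] applies
    to it. Which one may vary with the pair, so the conclusion bounds the sum of both averages. *)
Lemma concentration (C : R) : 0 <= C -> exists2 dl : R, 0 < dl &
  forall u w, Hdot1 u -> Hdot1 w -> Nfun u w = 1 -> En u + En w <= C ->
  exists (x : E) (r : R), 0 < r /\
    dl < \int[mu]_h (\1_cube h * `|resc r x u h|) + \int[mu]_h (\1_cube h * `|resc r x w h|).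
Proof.
move=> C0.
have aux (a b : R) : 1 <= 3 * (a + b) -> a < 6^-1 -> 6^-1 <= b by lra.
have [K K0 nonv] := nonvanishing R.
have [dl d0 hd] : exists2 dl : R, 0 < dl & forall a : R, a <= C -> K * dl ^+ 2 * a < 6^-1.
  (* This makes K dl^2 a = a / (12 (C + 1)), which is below 1/6 for all a <= C. *)
  pose dl := Num.sqrt (12 * K * (C + 1))^-1.
  have C1 : 0 < C + 1 by rewrite ltr_wpDl.
  have p0 : 0 < (12 * K * (C + 1))^-1 by rewrite invr_gt0 !mulr_gt0.
  exists dl; first by rewrite sqrtr_gt0.
  move=> a aC; rewrite sqr_sqrtr ?(ltW p0)//.
  rewrite (_ : _ * a = (12 * (C + 1))^-1 * a); last by field; rewrite !gt_eqF.
  rewrite mulrC ltr_pdivrMr ?mulr_gt0//; lra.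
exists dl => // u w Hu Hw N1 KC.
have G1 := H1_grad Hu; have G2 := H1_grad Hw; have [Lu _ _] := G1; have [Lw _ _] := G2.
have cge0 (f : E -> R) : 0 <= \int[mu]_h (\1_cube h * `|f h|).
  by apply: int_ge0 => h; rewrite mulr_ge0// indic_ge0.
have := Nfun_le Lu Lw; rewrite N1 => h.
have [h1|h1] := lerP (6^-1) (\int[mu]_x u x ^+ 4).
  have [x [r [r0 hx]]] : exists (x : E) (r : R), 0 < r /\ dl < \int[mu]_h (\1_cube h * `|resc r x u h|).
    apply: (nonv _ _ _ G1 d0); apply: lt_le_trans h1; apply: hd.
    by apply: le_trans KC; rewrite lerDl En_ge0.
  by exists x, r; split=> //; rewrite ltr_wpDr.
have [x [r [r0 hx]]] : exists (x : E) (r : R), 0 < r /\ dl < \int[mu]_h (\1_cube h * `|resc r x w h|).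
  apply: (nonv _ _ _ G2 d0); apply: (@lt_le_trans _ _ 6^-1); last exact: aux h h1.
  by apply: hd; apply: le_trans KC; rewrite lerDr En_ge0.
by exists x, r; split=> //; rewrite ltr_wpDl.
Qed.

Lemma Hdot1_resc (r : R) (x : E) u : 0 < r -> Hdot1 u -> Hdot1 (resc r x u).
Proof. by move=> r0 /H1_grad G; apply/Hdot1P; eexists; exact: H1_resc G. Qed.

(** Since U contains all tails, each set where |a| < 1 / (j + 1) has elements beyond any given
    index, and the next term can be picked there. *)
Lemma ultra_subseq (U : set_system nat) (a : nat -> R) : ProperFilter U -> \oo `<=` U ->
  a @ U --> (0 : R) ->
  exists phi : nat -> nat, (forall j, (phi j < phi j.+1)%N) /\ a \o phi @ \oo --> (0 : R).
Proof.
move=> FU oU aU.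
have /choice[f Hf] (jp : nat * nat) : exists m, (jp.2 < m)%N /\ `|a m| < jp.1.+1%:R^-1.
  have j0 : 0 < jp.1.+1%:R^-1 :> R by rewrite invr_gt0.
  have /cvgr0Pnorm_lt/(_ _ j0) h1 := aU.
  have h2 : U [set m | (jp.2 < m)%N] by apply: oU; exact: nbhs_infty_gt.
  by have [m []] := filter_ex (filterI h2 h1); exists m.
pose phi := fix F j := if j is i.+1 then f (i.+1, F i) else f (0%N, 0%N).
have ph j : `|a (phi j)| < j.+1%:R^-1 
  by case: j => [|j]; [exact: (Hf (0%N, 0%N)).2|exact: (Hf (j.+1, phi j)).2].
exists phi; split; first by move=> j /=; case: (Hf (j.+1, phi j)).
apply/cvgr0Pnorm_lt => e e0; near=> j; apply: (lt_trans (ph j)); near: j.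
exact: near_infty_natSinv_lt (PosNum e0).
Unshelve. all: by end_near. Qed.

End profile.

Lemma split_dichotomy (R : realType) (I k b : R) : 0 < I -> 0 <= k -> k <= I ->
  I ^+ 2 * b <= k ^+ 2 -> I ^+ 2 * (1 - b) <= (I - k) ^+ 2 -> k = 0 \/ k = I.
Proof.
move=> I0 k0 kI h1 h2; have h : k * (I - k) <= 0 by nra.
have := mulr_ge0 k0 (_ : 0 <= I - k); rewrite subr_ge0 => /(_ kI) h3.
have : k * (I - k) == 0 by rewrite eq_le h h3.
by rewrite mulf_eq0 subr_eq0 => /orP[/eqP|/eqP]; [left|right].
Qed.

(** Here a and b are the cube averages of the rescaled pair, p and q those of the weak limit, a' and
    b' those of the remainder. *)
Lemma remainder_lower (R : realType) (d a b p q a' b' t : R) : d < a + b ->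
  a <= p + a' -> b <= q + b' -> p <= 2 * t -> q <= 2 * t -> d - 4 * t <= a' + b'.
Proof. by move=> *; lra. Qed.

Lemma eighth_lt (R : realType) (d : R) : 0 < d -> d - 4 * (d / 8) <= 0 -> False.
Proof. by move=> *; lra. Qed.

Theorem theorem3p11 (R : realType) (u w : nat -> R4 R -> R) :
  (forall m, inNN (u m) (w m)) ->
  (forall m, Nfun (u m) (w m) = 1) ->
  (forall m, {ae @leb4 R, forall x, 0 <= u m x}) ->
  (forall m, {ae @leb4 R, forall x, 0 <= w m x}) ->
  (fun m => Kfun (u m) (w m)) @ \oo --> Ival R ->
  exists (phi : nat -> nat) (Rs : nat -> R) (y : nat -> R4 R) (v z : R4 R -> R),
    (forall j, (phi j < phi j.+1)%N) /\
    (forall j, 0 < Rs j) /\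
    (forall j, Hdot1 (rescale (Rs j) (y j) (u (phi j))) /\
               Hdot1 (rescale (Rs j) (y j) (w (phi j)))) /\
    (fun j => Kfun (rescale (Rs j) (y j) (u (phi j)) \- v)
                   (rescale (Rs j) (y j) (w (phi j)) \- z)) @ \oo --> 0 /\
    inNN v z /\ Nfun v z = 1 /\ Kfun v z = Ival R.
Proof.
move=> HN N1 _ _ KI.
have Hu m : Hdot1 (u m) by case: (HN m).
have Hw m : Hdot1 (w m) by case: (HN m) => _ [].
have KE m : Kfun (u m) (w m) = En (u m) + En (w m) by exact: KfunE.
have I0 : 0 < Ival R.
  have [c c0 Kc] := K_lower R; apply: (lt_le_trans c0).
  by apply: (cvgr_to_ge KI); apply: nearW => m; rewrite KE Kc.
have [C KC] : exists C, forall m, En (u m) + En (w m) <= C.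
  have /cvg_seq_bounded [M [_ HM]] : cvgn (fun m => Kfun (u m) (w m)) by apply/cvg_ex; eexists; exact: KI.
  exists (`|M| + 1) => m; rewrite -KE; apply: (le_trans (ler_norm _)).
  by apply: HM => //; rewrite (le_lt_trans (ler_norm M))// ltrDl.
have C0 : 0 <= C by apply: le_trans (KC 0%N); rewrite addr_ge0// En_ge0.
have [dl d0 Hdl] := concentration C0.
have /choice[xr Hxr] m : exists xr : R4 R * R, 0 < xr.2 /\
    dl < \int[lam4 R]_h (\1_(@cube R) h * `|resc xr.2 xr.1 (u m) h|) +
         \int[lam4 R]_h (\1_(@cube R) h * `|resc xr.2 xr.1 (w m) h|).
  by have [x [r h]] := Hdl _ _ (Hu m) (Hw m) (N1 m) (KC m); exists (x, r).
pose V m := resc (xr m).2 (xr m).1 (u m); pose Z m := resc (xr m).2 (xr m).1 (w m).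
have r0 m : 0 < (xr m).2 by case: (Hxr m).
have HV m : Hdot1 (V m) by exact: Hdot1_resc.
have HZ m : Hdot1 (Z m) by exact: Hdot1_resc.
have EV m : En (V m) = En (u m) by exact: En_resc.
have EZ m : En (Z m) = En (w m) by exact: En_resc.
have L4H (f : R4 R -> R) : Hdot1 f -> L4 f by move=> /H1_grad[].
have NVZ m : Nfun (V m) (Z m) = 1 by rewrite Nfun_resc//; exact: L4H.
(* U refines [\oo], so K -> I persists along U, and [oU] is also what permits returning to a
   subsequence at the end. *)
have [U [UU oU]] := ultraFilterLemma (eventually_filter : ProperFilter (\oo : set_system nat)).
have VC m : En (V m) <= C by rewrite EV (le_trans _ (KC m))// lerDl En_ge0.
have ZC m : En (Z m) <= C by rewrite EZ (le_trans _ (KC m))// lerDr En_ge0.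
have [v [B1 [Hv HD DB cD eD]]] := profile UU HV VC.
have [z [B2 [Hz HG GB cG eG]]] := profile UU HZ ZC.
pose D m x := V m x - v x; pose G m x := Z m x - z x.
have LD m : L4 (D m) := L4H _ (HD m).
have LG m : L4 (G m) := L4H _ (HG m).
have Lv := L4H _ Hv; have Lz := L4H _ Hz.
pose k := En v + En z; pose b := Nfun v z.
have k0 : 0 <= k by rewrite addr_ge0// En_ge0.
have KU : (fun m => En (V m) + En (Z m)) @ U --> Ival R.
  have -> : (fun m => En (V m) + En (Z m)) = (fun m => Kfun (u m) (w m)).
    by apply/funext => m; rewrite KE EV EZ.
  by apply: cvg_trans KI; exact: cvg_app.
have cK : (fun m => En (D m) + En (G m)) @ U --> Ival R - k.
  have -> : (fun m => En (D m) + En (G m)) = (fun m => (En (V m) + En (Z m)) -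
      ((En (V m) - En (fun x => V m x - v x)) + (En (Z m) - En (fun x => Z m x - z x)))).
    apply/funext => m; rewrite -/(D m) -/(G m).
    by move: (En (V m)) (En (Z m)) (En (D m)) (En (G m)) => a1 a2 a3 a4; ring.
  exact: (cvgB KU (cvgD eD eG)).
have cN : (fun m => Nfun (D m) (G m)) @ U --> 1 - b.
  have DB' m : \int[lam4 R]_x (D m x) ^+ 4 <= Num.max B1 B2 by rewrite le_max DB.
  have GB' m : \int[lam4 R]_x (G m x) ^+ 4 <= Num.max B1 B2 by rewrite le_max GB orbT.
  have c1 : (fun m => Nfun (fun x => v x + D m x) (fun x => z x + G m x)
      - Nfun v z - Nfun (D m) (G m)) @ U --> (0 : R).
    exact: (Nfun_split _ Lv Lz LD LG DB' GB' cD cG).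
  have -> : (fun m => Nfun (D m) (G m)) = (fun m => (1 - b) -
      (Nfun (fun x => v x + D m x) (fun x => z x + G m x) - Nfun v z - Nfun (D m) (G m))).
    apply/funext => m; rewrite -/b.
    have -> : (fun x => v x + D m x) = V m by apply/funext => x; rewrite /D addrC subrK.
    have -> : (fun x => z x + G m x) = Z m by apply/funext => x; rewrite /G addrC subrK.
    by rewrite NVZ; move: (Nfun (D m) (G m)) => a; ring.
  by rewrite -[X in _ --> X]subr0; exact: (cvgB (cvg_cst (1 - b)) c1).
have kI : k <= Ival R.
  rewrite -subr_ge0; apply: (cvgr_to_ge cK); apply: nearW => m.
  by rewrite addr_ge0// En_ge0.
have b1 : b <= 1.
  rewrite -subr_ge0; apply: (cvgr_to_ge cN); apply: nearW => m.
  exact: Nfun_ge0.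
have h1 : Ival R ^+ 2 * b <= k ^+ 2 by apply: Ival_bound => //; exact: ltW.
have h2 : Ival R ^+ 2 * (1 - b) <= (Ival R - k) ^+ 2.
  have c1 : (fun m => Ival R ^+ 2 * Nfun (D m) (G m)) @ U --> Ival R ^+ 2 * (1 - b).
    by apply: cvgM => //; exact: cvg_cst.
  have c2 : (fun m => (En (D m) + En (G m)) ^+ 2) @ U --> (Ival R - k) ^+ 2.
    by rewrite expr2; apply: cvgM.
  apply: (ler_cvg_to c1 c2); apply: nearW => m.
  exact: (Ival_bound (HD m) (HG m) (ltW I0)).
(* If k = 0, then v and z have zero energy, hence zero L^4 norm by Sobolev, and their cube averages
   are at most 2 t for any t > 0. The averages of the remainders would then stay above dl - 4 t,
   although they tend to 0; t = dl / 8 makes this bound dl / 2. *)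
have kn : k != 0.
  apply/eqP => kz.
  have Ev : En v = 0 by apply/le_anti; rewrite En_ge0 andbT -kz lerDl En_ge0.
  have Ez : En z = 0 by apply/le_anti; rewrite En_ge0 andbT -kz lerDr En_ge0.
  have [c c0 sob] := sobolev R.
  pose t := dl / 8; have t0 : 0 < t by rewrite divr_gt0.
  have small (f : R4 R -> R) : Hdot1 f -> En f = 0 ->
      \int[lam4 R]_h (\1_(@cube R) h * `|f h|) <= 2 * t.
    move=> Hf Ef; apply: cube_int_small => //; first exact: L4H.
    apply: (le_trans (sob _ _ (H1_grad Hf))).
    by rewrite Ef mulr0 expr0n exprn_ge0// ltW.
  have c1 : (fun m => \int[lam4 R]_h (\1_(@cube R) h * `|D m h|)) @ U --> (0 : R).
    exact: cube_int_cvg0.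
  have c2 : (fun m => \int[lam4 R]_h (\1_(@cube R) h * `|G m h|)) @ U --> (0 : R).
    exact: cube_int_cvg0.
  have tri (f g : R4 R -> R) : L4 f -> L4 g ->
      \int[lam4 R]_h (\1_(@cube R) h * `|g h|) <=
      \int[lam4 R]_h (\1_(@cube R) h * `|f h|) +
      \int[lam4 R]_h (\1_(@cube R) h * `|g h - f h|).
    move=> Lf Lg; have Lgf : L4 (fun x => g x - f x).
      have := L4D Lg (L4Z (-1) Lf); congr L4.
      by apply/funext => x; rewrite mulN1r.
    have if_ := intg_cube_L4 Lf; have igf := intg_cube_L4 Lgf.
    rewrite -intD//; apply: int_le; [exact: intg_cube_L4|exact: intgD|].
    move=> h; rewrite -mulrDr ler_wpM2l ?indic_ge0//.
    by rewrite -{1}(subrK (f h) (g h)) addrC ler_normD.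
  suff : dl - 4 * t <= 0 by exact: eighth_lt.
  have c3 : (fun m => \int[lam4 R]_h (\1_(@cube R) h * `|D m h|) +
      \int[lam4 R]_h (\1_(@cube R) h * `|G m h|)) @ U --> (0 : R).
    by rewrite -[X in _ --> X]addr0; exact: (cvgD c1 c2).
  apply: (cvgr_to_ge c3); apply: nearW => m; have [_ hm] := Hxr m.
  exact: (remainder_lower hm (tri _ _ Lv (L4H _ (HV m))) (tri _ _ Lz (L4H _ (HZ m)))
    (small _ Hv Ev) (small _ Hz Ez)).
have kE : k = Ival R.
  by case: (split_dichotomy I0 k0 kI h1 h2) => // /eqP; rewrite (negbTE kn).
(* With k = I the bound on the remainder reads I^2 (1 - b) <= 0. *)
have bE : b = 1.
  apply/le_anti; rewrite b1 /= -subr_le0.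
  move: h2; rewrite kE subrr expr0n /= pmulr_rle0// exprn_gt0//.
rewrite kE subrr in cK.
have [phi [phi_inc cphi]] := ultra_subseq _ oU cK.
(* These parameters solve r = R^-1 and x = - R^-1 y, which turn [rescale R y] into [resc r x]. *)
exists phi, (fun j => (xr (phi j)).2^-1),
  (fun j => - ((xr (phi j)).2^-1 *: (xr (phi j)).1)), v, z.
have resE m (f : R4 R -> R) :
    rescale (xr m).2^-1 (- ((xr m).2^-1 *: (xr m).1)) f = resc (xr m).2 (xr m).1 f.
  rewrite rescaleE invrK scalerN opprK scalerA mulrV ?unitfE ?gt_eqF// scale1r//.
split; first exact: phi_inc.
split; first by move=> j; rewrite invr_gt0.
split; first by move=> j; rewrite !resE; split; [exact: HV|exact: HZ].
split.
  rewrite (_ : (fun j => _) = (fun m => En (D m) + En (G m)) \o phi)//.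
  by apply/funext => j; rewrite !resE; exact: (KfunE (HD (phi j)) (HG (phi j))).
split; last by rewrite -/b bE KfunE// -/k kE.
by split=> //; split=> //; rewrite -/b bE.
Qed.
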